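(* Let $d\in(0,\frac12)$, let $L^d$ be a fractional L\'evy process, and let $\lambda>0$. Then the unique stationary pathwise solution of the Langevin equation $$d\mathcal L_t=-\lambda\mathcal L_t\,dt+dL^d_t,\qquad t\in\mathbb R,$$ is given almost surely by the fractional L\'evy--Ornstein--Uhlenbeck process $$\mathcal L^{d,\lambda}_t=\int_{-\infty}^te^{-\lambda(t-u)}\,dL^d_u,\qquad t\in\mathbb R.$$ That is, $\mathcal L^{d,\lambda}$ is a stationary pathwise solution, and every stationary pathwise solution $(X_t)_{t\in\mathbb R}$ satisfies $(X_t)_{t\in\mathbb R}=(\mathcal L^{d,\lambda}_t)_{t\in\mathbb R}$ almost surely.
   Context: All random objects live on a complete probability space $(\Omega,\mathcal F,P)$. A two-sided L\'evy process is $L_t=L^1_t1_{\{t\ge0\}}+L^2_{-t-}1_{\{t<0\}}$, $t\in\mathbb R$, where $L^1,L^2$ are two independent copies of the same L\'evy process. Fractional L\'evy process (FLP): let $L=(L_t)_{t\in\mathbb R}$ be a zero-mean two-sided L\'evy process with $E[L(1)^2]<\infty$ and without Brownian component, and $d\in(0,\frac12)$; the FLP with driving L\'evy process $L$ is $$L^d_t:=\frac{1}{\Gamma(d+1)}\int_{-\infty}^\infty[(t-s)_+^d-(-s)_+^d]\,L(ds),\quad t\in\mathbb R,$$ where the integral exists in the $L^2(\Omega)$-sense. One always works with the modification given by the pathwise improper Riemann integral $$L^d_t=\frac{1}{\Gamma(d)}\int_{\mathbb R}[(t-s)_+^{d-1}-(-s)_+^{d-1}]\,L(s)\,ds,\quad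 t\in\mathbb R,$$ which is continuous in $t$. The integral defining $\mathcal L^{d,\lambda}_t$ is a pathwise improper Riemann--Stieltjes integral, which exists almost surely for all $t$. A pathwise solution of the Langevin equation is a process $X$ with continuous sample paths such that, almost surely, $X_t-X_s=-\lambda\int_s^tX_u\,du+L^d_t-L^d_s$ for all $s\le t$ in $\mathbb R$. A process $X$ is stationary if $(X_{t_1},\dots,X_{t_m})\stackrel{d}{=}(X_{t_1+h},\dots,X_{t_m+h})$ for all $m\in\mathbb N$, $t_1<\dots<t_m$, $h\in\mathbb R$.
   Formalization: The two-sided Lévy process is taken as L_t = L^1_t for t ≥ 0 and −L^2_{−t−} for t < 0: with the printed plus sign the process is not stationary for non-symmetric drivers (e.g. compensated Poisson); symmetric drivers are unaffected. *)

(* Defs.v *)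
From HB Require Import structures.
From mathcomp Require Import all_boot all_order all_algebra.
From mathcomp Require Import all_classical all_reals all_analysis.

Set Implicit Arguments.
Unset Strict Implicit.
Unset Printing Implicit Defensive.

Import Order.TTheory GRing.Theory Num.Theory.
Import numFieldNormedType.Exports.

Local Open Scope classical_set_scope.
Local Open Scope ring_scope.

Section RiemannStieltjes.
Context {R : realType}.
Implicit Types (f g : R -> R) (a b t I : R).

(* [is_RS_int f g a b I]: the Riemann-Stieltjes integral of f with respect to
   the integrator g over [a, b] exists and equals I, as the limit of the sums
   over the tagged partitions a = x 0 <= xi 0 <= x 1 <= ... <= x n = b when the
   mesh tends to 0. The Riemann integral is the case g = id. *)
Definition is_RS_int f g a b I : Prop :=
  a <= b /\
  forall e, 0 < e -> exists2 delta, 0 < delta &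
    forall (n : nat) (x xi : nat -> R),
      x 0%N = a -> x n = b ->
      (forall i, (i < n)%N ->
        [/\ x i <= xi i, xi i <= x i.+1 & x i.+1 - x i < delta]) ->
      `| \sum_(i < n) f (xi i) * (g (x i.+1) - g (x i)) - I | < e.

Definition RS_integrable f g a b : Prop := exists I, is_RS_int f g a b I.

(* 0 when the integral does not exist. *)
Definition RS_int f g a b : R := xget 0 [set I | is_RS_int f g a b I].

(* Improper Riemann-Stieltjes integral over ]-oo, t]. *)
Definition is_RS_int_ninfty f g t I : Prop :=
  (forall a, a <= t -> RS_integrable f g a t) /\
  RS_int f g a t @[a --> -oo] --> I.

Definition RS_int_ninfty f g t : R :=
  xget 0 [set I | is_RS_int_ninfty f g t I].

(* Improper Riemann integral over the open interval ]a, b[: f is Riemann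
   integrable on every [u, v] inside ]a, b[ and the integrals converge
   when u tends to a and v to b independently. *)
Definition is_improper_Rint_on f (a b : \bar R) I : Prop :=
  (forall u v, (a < u%:E)%E -> u <= v -> (v%:E < b)%E ->
     RS_integrable f id u v) /\
  forall e, 0 < e -> exists u0 v0 : R,
    [/\ (a < u0%:E)%E, u0 <= v0, (v0%:E < b)%E &
      forall u v, (a < u%:E)%E -> u <= u0 -> v0 <= v -> (v%:E < b)%E ->
        `| RS_int f id u v - I | < e].

(* Improper Riemann integral over ]a, +oo[ with exceptional points s. *)
Fixpoint is_improper_Rint_from f (a : \bar R) (s : seq R) I : Prop :=
  if s is p :: s' then
    exists J K, [/\ is_improper_Rint_on f a p%:E J,
                    is_improper_Rint_from f p%:E s' K & I = J + K]
  else is_improper_Rint_on f a +oo%E I.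

(* Improper Riemann integral over the real line: f may be unbounded near
   finitely many points, and I does not depend on the choice of a list s of
   such points. *)
Definition is_improper_Rint f I : Prop :=
  exists s : seq R, sorted <%R s /\ is_improper_Rint_from f -oo%E s I.

Definition improper_Rint f : R := xget 0 [set I | is_improper_Rint f I].

End RiemannStieltjes.

Section Processes.
Context {R : realType} {disp : measure_display} {Omega : measurableType disp}.
Variable P : probability Omega R.
Implicit Types X Y L : R -> Omega -> R.

(* A process is indexed by R; for one-sided processes only the values at
   nonnegative times matter. *)
Definition is_process (T : set R) X : Prop :=
  forall t, T t -> measurable_fun [set: Omega] (X t).

Definition eq_in_law d' (E : measurableType d') (U V : Omega -> E) : Prop :=
  forall A : set E, measurable A -> P (U @^-1` A) = P (V @^-1` A).

Definition fdd X (m : nat) (t : 'I_m -> R) (w : Omega) : m.-tuple R :=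
  [tuple X (t i) w | i < m].

Definition eq_fdd (T : set R) X Y : Prop :=
  forall (m : nat) (t : 'I_m -> R), (forall i, T (t i)) ->
    eq_in_law (fdd X t) (fdd Y t).

Definition sigma_of (T : set R) X : set (set Omega) :=
  <<s [set A | exists t, T t /\
                 exists2 B : set R, measurable B & A = X t @^-1` B] >>.

Definition indep_processes (T : set R) X Y : Prop :=
  forall A B, sigma_of T X A -> sigma_of T Y B ->
    P (A `&` B) = (P A * P B)%E.

Definition indep_increments X : Prop :=
  forall (m : nat) (t : nat -> R) (B : nat -> set R),
    0 <= t 0%N -> (forall i, t i < t i.+1) ->
    (forall i, measurable (B i)) ->
    P (\bigcap_(i in `I_m) [set w | B i (X (t i.+1) w - X (t i) w)]) =
    (\prod_(i < m) P [set w | B i (X (t i.+1) w - X (t i) w)%R])%E.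

Definition stationary_increments X : Prop :=
  forall s h : R, 0 <= s -> 0 <= h ->
    eq_in_law (fun w => X (s + h) w - X s w) (fun w => X h w - X 0 w).

Definition continuous_in_probability X : Prop :=
  forall t e : R, 0 <= t -> 0 < e ->
    P [set w | e < `|X s w - X t w|]
      @[s --> within [set s : R | 0 <= s] (nbhs t)] --> 0%E.

Definition cadlag (x : R -> R) : Prop :=
  forall t : R, 0 <= t ->
    x s @[s --> t^'+] --> x t /\ (0 < t -> cvg (x s @[s --> t^'-])).

Definition Levy_process X : Prop :=
  [/\ is_process [set t : R | 0 <= t] X,
      {ae P, forall w, X 0 w = 0},
      indep_increments X & stationary_increments X] /\
  continuous_in_probability X /\ {ae P, forall w, cadlag (X ^~ w)}.

(* The Gaussian variance in the Levy-Khintchine triplet of the law of X_1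
   is zero: E[exp(iu X_1)] = exp(psi u), where
     psi u = i u c + \int (exp(iux) - 1 - iux 1_{|x| <= 1}) nu(dx)
   for a Levy measure nu. Both sides are split into real and imaginary parts. *)
Definition no_Brownian_component X : Prop :=
  exists (c : R) (nu : {measure set R -> \bar R}),
    [/\ nu [set 0] = 0%E,
        (\int[nu]_x (Num.min 1 (x ^+ 2))%:E < +oo)%E &
        forall u : R,
          let re := \int[nu]_x (cos (u * x) - 1) in
          let im := u * c +
            \int[nu]_x (sin (u * x) - u * x * (`|x| <= 1)%R%:R) in
          ('E_P[fun w => cos (u * X 1 w)%R])%E = (expR re * cos im)%:E /\
          ('E_P[fun w => sin (u * X 1 w)%R])%E = (expR re * sin im)%:E].

(* The minus sign is needed for L to have stationary increments across time 0:
   dropping it gives increments distributed as those of - L^2 at negative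
   times, whose law differs from that of the increments of L^1 in general. *)
Definition two_sided (L1 L2 : R -> Omega -> R) : R -> Omega -> R :=
  fun t w => if 0 <= t then L1 t w else - lim (L2 s w @[s --> (- t)^'-]).

Definition two_sided_Levy L : Prop :=
  exists L1 L2 : R -> Omega -> R,
    [/\ Levy_process L1, Levy_process L2,
        eq_fdd [set t : R | 0 <= t] L1 L2,
        indep_processes [set t : R | 0 <= t] L1 L2 & L = two_sided L1 L2].

Definition driving_Levy L : Prop :=
  [/\ two_sided_Levy L,
      no_Brownian_component L,
      forall t, ('E_P[L t])%E = 0%E &
      ('E_P[fun w => (L 1 w ^+ 2)%R] < +oo)%E].

Definition Gamma (x : R) : R :=
  \int[lebesgue_measure]_(u in `]0, +oo[) (u `^ (x - 1) * expR (- u)).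

(* Since d - 1 <> 0, [powR] gives x_+ `^ (d - 1) = 0 for x <= 0. *)
Definition FLP_kernel (d t s : R) : R :=
  Num.max (t - s) 0 `^ (d - 1) - Num.max (- s) 0 `^ (d - 1).

(* The continuous modification of the fractional Levy process driven by L,
   given by a pathwise improper Riemann integral. *)
Definition FLP (d : R) L : R -> Omega -> R :=
  fun t w => (Gamma d)^-1 * improper_Rint (fun s => FLP_kernel d t s * L s w).

(* The fractional Levy-Ornstein-Uhlenbeck process, for the integrator Z. *)
Definition FLOU (lam : R) (Z : R -> Omega -> R) : R -> Omega -> R :=
  fun t w => RS_int_ninfty (fun u => expR (- lam * (t - u))) (Z ^~ w) t.

Definition pathwise_solution (lam : R) (Z X : R -> Omega -> R) : Prop :=
  [/\ is_process setT X,
      {ae P, forall w, continuous (X ^~ w)} &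
      {ae P, forall w, forall s t, s <= t ->
        X t w - X s w =
          - lam * (\int[lebesgue_measure]_(u in `[s, t]) X u w)
          + (Z t w - Z s w)}].

Definition stationary X : Prop :=
  forall (m : nat) (t : 'I_m -> R) (h : R),
    (forall i j : 'I_m, (i < j)%N -> t i < t j) ->
    eq_in_law (fdd X t) (fdd X (fun i => t i + h)).

End Processes.

(* Main.v *)
Require Import Defs.
From HB Require Import structures.
From mathcomp Require Import all_boot all_order all_algebra.
From mathcomp Require Import all_classical all_reals all_analysis.
From mathcomp Require Import measurable_realfun.
From mathcomp Require Import ring lra zify.

Set Implicit Arguments.
Unset Strict Implicit.
Unset Printing Implicit Defensive.

Import Order.TTheory GRing.Theory Num.Theory.
Import numFieldNormedType.Exports.

Local Open Scope classical_set_scope.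
Local Open Scope ring_scope.

(* Fix b with 1/2 < b < 1 - d. By Ottaviani's inequality and the Borel-Cantelli
   lemma, almost every path x of L is right-continuous with
   |x s| <= C (1 + |s|)^b. For such a path the argument is deterministic: the
   kernel is integrable against (1 + |s|)^b, so the improper integral defining
   y = L^d is a Lebesgue integral, continuous and of polynomial growth in t;
   integration by parts gives
     LOU_t = y_t - lam e^(- lam t) \int_(-oo)^t e^(lam u) y_u du,
   which solves the Langevin equation. Kernel integrals of constants vanish, so
   LOU_(t + h) is the same functional, evaluated at t, of the path
   s |-> x (s + h) - x h; this functional is a limit of functions of finitely
   many coordinates, hence measurable, and the stationarity of LOU follows from
   that of the increments of L. The difference D of two solutions satisfies
   D_t = e^(- lam t) D_0; if both are stationary, D_0 = e^(- lam n) D_(- n) tends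
   to 0 in probability, so D_0 = 0. *)

(** The two bounds on b answer to different steps. Chebyshev's inequality, with a variance of order
    2^k and the level (2^k)^b, gives probabilities of order 2^(k (1 - 2 b)), summable when b > 1/2;
    the kernel decays like |s|^(d - 2) at -oo, so it is integrable against |s|^b when b < 1 - d. The
    two are compatible because d < 1/2. The integrals in the definitions are limits of Riemann sums
    selected by [xget], so nothing is known of their values before existence and uniqueness are
    proved. Identifying them with Lebesgue integrals settles both and gives access to dominated
    convergence. The paths of L^d may have unbounded variation; integration by parts moves the
    variation to the exponential, and continuity of L^d is then enough. At negative times L is a
    left limit. At each fixed time it is almost surely an honest value of the second process, and
    completeness of P turns such almost sure identities into measurability. *)

Section DominatedConvergence.
Context d (T : measurableType d) (R : realType).
Variable mu : {measure set T -> \bar R}.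

Lemma dominated_Rcvg (D : set T) (f_ : nat -> T -> R) (f g : T -> R) :
  measurable D ->
  (forall n, measurable_fun D (f_ n)) -> measurable_fun D f ->
  {ae mu, forall s, D s -> f_ ^~ s @ \oo --> f s} ->
  mu.-integrable D (EFin \o g) ->
  (forall n s, D s -> `|f_ n s| <= g s) ->
  mu.-integrable D (EFin \o f) /\
  \int[mu]_(s in D) f_ n s @[n --> \oo] --> \int[mu]_(s in D) f s.
Proof.
move=> mD mf_ mf f_f gi f_g.
have [] := @dominated_convergence _ _ _ mu D mD (fun n => EFin \o f_ n)
  (EFin \o f) (EFin \o g) _ _ _ gi _.
- by move=> n; exact/measurable_EFinP.
- exact/measurable_EFinP.
- apply: filterS f_f => s h /h fs.
  by apply: cvg_EFin fs; exact: nearW.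
- by apply: aeW => s n Ds /=; rewrite lee_fin f_g.
move=> fi _ h; split=> //.
have gfi n : mu.-integrable D (EFin \o f_ n).
  apply: le_integrable gi => //; first exact/measurable_EFinP.
  by move=> s Ds /=; rewrite lee_fin (le_trans (f_g _ _ Ds))// ler_norm.
by apply: fine_cvg; rewrite /= /Rintegral fineK ?integrable_fin_num.
Qed.

End DominatedConvergence.

(** * Riemann-Stieltjes and Lebesgue integrals *)

Section RiemannLebesgue.
Context {R : realType}.
Implicit Types (f g : R -> R) (a b t I : R).
Local Notation mu := (@lebesgue_measure R).

Lemma fine_partition a b delta : a <= b -> 0 < delta ->
  exists n (x : nat -> R), [/\ x 0%N = a, x n = b &
    forall i, (i < n)%N -> x i <= x i.+1 /\ x i.+1 - x i < delta].
Proof.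
move=> ab d0; set n := (Num.truncn ((b - a) / delta)).+1.
have n0 : (n%:R : R) != 0 by rewrite pnatr_eq0.
have hn : (b - a) / n%:R < delta.
  rewrite ltr_pdivrMr ?ltr0n// mulrC -ltr_pdivrMr//.
  by rewrite /n truncnS_gt.
exists n, (fun i => a + i%:R * ((b - a) / n%:R)); split.
- by rewrite mul0r addr0.
- by rewrite mulrCA mulfV// mulr1 addrC subrK.
- move=> i _; split.
    by rewrite lerD2l ler_wpM2r ?ler_nat// divr_ge0// subr_ge0.
  by rewrite opprD addrACA subrr add0r -mulrBl -natrB// subSnn mul1r.
Qed.

Lemma is_RS_int_unique f g a b I J :
  is_RS_int f g a b I -> is_RS_int f g a b J -> I = J.
Proof.
move=> [ab hI] [_ hJ]; apply/eqP; rewrite -subr_eq0 -normr_le0.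
apply/ler_addgt0Pr => e e0; rewrite add0r.
have e20 : 0 < e / 2 by rewrite divr_gt0.
have [d1 d10 h1] := hI _ e20; have [d2 d20 h2] := hJ _ e20.
have d0 : 0 < Num.min d1 d2 by rewrite lt_min d10.
have [n [x [x0 xn hx]]] := fine_partition ab d0.
have {}h1 := h1 n x x x0 xn _; have {}h2 := h2 n x x x0 xn _.
have /h1{}h1 : forall i, (i < n)%N ->
    [/\ x i <= x i, x i <= x i.+1 & x i.+1 - x i < d1].
  by move=> i /hx[? h]; split => //; apply: (lt_le_trans h); rewrite ge_min lexx.
have /h2{}h2 : forall i, (i < n)%N ->
    [/\ x i <= x i, x i <= x i.+1 & x i.+1 - x i < d2].
  by move=> i /hx[? h]; split => //; apply: (lt_le_trans h); rewrite ge_min lexx orbT.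
set S := \sum_(i < n) _ in h1 h2.
rewrite (_ : I - J = (S - J) - (S - I)); last by ring.
rewrite (le_trans (ler_normB _ _))// [leRHS]splitr lerD// ltW//.
Qed.

Lemma RS_intE f g a b I : is_RS_int f g a b I -> RS_int f g a b = I.
Proof.
move=> h; rewrite /RS_int; case: xgetP => [J _ hJ|/(_ I)//].
exact: is_RS_int_unique hJ h.
Qed.

Lemma partition_le (n : nat) (x : nat -> R) :
  (forall i, (i < n)%N -> x i <= x i.+1) ->
  forall i j, (i <= j)%N -> (j <= n)%N -> x i <= x j.
Proof.
move=> h i j ij; elim: j ij => [|j ih]; first by rewrite leqn0 => /eqP ->.
rewrite leq_eqVlt => /predU1P[->//|ij] jn.
by apply: (le_trans (ih ij (ltnW jn))); exact: h.
Qed.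

Lemma partition_locate (n : nat) (x : nat -> R) s : x 0%N < s -> s <= x n ->
  exists2 i, (i < n)%N & x i < s <= x i.+1.
Proof.
elim: n => [|n ih] x0s sn; first by move: (lt_le_trans x0s sn); rewrite ltxx.
have [sxn|xns] := leP s (x n).
  by have [i ? ?] := ih x0s sxn; exists i => //; exact: ltnW.
by exists n => //; rewrite xns sn.
Qed.

Lemma Rintegral_partition f n (x : nat -> R) :
  (forall i, (i < n)%N -> x i <= x i.+1) ->
  mu.-integrable `[x 0%N, x n] (EFin \o f) ->
  \int[mu]_(s in `[x 0%N, x n]) f s =
  \sum_(i < n) \int[mu]_(s in `[x i, x i.+1]) f s.
Proof.
elim: n => [_ _|n ih hx fi]; first by rewrite big_ord0 set_itv1 Rintegral_set1.
have x0n : x 0%N <= x n by apply: (@partition_le n.+1) => //.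
have xnn : x n <= x n.+1 by exact: hx.
rewrite big_ord_recr/= -ih; last 2 first.
  by move=> i i_n; apply: hx; exact: ltnW.
  apply: integrableS fi => //; apply: subset_itvl; rewrite bnd_simp//.
have := @Rintegral_itvB _ f (BLeft (x 0%N)) (BRight (x n.+1)) (x n) fi.
rewrite !bnd_simp => /(_ x0n xnn); rewrite Rintegral_itv_obnd_cbnd.
  by move=> <-; rewrite addrC subrK.
apply: integrableS fi => //; apply: subset_itvr; rewrite bnd_simp//.
Qed.

Lemma Rintegral_gt0 (A : set R) f : measurable A -> (0 < mu A)%E ->
  mu.-integrable A (EFin \o f) -> (forall s, A s -> 0 < f s) ->
  0 < \int[mu]_(s in A) f s.
Proof.
move=> mA A0 fi f0; rewrite lt_neqAle Rintegral_ge0 ?andbT; last first.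
  by move=> s /f0/ltW.
apply/negP => /eqP h; have mf := measurable_int _ fi.
have : (\int[mu]_(s in A) `|(EFin \o f) s| = 0)%E.
  under eq_integral => s.
    rewrite inE => /f0/ltW fs; rewrite gee0_abs ?lee_fin//.
    over.
  transitivity ((\int[mu]_(s in A) f s)%:E); last by rewrite -h.
  by rewrite /Rintegral fineK//; exact: integrable_fin_num.
move/(ae_eq_integral_abs mu mA mf) => [N [mN N0 AN]].
move: A0; rewrite ltNge -N0 => /negP; apply.
apply: le_measure; rewrite ?inE// => s As; apply: AN => /=.
by move/(_ As) => [fs0]; have := f0 _ As; rewrite fs0 ltxx.
Qed.

Lemma integrable_cst_itv (c u v : R) :
  mu.-integrable `[u, v] (EFin \o cst c).
Proof.
apply: measurable_bounded_integrable => //=; last exact: bounded_cst.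
by rewrite lebesgue_measure_itv/=; case: ifPn => // _; rewrite -EFinB ltry.
Qed.

Lemma Rintegral_cst_itv (c u v : R) : u <= v ->
  \int[mu]_(s in `[u, v]) cst c s = c * (v - u).
Proof.
move=> uv; rewrite Rintegral_cst//= lebesgue_measure_itv/=.
move: uv; rewrite le_eqVlt => /predU1P[->|uv].
  by rewrite lte_fin ltxx subrr.
by rewrite lte_fin uv -EFinB.
Qed.

(** An integrable function cannot exceed its mean everywhere on a nondegenerate segment. With
    [tag_above_mean] this yields tags whose sums bracket the Lebesgue integral, without any
    continuity of [f]. *)
Lemma tag_below_mean f u v : u <= v -> mu.-integrable `[u, v] (EFin \o f) ->
  exists2 xi, u <= xi <= v & f xi * (v - u) <= \int[mu]_(s in `[u, v]) f s.
Proof.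
rewrite le_eqVlt => /predU1P[<- _|uv fi].
  by exists u; rewrite ?lexx// subrr mulr0 set_itv1 Rintegral_set1.
apply/not_exists2P => h.
set m := (\int[mu]_(s in `[u, v]) f s) in h *.
have vu0 : 0 < v - u by rewrite subr_gt0.
have ci := integrable_cst_itv (m / (v - u)) u v.
have : 0 < \int[mu]_(s in `[u, v]) (f s - cst (m / (v - u)) s).
  apply: Rintegral_gt0 => //.
  - by rewrite lebesgue_measure_itv/= lte_fin uv -EFinB lte_fin.
  - exact: (integrableB _ fi ci).
  - move=> s /=; rewrite in_itv/= => us.
    have [//|/negP] := h s; rewrite -ltNge => ms.
    by rewrite subr_gt0 ltr_pdivrMr.
by rewrite RintegralB// Rintegral_cst_itv ?ltW// mulfVK ?gt_eqF// subrr ltxx.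
Qed.

Lemma tag_above_mean f u v : u <= v -> mu.-integrable `[u, v] (EFin \o f) ->
  exists2 xi, u <= xi <= v & \int[mu]_(s in `[u, v]) f s <= f xi * (v - u).
Proof.
move=> uv fi.
have : mu.-integrable `[u, v] (EFin \o (fun s => -1 * f s)).
  exact: (integrableZl _ (-1) fi).
move=> /(tag_below_mean uv)[xi uxi]; rewrite RintegralZl// !mulN1r mulNr lerN2.
by exists xi.
Qed.

(** On one fine partition, tags below and above the cell means give two Riemann sums that enclose
    the Lebesgue integral, and both lie within [e] of [I]. *)
Lemma is_RS_int_id_integral f a b I : is_RS_int f id a b I ->
  mu.-integrable `[a, b] (EFin \o f) -> I = \int[mu]_(s in `[a, b]) f s.
Proof.
move=> [ab hI] fi.
suff : forall e, 0 < e -> I - e <= \int[mu]_(s in `[a, b]) f s <= I + e.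
  move=> h; apply/eqP; rewrite eq_le; apply/andP; split.
    by apply/ler_addgt0Pr => e /h/andP[]; rewrite lerBlDr.
  by apply/ler_addgt0Pr => e /h/andP[].
move=> e /hI[delta delta0 {}hI].
have [n [x [x0 xn hx]]] := fine_partition ab delta0.
have fii i : (i < n)%N -> mu.-integrable `[x i, x i.+1] (EFin \o f).
  move=> i_n; apply: integrableS fi => //; rewrite -x0 -xn.
  have hxi k : (k < n)%N -> x k <= x k.+1 by move/hx => [].
  by apply: subset_itv; rewrite bnd_simp; apply: (partition_le hxi) => //; exact: ltnW.
have -> : \int[mu]_(s in `[a, b]) f s = \sum_(i < n) \int[mu]_(s in `[x i, x i.+1]) f s.
  rewrite -x0 -xn; apply: Rintegral_partition.
    by move=> i /hx[].
  by rewrite x0 xn.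
have /choice[l hl] : forall i, exists l : R, (i < n)%N -> x i <= l <= x i.+1 /\
    f l * (x i.+1 - x i) <= \int[mu]_(s in `[x i, x i.+1]) f s.
  move=> i.
  have [i_n|] := ltnP i n; last by exists 0.
  have [xi ? ?] := tag_below_mean (hx _ i_n).1 (fii _ i_n).
  by exists xi.
have /choice[r hr] : forall i, exists r : R, (i < n)%N -> x i <= r <= x i.+1 /\
    \int[mu]_(s in `[x i, x i.+1]) f s <= f r * (x i.+1 - x i).
  move=> i.
  have [i_n|] := ltnP i n; last by exists 0.
  have [xi ? ?] := tag_above_mean (hx _ i_n).1 (fii _ i_n).
  by exists xi.
have tagged (z : nat -> R) : (forall i, (i < n)%N -> x i <= z i <= x i.+1) ->
    I - e <= \sum_(i < n) f (z i) * (x i.+1 - x i) <= I + e.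
  move=> hz; rewrite -ler_distlC ltW// distrC; apply: hI => // i i_n.
  by have /andP[? ?] := hz _ i_n; split => //; case: (hx _ i_n).
have /andP[hl1 _] := tagged l (fun i i_n => (hl i i_n).1).
have /andP[_ hr2] := tagged r (fun i i_n => (hr i i_n).1).
apply/andP; split.
  by apply: (le_trans hl1); apply: ler_sum => i _; exact: (hl i (ltn_ord i)).2.
  by apply: (le_trans _ hr2); apply: ler_sum => i _; exact: (hr i (ltn_ord i)).2.
Qed.
Definition right_cont (x : R -> R) := forall t, x s @[s --> t^'+] --> x t.

(* The points of oscillation > e are isolated from the right. *)
Lemma right_cont_countable_discontinuity x : right_cont x ->
  countable [set t | ~ {for t, continuous x}].
Proof.
move=> rx.
pose D k := [set t : R | forall eta : R, 0 < eta -> exists u v : R,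
  [/\ `|u - t| < eta, `|v - t| < eta & k.+1%:R^-1 < `|x u - x v|]].
suff DC k : countable (D k).
  apply: (@sub_countable _ _ _ (\bigcup_k D k)); last exact: bigcup_countable.
  apply: subset_card_le => t tx; apply: contrapT => tD; apply: tx.
  apply/cvgrPdist_lt => e e0.
  pose k := Num.truncn e^-1.
  have ke : k.+1%:R^-1 < e.
    by rewrite invf_plt ?posrE// truncnS_gt.
  have /asboolPn/existsp_asboolPn[eta /not_implyP[eta0 heta]] : ~ D k t.
    by move=> Dk; apply: tD; exists k.
  near=> s.
  rewrite (le_lt_trans _ ke)// leNgt; apply/negP => h.
  apply: heta; exists t, s; split; [by rewrite subrr normr0 | | exact: h].
  by rewrite distrC; near: s; exact: (nbhsx_ballx t eta eta0).
(* On a small interval to the right of [t] the oscillation is too small for another point of [D k];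
   a rational in that gap labels [t], and distinct points get distinct labels. *)
have rk t : exists q : rat, D k t -> t < ratr q /\
    (forall s, D k s -> t < s -> ratr q <= s).
  have e0 : 0 < k.+1%:R^-1 / 2 :> R by rewrite divr_gt0.
  have [eta /= eta0 heta] := (cvgrPdist_lt _ _).1 (rx t) _ e0.
  have /rat_in_itvoo[q] : t < t + eta by rewrite ltrDl.
  rewrite in_itv/= => /andP[tq qe]; exists q => Dt; split => // s Ds ts.
  rewrite leNgt; apply/negP => sq.
  have d0 : 0 < Num.min (s - t) (t + eta - s).
    by rewrite lt_min !subr_gt0 ts (lt_trans sq qe).
  have near_t u : `|u - s| < Num.min (s - t) (t + eta - s) ->
      `|x t - x u| < k.+1%:R^-1 / 2.
    rewrite lt_min => /andP[]; rewrite ltrBrDr distrC => us1.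
    rewrite distrC ltrBrDr => us2.
    have tu : t < u by have := ler_norm (s - u); lra.
    apply: heta => //=; rewrite ltr_norml.
    by have := ler_norm (u - s); lra.
  have [u [v [us vs]]] := Ds _ d0.
  apply/negP; rewrite -leNgt (le_trans (ler_distD (x t) _ _))//.
  by rewrite [leRHS]splitr lerD// ltW// ?near_t// distrC near_t.
have /choice[q hq] := rk.
apply/countable_injP; exists (fun t => pickle (q t)) => t s.
rewrite !inE => Dt Ds /(pcan_inj pickleK) qts.
have [tq ht] := hq _ Dt; have [sq hs] := hq _ Ds.
apply/eqP; rewrite eq_le !leNgt; apply/andP; split; apply/negP => st.
  by have := hs _ Dt st; rewrite -qts leNgt tq.
by have := ht _ Ds st; rewrite qts leNgt sq.
Unshelve. all: by end_near.
Qed.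

Lemma dist_lt_itv a b s t e : a <= t -> t <= b -> a <= s -> s <= b ->
  b - a < e -> `|s - t| < e :> R.
Proof. by rewrite ltr_norml; lra. Qed.

(** The step function whose integral is the Riemann sum. Its cells are open on the left, so it
    vanishes at the single point [x 0]. *)
Definition riemann_step f (n : nat) (x xi : nat -> R) s : R :=
  \sum_(i < n) f (xi i) * \1_(`]x i, x i.+1]%classic) s.

Lemma riemann_stepE f n x xi s i : (forall i, (i < n)%N -> x i <= x i.+1) ->
  (i < n)%N -> x i < s <= x i.+1 -> riemann_step f n x xi s = f (xi i).
Proof.
move=> hx i_n /andP[xis sxi]; rewrite /riemann_step (bigD1 (Ordinal i_n))//= big1 => [|j ji].
  by rewrite addr0 indicE mem_set ?mulr1//= in_itv/= xis.
rewrite indicE memNset ?mulr0//= in_itv/= => /andP[xjs sxj].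
have [ij|ij|ij] := ltngtP i j.
- have := partition_le hx ij (ltnW (ltn_ord j)).
  by move=> /(le_trans sxi)/(lt_le_trans xjs); rewrite ltxx.
- have := partition_le hx ij (ltnW i_n).
  by move=> /(le_trans sxj)/(lt_le_trans xis); rewrite ltxx.
- by move/negP: ji; apply; apply/eqP/val_inj.
Qed.

Lemma measurable_riemann_step f n x xi (A : set R) : measurable_fun A (riemann_step f n x xi).
Proof.
apply: measurable_sum => i; apply: measurable_funM => //.
Qed.

Lemma riemann_step_le f n x xi s (M : R) : (forall i, (i < n)%N -> x i <= x i.+1) ->
  (forall i, (i < n)%N -> `|f (xi i)| <= M) -> 0 <= M ->
  x 0%N <= s <= x n -> `|riemann_step f n x xi s| <= M.
Proof.
move=> hx hf M0 /andP[]; rewrite le_eqVlt => /predU1P[<- _|xs sx].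
  rewrite /riemann_step big1 ?normr0// => i _.
  rewrite indicE memNset ?mulr0//= in_itv/= ltNge.
  by rewrite (partition_le hx)// ltnW.
have [i i_n /(riemann_stepE f xi hx i_n)->] := partition_locate xs sx.
exact: hf.
Qed.

Lemma integrable_riemann_step f n x xi (M : R) : (forall i, (i < n)%N -> x i <= x i.+1) ->
  (forall i, (i < n)%N -> `|f (xi i)| <= M) -> 0 <= M ->
  mu.-integrable `[x 0%N, x n] (EFin \o riemann_step f n x xi).
Proof.
move=> hx hf M0; apply: le_integrable (integrable_cst_itv M _ _) => //.
  by apply/measurable_EFinP; exact: measurable_riemann_step.
move=> s /=; rewrite in_itv/= => sx; rewrite lee_fin (ger0_norm M0).
exact: riemann_step_le.
Qed.

Lemma Rintegral_riemann_step f n x xi (M : R) : (forall i, (i < n)%N -> x i <= x i.+1) ->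
  (forall i, (i < n)%N -> `|f (xi i)| <= M) -> 0 <= M ->
  \int[mu]_(s in `[x 0%N, x n]) riemann_step f n x xi s =
  \sum_(i < n) f (xi i) * (x i.+1 - x i).
Proof.
move=> hx hf M0; have si := integrable_riemann_step hx hf M0.
rewrite (Rintegral_partition hx si); apply: eq_bigr => -[i i_n] _ /=.
rewrite -Rintegral_cst_itv ?hx//.
rewrite -[LHS]Rintegral_itv_obnd_cbnd; last first.
  apply: integrableS si => //; apply: subset_itv; rewrite bnd_simp.
    by rewrite (partition_le hx)// ltnW.
  by rewrite (partition_le hx).
rewrite -[RHS]Rintegral_itv_obnd_cbnd; last first.
  apply: integrableS (integrable_cst_itv _ (x i) (x i.+1)) => //.
  by apply: subset_itvr; rewrite bnd_simp.
by apply: eq_Rintegral => s; rewrite inE/= in_itv/=; exact: riemann_stepE.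
Qed.

(** The sufficient half of Lebesgue's criterion. A failure would give tagged partitions of mesh
    below [m.+1%:R^-1] whose sums stay at distance [e] from the integral; but their step functions
    converge to [f] at every continuity point and are bounded by [M], against dominated
    convergence. *)
Lemma is_RS_int_id_ae_continuous f a b (M : R) (D : set R) : a <= b ->
  measurable_fun `[a, b] f -> (forall s, a <= s <= b -> `|f s| <= M) ->
  countable D -> (forall s, a < s < b -> ~ D s -> {for s, continuous f}) ->
  is_RS_int f id a b (\int[mu]_(s in `[a, b]) f s).
Proof.
move=> ab mf fM cD fc; split=> // e e0.
apply: contrapT => /forall2NP h.
have M0 : 0 <= M by apply: le_trans (fM a _); rewrite ?lexx.
pose good m (p : nat * ((nat -> R) * (nat -> R))) :=
  [/\ p.2.1 0%N = a, p.2.1 p.1 = b, (forall i, (i < p.1)%N ->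
    [/\ p.2.1 i <= p.2.2 i, p.2.2 i <= p.2.1 i.+1 &
        p.2.1 i.+1 - p.2.1 i < m.+1%:R^-1]) &
   e <= `| \sum_(i < p.1) f (p.2.2 i) * (p.2.1 i.+1 - p.2.1 i) -
       \int[mu]_(s in `[a, b]) f s|].
have /choice[p hp] : forall m, exists p, good m p.
  move=> m; have [n0|] := h m.+1%:R^-1; first by case: n0; rewrite invr_gt0.
  move=> /existsNP[n /existsNP[x /existsNP[xi]]].
  move=> /not_implyP[x0 /not_implyP[xn /not_implyP[hx /negP]]].
  by rewrite -leNgt => hS; exists (n, (x, xi)).
have hx m i : (i < (p m).1)%N -> (p m).2.1 i <= (p m).2.1 i.+1.
  by move=> im; have [_ _ /(_ _ im)[h1 h2 _] _] := hp m; exact: le_trans h2.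
have px m : (p m).2.1 0%N = a /\ (p m).2.1 (p m).1 = b by case: (hp m).
have hf m i : (i < (p m).1)%N -> `|f ((p m).2.2 i)| <= M.
  move=> im; apply: fM; have [x0 xn + _] := hp m => /(_ _ im)[h1 h2 _].
  rewrite -x0 -xn (le_trans _ h1) ?(le_trans h2)//.
    by rewrite (partition_le (hx m)).
  by rewrite (partition_le (hx m))// ltnW.
pose F m := riemann_step f (p m).1 (p m).2.1 (p m).2.2.
have [_] : mu.-integrable `[a, b] (EFin \o f) /\
    \int[mu]_(s in `[a, b]) F m s @[m --> \oo] --> \int[mu]_(s in `[a, b]) f s.
  apply: (@dominated_Rcvg _ _ _ mu _ _ _ (cst M)) => //.
  - by move=> m; exact: measurable_riemann_step.
  (* The endpoints join the null set because continuity is assumed only inside []a, b[]. *)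
  - exists (D `|` [set a; b]); split.
    + apply: measurableU; last exact: measurableU.
      exact: countable_measurable.
    + apply: null_set_setU.
      * exact: countable_measurable.
      * exact: measurableU.
      * exact: countable_lebesgue_measure0.
      * apply: countable_lebesgue_measure0; apply: finite_set_countable.
        by rewrite finite_setU.
    + move=> s /= /not_implyP[]; rewrite in_itv/= => /andP[as_ sb] Fs.
      apply: contrapT => /not_orP[Ds /not_orP[sa sb']]; apply: Fs.
      have {}as_ : a < s by rewrite lt_neqAle as_ andbT; apply/eqP => /esym.
      have {sb' sb}sb : s < b by rewrite lt_neqAle sb andbT; exact/eqP.
      have asb : a < s < b by rewrite as_.
      apply/cvgrPdist_lt => eps eps0.
      have [eta /= eta0 heta] := (cvgrPdist_lt _ _).1 (fc _ asb Ds) _ eps0.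
      near=> m.
      have [x0 xn hp3 _] := hp m.
      have [i im si] : exists2 i, (i < (p m).1)%N &
          (p m).2.1 i < s <= (p m).2.1 i.+1.
        by apply: partition_locate; rewrite ?x0 ?xn// ltW.
      rewrite /F (riemann_stepE f _ (hx m) im si); apply: heta => /=.
      have [h1 h2 h3] := hp3 _ im; have {si}/andP[si1 si2] := si.
      have : m.+1%:R^-1 < eta.
        by near: m; exact: near_infty_natSinv_lt (PosNum eta0).
      by move=> /(lt_trans h3)/(dist_lt_itv h1 h2 (ltW si1) si2).
  - exact: integrable_cst_itv.
  - move=> m s /=; rewrite in_itv/= => sab; apply: riemann_step_le => //.
      exact: hx. exact: hf.
    by have [-> ->] := px m.
move/cvgrPdist_lt => /(_ _ e0)[m _ /(_ m)]/= /(_ (leqnn _)).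
rewrite ltNge distrC => /negP; apply.
have [_ _ _] := hp m; have [x0 xn] := px m.
by rewrite -(@Rintegral_riemann_step _ _ _ _ M (hx m) (hf m) M0) x0 xn.
Unshelve. all: by end_near.
Qed.
End RiemannLebesgue.

(** * Affine changes of variable and integrals of powers *)

Section AffineSubstitution.
Context {R : realType}.
Local Notation mu := (@lebesgue_measure R).

Definition aff (c h : R) : measurableTypeR R -> measurableTypeR R := fun s => c * s + h.

Lemma measurable_aff c h : measurable_fun setT (aff c h).
Proof.
apply: (@measurable_funD _ _ _ _ ( *%R c) (cst h)) => //.
Qed.


(** The image of [mu] under [aff c h], scaled by [c], agrees with [mu] on the intervals []a, b]],
    which determine it. *)
Lemma lebesgue_measure_affine (c h : R) (A : set R) : 0 < c -> measurable A ->
  (c%:E * mu (aff c h @^-1` A))%E = mu A.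
Proof.
move=> c0 mA; apply/esym.
unshelve refine (@lebesgue_measure_unique R
  (mscale (NngNum (ltW c0)) (pushforward mu (aff c h))) _ A mA).
  exact: measurable_aff.
move=> _ [[a b]] _ <-.
rewrite [RHS](_ : _ = c%:E * mu (aff c h @^-1` `]a, b]))%E//.
rewrite (_ : _ @^-1` _ = `](a - h) / c, (b - h) / c]%classic); last first.
  apply/seteqP; split => s /=; rewrite !in_itv/= /aff;
   by rewrite ltr_pdivrMr// ler_pdivlMr// ltrBlDr lerBrDr mulrC.
rewrite !lebesgue_measure_itv/= !lte_fin ltr_pM2r ?invr_gt0// ltrD2r.
case: ifPn => _; last by rewrite mule0.
rewrite -!EFinD -EFinM -mulrBl mulrCA mulfV ?gt_eqF// mulr1; congr EFin; ring.
Qed.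

Lemma ge0_integral_affine (c h : R) (f : R -> \bar R) : 0 < c ->
  measurable_fun setT f -> (forall s, 0 <= f s)%E ->
  (\int[mu]_s f s = c%:E * \int[mu]_s f (c * s + h)%R)%E.
Proof.
move=> c0 mf f0; have ma := measurable_aff c h.
unshelve rewrite (eq_measure_integral
  (mscale (NngNum (ltW c0)) (pushforward mu (aff c h)))); last first.
- by move=> A mA _; apply/esym; exact: lebesgue_measure_affine.
- by rewrite ge0_integral_mscale//= ge0_integral_pushforward.
Qed.

Lemma integrable_affine (c h : R) (f : R -> R) : 0 < c ->
  measurable_fun setT f -> mu.-integrable setT (EFin \o f) ->
  mu.-integrable setT (EFin \o (fun s => f (c * s + h))).
Proof.
move=> c0 mf /integrableP[_ fi]; apply/integrableP; split.
  apply/measurable_EFinP; apply: (measurableT_comp mf).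
  exact: measurable_aff.
have mnf : measurable_fun setT (fun s => `|(f s)%:E|%E).
  by apply: measurableT_comp => //; exact/measurable_EFinP.
move: fi; rewrite (ge0_integral_affine h c0 mnf)//=.
case: (integral _ _ _) => [r _|/=|_]; first by rewrite ltry.
  by rewrite gt0_muley.
by rewrite ltNye.
Qed.

Lemma Rintegral_affine (c h : R) (f : R -> R) : 0 < c ->
  measurable_fun setT f -> mu.-integrable setT (EFin \o f) ->
  \int[mu]_s f s = c * \int[mu]_s f (c * s + h).
Proof.
move=> c0 mf fi; have gi := integrable_affine h c0 mf fi.
have mfE : measurable_fun setT (EFin \o f) by exact/measurable_EFinP.
rewrite /Rintegral integralE [in RHS]integralE.
rewrite (@ge0_integral_affine c h (funepos (EFin \o f)) c0)//; last exact: measurable_funepos.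
rewrite (@ge0_integral_affine c h (funeneg (EFin \o f)) c0)//; last exact: measurable_funeneg.
pose g := EFin \o (fun s => f (c * s + h)).
have pf : (\int[mu]_s funepos g s)%E \is a fin_num.
  exact: (integrable_pos_fin_num _ gi).
have nf : (\int[mu]_s funeneg g s)%E \is a fin_num.
  exact: (integrable_neg_fin_num _ gi).
have -> : (\int[mu]_s funepos (EFin \o f) (c * s + h)%R =
    \int[mu]_s funepos g s)%E by apply: eq_integral => s _; rewrite !funeposE.
have -> : (\int[mu]_s funeneg (EFin \o f) (c * s + h)%R =
    \int[mu]_s funeneg g s)%E by apply: eq_integral => s _; rewrite !funenegE.
rewrite -/g -(fineK pf) -(fineK nf) -!EFinM -!EFinB /=.
by rewrite mulrBr.
Qed.

Lemma integrable_translate (h : R) (f : R -> R) :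
  measurable_fun setT f -> mu.-integrable setT (EFin \o f) ->
  mu.-integrable setT (EFin \o (fun s => f (s + h))).
Proof.
move=> mf fi; have := integrable_affine h ltr01 mf fi.
by apply: eq_integrable => // s _ /=; rewrite mul1r.
Qed.

Lemma Rintegral_translate (h : R) (f : R -> R) :
  measurable_fun setT f -> mu.-integrable setT (EFin \o f) ->
  \int[mu]_s f (s + h) = \int[mu]_s f s.
Proof.
move=> mf fi; rewrite (Rintegral_affine h ltr01 mf fi) mul1r.
by apply: eq_Rintegral => s _; rewrite mul1r.
Qed.

End AffineSubstitution.

Lemma ge0_integral_bigcup_le d (T : measurableType d) (R : realType)
    (mu : {measure set T -> \bar R}) (F : (set T)^nat) (f : T -> \bar R)
    (M : \bar R) :
  nondecreasing_seq F -> (forall n, measurable (F n)) ->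
  measurable_fun (\bigcup_n F n) f -> (forall x, 0 <= f x)%E ->
  (forall n, \int[mu]_(x in F n) f x <= M)%E ->
  (\int[mu]_(x in \bigcup_n F n) f x <= M)%E.
Proof.
move=> ndF mF mf f0 FM.
have cF : (\int[mu]_(x in F n) f x)%E @[n --> \oo] -->
    (\int[mu]_(x in \bigcup_n F n) f x)%E.
  apply: ge0_nondecreasing_set_cvg_integral => //.
  move=> n; apply: (measurable_funS _ _ mf); first exact: bigcupT_measurable.
  exact: bigcup_sup.
rewrite -(cvg_lim _ cF)//; apply: lime_le; last exact: nearW.
by apply/cvg_ex; eexists; exact: cF.
Qed.

Section PowerIntegral.
Context {R : realType}.
Local Notation mu := (@lebesgue_measure R).

Lemma integral_powR (q a b : R) : q + 1 != 0 -> 0 < a -> a < b ->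
  (\int[mu]_(u in `[a, b]) (u `^ q)%:E =
   ((b `^ (q + 1) - a `^ (q + 1)) / (q + 1))%:E)%E.
Proof.
move=> q1 a0 ab; rewrite mulrC mulrBr EFinB.
pose F : R -> R := (q + 1)^-1 \*: ((@powR R) ^~ (q + 1)).
have dF (u : R) : 0 < u -> is_derive u 1 F (u `^ q).
  move=> u0; have := is_deriveZ (q + 1)^-1 (is_derive1_powR (q + 1) u0).
  by move/is_derive_eq; apply; rewrite addrK /GRing.scale/= mulKf.
have cF (u : R) : 0 < u -> {for u, continuous F}.
  by move=> /dF[/derivable1_diffP/differentiable_continuous].
apply: (@continuous_FTC2 _ _ F) => //.
- apply: continuous_in_subspaceT => u; rewrite inE/= in_itv/= => /andP[au _].
  have u0 := lt_le_trans a0 au.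
  by have [/derivable1_diffP/differentiable_continuous] := is_derive1_powR q u0.
- split.
  + move=> u; rewrite in_itv/= => /andP[au _].
    by have [] := dF u (lt_trans a0 au).
  + by apply: cvg_at_right_filter; exact: cF.
  + by apply: cvg_at_left_filter; apply: cF; exact: lt_trans ab.
- move=> u; rewrite in_itv/= => /andP[au _].
  by rewrite derive1E; have [_ ->] := dF u (lt_trans a0 au).
Qed.

Lemma integrable_powR_near0 (q : R) : -1 < q ->
  mu.-integrable `]0, 1] (EFin \o (@powR R ^~ q)).
Proof.
move=> q1; apply/integrableP; split.
  by apply/measurable_EFinP; apply: measurable_funTS; exact: measurable_powR.
under eq_integral do rewrite /= ger0_norm ?powR_ge0//.
have q10 : 0 < q + 1 by rewrite -ltrBlDr sub0r.
pose F n := [set` `[n.+1%:R^-1 : R, 1]].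
have FU : \bigcup_n F n = `]0, 1]%classic.
  apply/seteqP; split => [u [n _]|u]; rewrite /F/= !in_itv/=.
    by move=> /andP[nu ->]; rewrite (lt_le_trans _ nu).
  move=> /andP[u0 u1]; exists (Num.truncn u^-1) => //=.
  by rewrite in_itv/= u1 andbT invf_ple ?posrE// ltW// truncnS_gt.
rewrite -FU.
have Fi n : (\int[mu]_(u in F n) (u `^ q)%:E <= (q + 1)^-1%:E)%E.
  have [->|n0] := eqVneq n 0%N.
    by rewrite /F invr1 set_itv1 integral_set1 lee_fin invr_ge0 ltW.
  rewrite integral_powR ?gt_eqF//; last by rewrite invf_lt1// ltr1n ltnS lt0n.
  rewrite lee_fin ler_pdivrMr// mulVf ?gt_eqF// powR1.
  by rewrite lerBlDr lerDl powR_ge0.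
apply: (@le_lt_trans _ _ (q + 1)^-1%:E); last exact: ltry.
apply: ge0_integral_bigcup_le => //.
- apply/nondecreasing_seqP => n; apply/subsetPset; apply: subset_itvr.
  by rewrite bnd_simp lef_pV2 ?posrE// ler_nat.
- by move=> n; exact: measurable_itv.
- by apply/measurable_EFinP; apply: measurable_funTS; exact: measurable_powR.
- by move=> u; rewrite lee_fin powR_ge0.
Qed.

Lemma integrable_powR_nearinfty (q : R) : q < -1 ->
  mu.-integrable `[1, +oo[ (EFin \o (@powR R ^~ q)).
Proof.
move=> q1; apply/integrableP; split.
  by apply/measurable_EFinP; apply: measurable_funTS; exact: measurable_powR.
under eq_integral do rewrite /= ger0_norm ?powR_ge0//.
have q10 : q + 1 < 0 by rewrite -ltrBrDr sub0r.
pose F n := [set` `[1 : R, n.+1%:R]].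
have FU : \bigcup_n F n = `[1, +oo[%classic.
  apply/seteqP; split => [u [n _]|u]; rewrite /F/= !in_itv/= ?andbT.
    by move=> /andP[].
  move=> u1; exists (Num.truncn u) => //=.
  by rewrite in_itv/= u1 ltW// truncnS_gt.
rewrite -FU.
have Fi n : (\int[mu]_(u in F n) (u `^ q)%:E <= (- (q + 1)^-1)%:E)%E.
  have [->|n0] := eqVneq n 0%N.
    by rewrite /F set_itv1 integral_set1 lee_fin oppr_ge0 invr_le0 ltW.
  rewrite integral_powR ?lt_eqF//; last by rewrite ltr1n ltnS lt0n.
  rewrite lee_fin ler_ndivrMr// mulNr mulVf ?lt_eqF// powR1.
  by rewrite lerBrDr addNr powR_ge0.
apply: (@le_lt_trans _ _ (- (q + 1)^-1)%:E); last exact: ltry.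
apply: ge0_integral_bigcup_le => //.
- apply/nondecreasing_seqP => n; apply/subsetPset; apply: subset_itvl.
  by rewrite bnd_simp ler_nat.
- by move=> n; exact: measurable_itv.
- by apply/measurable_EFinP; apply: measurable_funTS; exact: measurable_powR.
- by move=> u; rewrite lee_fin powR_ge0.
Qed.

End PowerIntegral.

(** * The fractional kernel *)

Section Weight.
Context {R : realType}.
Implicit Types b s t : R.

(** Adding 1 to |s| makes the weight at least 1 and submultiplicative under both sums and products
    when [0 <= b], so that translating or dilating a path costs only a factor. *)
Definition weight b s : R := (1 + `|s|) `^ b.

Lemma weight_gt0 b s : 0 < weight b s.
Proof. by rewrite powR_gt0// ltr_pwDl. Qed.

Lemma weight_ge0 b s : 0 <= weight b s.
Proof. exact/ltW/weight_gt0. Qed.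

Lemma weight_ge1 b s : 0 <= b -> 1 <= weight b s.
Proof.
move=> b0; rewrite -[leLHS](powRr0 (1 + `|s|)) /weight.
by rewrite ler_powR// lerDl.
Qed.

Lemma weight0 b : weight b 0 = 1.
Proof. by rewrite /weight normr0 addr0 powR1. Qed.

Lemma weightN b s : weight b (- s) = weight b s.
Proof. by rewrite /weight normrN. Qed.

Lemma weightD b s t : 0 <= b -> weight b (s + t) <= weight b s * weight b t.
Proof.
move=> b0; rewrite /weight -powRM ?addr_ge0//.
rewrite ge0_ler_powR ?nnegrE ?addr_ge0 ?mulr_ge0 ?addr_ge0//.
have := ler_normD s t; have : 0 <= `|s| * `|t| by rewrite mulr_ge0.
by nra.
Qed.

Lemma weightM b s t : 0 <= b -> weight b (s * t) <= weight b s * weight b t.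
Proof.
move=> b0; rewrite /weight -powRM ?addr_ge0//.
rewrite ge0_ler_powR ?nnegrE ?addr_ge0 ?mulr_ge0 ?addr_ge0//.
by rewrite normrM; have := normr_ge0 s; have := normr_ge0 t; nra.
Qed.

Lemma measurable_weight b : measurable_fun setT (weight b).
Proof.
apply: (measurableT_comp (measurable_powR b)).
by apply: measurable_funD => //; exact: normr_measurable.
Qed.

End Weight.

Section Reflection.
Context {R : realType}.
Local Notation mu := (@lebesgue_measure R).

Lemma ge0_integral_oppr (f : R -> \bar R) :
  measurable_fun setT f -> (forall s, 0 <= f s)%E ->
  (\int[mu]_s f s = \int[mu]_s f (- s)%R)%E.
Proof.
move=> mf f0.
have mN : measurable_fun setT (-%R : measurableTypeR R -> measurableTypeR R).
  exact: oppr_measurable.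
unshelve rewrite (eq_measure_integral
  (pushforward mu (-%R : measurableTypeR R -> measurableTypeR R))); last first.
- by move=> A mA _; apply/esym; exact: lebesgue_measureN.
- by rewrite ge0_integral_pushforward.
Qed.

Lemma integrable_oppr (f : R -> R) :
  measurable_fun setT f -> mu.-integrable setT (EFin \o f) ->
  mu.-integrable setT (EFin \o (fun s => f (- s))).
Proof.
move=> mf /integrableP[_ fi]; apply/integrableP; split.
  by apply/measurable_EFinP; apply: (measurableT_comp mf).
move: fi; rewrite ge0_integral_oppr//.
by apply: measurableT_comp => //; exact/measurable_EFinP.
Qed.

End Reflection.

Section Kernel.
Context {R : realType}.
Variables (d b : R).
Hypotheses (d_gt0 : 0 < d) (d_lt1 : d < 1) (b_ge0 : 0 <= b) (b_lt : b < 1 - d).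
Local Notation mu := (@lebesgue_measure R).
Local Notation ker := (FLP_kernel d).
Implicit Types s t : R.

Definition ppow (r : R) : R := Num.max r 0 `^ (d - 1).

Lemma FLP_kernelE t s : ker t s = ppow (t - s) - ppow (- s).
Proof. by []. Qed.

Lemma ppow_ge0 r : 0 <= ppow r.
Proof. exact: powR_ge0. Qed.

Lemma ppow_pos r : 0 < r -> ppow r = r `^ (d - 1).
Proof. by move=> r0; rewrite /ppow max_l// ltW. Qed.

Lemma ppow_neg r : r <= 0 -> ppow r = 0.
Proof. by move=> r0; rewrite /ppow max_r// powR0// subr_eq0 lt_eqF. Qed.

Lemma ppow_anti r s : 0 < r -> r <= s -> ppow s <= ppow r.
Proof.
move=> r0 rs; have s0 := lt_le_trans r0 rs.
rewrite !ppow_pos// -(opprB 1 d) !powRN.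
rewrite lef_pV2 ?posrE ?powR_gt0//.
by apply: ge0_ler_powR; rewrite ?nnegrE ?subr_ge0//; exact/ltW.
Qed.

Lemma ppowM c r : 0 < c -> ppow (c * r) = c `^ (d - 1) * ppow r.
Proof.
move=> c0; rewrite /ppow -powRM ?(ltW c0)//; last by rewrite le_max lexx orbT.
by rewrite maxr_pMr ?(ltW c0)// mulr0.
Qed.

Lemma measurable_ppow : measurable_fun setT ppow.
Proof.
apply: (measurableT_comp (measurable_powR (d - 1))).
exact: measurable_maxr.
Qed.

Lemma measurable_FLP_kernel t : measurable_fun setT (ker t).
Proof.
apply: measurable_funB; apply: (measurableT_comp measurable_ppow) => //.
by apply: measurable_funB.
Qed.

Lemma FLP_kernel0 s : ker 0 s = 0.
Proof. by rewrite FLP_kernelE sub0r subrr. Qed.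

Lemma FLP_kernel_scale c t s : 0 < c -> ker (c * t) (c * s) = c `^ (d - 1) * ker t s.
Proof.
by move=> c0; rewrite !FLP_kernelE -mulrBr -mulrN !ppowM// mulrBr.
Qed.

Lemma FLP_kernelN t s : ker (- t) s = - ker t (s + t).
Proof.
rewrite !FLP_kernelE opprB opprD; congr (ppow _ - ppow _); ring.
Qed.

Lemma FLP_kernel_shift t h s : ker (t + h) s - ker h s = ker t (s - h).
Proof.
rewrite !FLP_kernelE opprB addrA subrK opprB.
by congr (ppow _ - ppow _); ring.
Qed.

(** Put v = 1 / (- s). The absolute value is (- s)^(d - 1) times 1 - (1 + v)^(d - 1), and (1 + v)^(d
    - 1) >= 1 / (1 + v) >= 1 - v. The cancellation between the two powers gains the factor v,
    without which the tail would not be integrable. *)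
Lemma FLP_kernel1_tail s : s <= -1 -> `|ker 1 s| <= (- s) `^ (d - 2).
Proof.
move=> s1; have u1 : 1 <= - s by lra.
have u0 : 0 < - s by lra.
rewrite FLP_kernelE distrC ger0_norm ?subr_ge0; last first.
  by apply: ppow_anti => //; lra.
rewrite !ppow_pos; [|lra|lra].
have -> : 1 - s = - s * (1 + (- s)^-1) by rewrite mulrDr mulr1 mulfV ?gt_eqF// addrC.
have v0 : 0 < (- s)^-1 by rewrite invr_gt0.
rewrite powRM ?(ltW u0)//; last exact/ltW/addr_gt0.
rewrite -[X in X - _]mulr1 -mulrBr.
have -> : d - 2 = (d - 1) + (-1) by ring.
rewrite (@powRD _ (- s) (d - 1)); last by rewrite (gt_eqF u0) implybT.
rewrite ler_wpM2l ?powR_ge0//.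
rewrite powR_inv1 ?(ltW u0)// lerBlDl -lerBlDr.
have : (1 + (- s)^-1)^-1 <= (1 + (- s)^-1) `^ (d - 1).
  rewrite -(@powR_inv1 _ (1 + (- s)^-1)); last by rewrite addr_ge0// ltW.
  by apply: ler_powR; [rewrite lerDl ltW|rewrite lerBrDr addNr ltW].
apply: le_trans.
rewrite -[leRHS]mul1r ler_pdivlMr ?addr_gt0//.
set v := (- s)^-1 in v0 *; nra.
Qed.

(** One term for the singularity at 1, one for the singularity at 0, one for the tail at -oo, whose
    exponent [d - 2 + b] is below -1 because [b < 1 - d]. The factor 2^b bounds the weight on
    [[-1, 1]], and the quotient of the weight by (- s)^b below -1. *)
Definition kernel1_majorant (s : R) : R := 2 `^ b *
  (((@powR R ^~ (d - 1)) \_ `]0, 1]) (1 - s) +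
   ((@powR R ^~ (d - 1)) \_ `]0, 1]) (- s) +
   ((@powR R ^~ (d - 2 + b)) \_ `[1, +oo[) (- s)).

Lemma integrable_kernel1_majorant :
  mu.-integrable setT (EFin \o kernel1_majorant).
Proof.
have mr (q : R) (A : set R) : measurable A -> measurable_fun setT ((@powR R ^~ q) \_ A).
  move=> mA; apply/measurable_restrict => //.
  by apply: measurable_funTS; exact: measurable_powR.
have i1 : mu.-integrable setT (EFin \o ((@powR R ^~ (d - 1)) \_ `]0, 1])).
  rewrite -restrict_EFin; apply/integrable_restrict => //.
  by rewrite setTI; apply: integrable_powR_near0; rewrite ltrBrDr addNr.
have i2 : mu.-integrable setT (EFin \o ((@powR R ^~ (d - 2 + b)) \_ `[1, +oo[)).
  rewrite -restrict_EFin; apply/integrable_restrict => //.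
  by rewrite setTI; apply: integrable_powR_nearinfty; move: b_lt; lra.
have j1 := integrable_oppr (mr _ _ (measurable_itv _)) i1.
have j2 := integrable_oppr (mr _ _ (measurable_itv _)) i2.
have mj1 : measurable_fun setT (fun s => ((@powR R ^~ (d - 1)) \_ `]0, 1]) (- s)).
  by apply: (measurableT_comp (mr _ _ (measurable_itv _))).
have j3 := integrable_translate (-1) mj1 j1.
have i3 := integrableD measurableT (integrableD measurableT j3 j1) j2.
apply: eq_integrable (integrableZl measurableT (2 `^ b) i3) => // s _ /=.
by rewrite -!EFinD -EFinM opprB.
Qed.

Lemma kernel1_majorantP s : `|ker 1 s * weight b s| <= kernel1_majorant s.
Proof.
rewrite normrM (ger0_norm (weight_ge0 _ _)) /kernel1_majorant mulrC.
have w2 : `|s| <= 1 -> weight b s <= 2 `^ b.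
  by move=> s1; rewrite /weight ge0_ler_powR ?nnegrE ?addr_ge0//; lra.
have p0 (q u : R) (A : set R) : 0 <= ((@powR R ^~ q) \_ A) u.
  by rewrite patchE; case: ifPn => // _; exact: powR_ge0.
have pin0 (q u : R) : 0 < u <= 1 -> ((@powR R ^~ q) \_ `]0, 1]) u = u `^ q.
  by move=> u01; rewrite patchE mem_set//= in_itv/=.
have b2 : 0 <= (2 : R) `^ b by exact: powR_ge0.
have ker_nonneg : 0 <= s -> `|ker 1 s| <= ((@powR R ^~ (d - 1)) \_ `]0, 1]) (1 - s).
  move=> s0; rewrite FLP_kernelE (ppow_neg (r := - s)) ?oppr_le0// subr0.
  rewrite ger0_norm ?ppow_ge0//; have [s1|s1] := leP 1 s.
    by rewrite ppow_neg ?subr_le0.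
  by rewrite ppow_pos ?subr_gt0// pin0// subr_gt0 s1 gerBl.
have [s0|s0] := leP 0 s.
  have [s1|s1] := leP s 1; last first.
    rewrite FLP_kernelE !ppow_neg; [|lra|lra].
    by rewrite subrr normr0 mulr0 mulr_ge0// !addr_ge0.
  rewrite ler_pM ?weight_ge0//; first by rewrite w2// ler_norml; apply/andP; split; lra.
  by rewrite (le_trans (ker_nonneg s0))// -addrA lerDl addr_ge0.
have [s1|s1] := leP s (-1).
  have w3 : weight b s <= 2 `^ b * (- s) `^ b.
    rewrite -powRM//; last lra.
    rewrite /weight ge0_ler_powR ?nnegrE ?addr_ge0//; first lra.
    by rewrite ltr0_norm//; lra.
  have n0 : 0 <= `|ker 1 s| by [].
  rewrite (le_trans (ler_pM (weight_ge0 _ _) n0 w3 (FLP_kernel1_tail s1)))//.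
  rewrite -mulrA ler_wpM2l// -powRD; last by rewrite oppr_eq0 (lt_eqF s0) implybT.
  have -> : ((@powR R ^~ (d - 2 + b)) \_ `[1, +oo[) (- s) = (- s) `^ (b + (d - 2)).
    rewrite patchE mem_set; first by rewrite addrC.
    by rewrite /= in_itv/= andbT lerNr.
  by rewrite lerDr addr_ge0.
rewrite ler_pM ?weight_ge0//; first by rewrite w2// ler_norml; apply/andP; split; lra.
rewrite FLP_kernelE distrC ger0_norm; last by rewrite subr_ge0 ppow_anti//; lra.
rewrite lerBlDr (ppow_pos (r := - s)) ?oppr_gt0//.
rewrite -(pin0 (d - 1) (- s)); last by rewrite oppr_gt0 s0 lerNl ltW.
have := ppow_ge0 (1 - s).
have := p0 (d - 1) (1 - s) `]0, 1]%classic.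
by have := p0 (d - 2 + b) (- s) `[1, +oo[%classic; lra.
Qed.

Lemma integrable_kernel1 :
  mu.-integrable setT (EFin \o (fun s => ker 1 s * weight b s)).
Proof.
apply: le_integrable integrable_kernel1_majorant => //.
  apply/measurable_EFinP; apply: measurable_funM.
    exact: measurable_FLP_kernel.
  exact: measurable_weight.
move=> s _; rewrite lee_fin (le_trans (kernel1_majorantP s))//; exact: ler_norm.
Qed.

Definition kernel_mass t : \bar R :=
  (\int[mu]_s (`|ker t s| * weight b s)%:E)%E.

Definition kernel_mass1 : R := fine (kernel_mass 1).

Lemma kernel_mass1E : kernel_mass 1 = kernel_mass1%:E.
Proof.
rewrite /kernel_mass1 fineK// ge0_fin_numE; last first.
  by apply: integral_ge0 => s _; rewrite lee_fin mulr_ge0 ?weight_ge0.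
have /integrableP[_] := integrable_kernel1; apply: le_lt_trans.
rewrite /kernel_mass; under [X in (_ <= X)%E]eq_integral => s _.
  rewrite /= normrM (ger0_norm (weight_ge0 _ _)).
  over.
exact: lexx.
Qed.

Lemma kernel_mass1_ge0 : 0 <= kernel_mass1.
Proof.
rewrite -lee_fin -kernel_mass1E; apply: integral_ge0 => s _.
by rewrite lee_fin mulr_ge0 ?weight_ge0.
Qed.

Lemma measurable_kernel_weight t :
  measurable_fun setT (fun s => `|ker t s| * weight b s).
Proof.
apply: measurable_funM; last exact: measurable_weight.
by apply: measurableT_comp => //; exact: measurable_FLP_kernel.
Qed.

(** Self-similarity of the kernel reduces to time 1: substituting t s for s produces t times t^(d -
    1), that is t^d, and [weightM] splits the weight. *)
Lemma kernel_mass_pos t : 0 < t ->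
  (kernel_mass t <= (t `^ d * weight b t * kernel_mass1)%:E)%E.
Proof.
move=> t0; rewrite /kernel_mass (@ge0_integral_affine _ t 0)//; first last.
- by move=> s; rewrite lee_fin mulr_ge0 ?weight_ge0.
- by apply/measurable_EFinP; exact: measurable_kernel_weight.
have -> : t `^ d = t * t `^ (d - 1) by rewrite mulr_powRB1 ?(ltW t0).
rewrite -!mulrA EFinM lee_wpmul2l ?lee_fin ?(ltW t0)//.
rewrite mulrA EFinM -kernel_mass1E /kernel_mass -ge0_integralZl//; first last.
- by rewrite lee_fin mulr_ge0 ?powR_ge0 ?weight_ge0.
- by move=> s _; rewrite lee_fin mulr_ge0 ?weight_ge0.
- by apply/measurable_EFinP; exact: measurable_kernel_weight.
apply: ge0_le_integral => //.
- by move=> s _; rewrite lee_fin mulr_ge0 ?weight_ge0.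
- apply/measurable_EFinP; apply: (measurableT_comp (measurable_kernel_weight t)).
  exact: measurable_aff.
- apply: measurable_funeM; apply/measurable_EFinP.
  exact: measurable_kernel_weight.
move=> s _; rewrite -EFinM lee_fin addr0 -[X in ker X]mulr1 FLP_kernel_scale//.
rewrite normrM (ger0_norm (powR_ge0 _ _)) -!mulrA ler_wpM2l ?powR_ge0//.
by rewrite mulrCA ler_wpM2l// weightM.
Qed.

(** For [t < 0] the identity [ker t s = - ker (- t) (s - t)] reduces to [- t], and the translation
    costs the second factor [weight b t]. The power |t|^d is kept because it tends to 0 with t,
    which later gives continuity. *)
Lemma kernel_mass_le t :
  (kernel_mass t <= (`|t| `^ d * weight b t ^+ 2 * kernel_mass1)%:E)%E.
Proof.
have w2 : weight b t <= weight b t ^+ 2.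
  by rewrite expr2 ler_peMl ?weight_ge0 ?weight_ge1.
have [t0|t0|<-] := ltgtP 0 t.
- apply: (le_trans (kernel_mass_pos t0)); rewrite lee_fin gtr0_norm//.
  by rewrite ler_wpM2r ?kernel_mass1_ge0// ler_wpM2l ?powR_ge0.
- have c0 : 0 < - t by rewrite oppr_gt0.
  pose F r := (`|ker (- t) r| * weight b (r - (- t)))%:E.
  have mw : measurable_fun setT (fun r : R => weight b (r - (- t))).
    apply: (measurableT_comp (measurable_weight b)).
    exact: measurable_funB.
  have mF : measurable_fun setT F.
    apply/measurable_EFinP; apply: measurable_funM => //.
    by apply: measurableT_comp => //; exact: measurable_FLP_kernel.
  have -> : kernel_mass t = (\int[mu]_r F r)%E.
    rewrite (@ge0_integral_affine _ 1 (- t) F)//; last first.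
      by move=> r; rewrite lee_fin mulr_ge0 ?weight_ge0.
    rewrite mul1e; apply: eq_integral => s _; rewrite /F mul1r addrK.
    have -> : ker t s = - ker (- t) (s - t) by rewrite -FLP_kernelN opprK.
    by rewrite normrN.
  apply: (@le_trans _ _ ((weight b t)%:E * kernel_mass (- t))%E).
    rewrite /kernel_mass -ge0_integralZl//; first last.
    - by rewrite lee_fin weight_ge0.
    - by move=> s _; rewrite lee_fin mulr_ge0 ?weight_ge0.
    - by apply/measurable_EFinP; exact: measurable_kernel_weight.
    apply: ge0_le_integral => //.
    - by move=> s _; rewrite lee_fin mulr_ge0 ?weight_ge0.
    - apply: measurable_funeM; apply/measurable_EFinP.
      exact: measurable_kernel_weight.
    move=> s _; rewrite -EFinM lee_fin mulrCA ler_wpM2l// opprK mulrC.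
    exact: weightD.
  rewrite expr2 mulrA mulrAC mulrC EFinM lee_wpmul2l ?lee_fin ?weight_ge0//.
  by rewrite (le_trans (kernel_mass_pos c0))// weightN ltr0_norm.
- rewrite normr0 powR0 ?gt_eqF// !mul0r /kernel_mass.
  by under eq_integral => s _ do rewrite FLP_kernel0 normr0 mul0r; rewrite integral0.
Qed.

End Kernel.

Section IntegrableEFin.
Context d (T : measurableType d) (R : realType).
Variable mu : {measure set T -> \bar R}.
Implicit Types (D : set T) (f g : T -> R).

Lemma integrableB_EFin D f g : measurable D ->
  mu.-integrable D (EFin \o f) -> mu.-integrable D (EFin \o g) ->
  mu.-integrable D (EFin \o (fun s => f s - g s)).
Proof.
move=> mD fi gi; apply: eq_integrable (integrableB mD fi gi) => // s _ /=.
Qed.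

Lemma integrableD_EFin D f g : measurable D ->
  mu.-integrable D (EFin \o f) -> mu.-integrable D (EFin \o g) ->
  mu.-integrable D (EFin \o (fun s => f s + g s)).
Proof.
move=> mD fi gi; apply: eq_integrable (integrableD mD fi gi) => // s _ /=.
Qed.

Lemma integrableZl_EFin D f (k : R) : measurable D ->
  mu.-integrable D (EFin \o f) ->
  mu.-integrable D (EFin \o (fun s => k * f s)).
Proof.
move=> mD fi; apply: eq_integrable (integrableZl mD k fi) => // s _ /=.
Qed.

End IntegrableEFin.

(** * Improper Riemann integrals as Lebesgue integrals *)

Section Improper.
Context {R : realType}.
Local Notation mu := (@lebesgue_measure R).
Implicit Types (f : R -> R) (a b : \bar R) (u v p I : R).

Definition eoo a b : set R := [set s | (a < s%:E)%E /\ (s%:E < b)%E].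

Lemma measurable_eoo a b : measurable (eoo a b).
Proof.
rewrite (_ : eoo a b = [set s | (a < s%:E)%E] `&` [set s | (s%:E < b)%E])//.
by apply: measurableI; rewrite -[X in measurable X]setTI;
  [apply: emeasurable_fun_o_infty|apply: emeasurable_fun_infty_o] => //.
Qed.

Lemma exhaust_left a (c : R) : (a < c%:E)%E -> exists u : nat -> R,
  (forall n, (a < (u n)%:E)%E /\ u n <= c) /\
  (forall s : R, (a < s%:E)%E -> \forall n \near \oo, u n <= s).
Proof.
case: a => [r| |]//.
  rewrite lte_fin => rc; exists (fun n => r + (c - r) / n.+1%:R).
  have cr : 0 < c - r by rewrite subr_gt0.
  split=> [n|s].
    rewrite lte_fin ltrDl divr_gt0//; split => //.
    by rewrite -lerBrDl ler_pdivrMr// ler_peMr ?ler1n// ltW.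
  rewrite lte_fin => rs; near=> n.
  rewrite -lerBrDl ler_pdivrMr// mulrC -ler_pdivrMr ?subr_gt0//.
  apply: (@le_trans _ _ n%:R); last by rewrite ler_nat.
  by near: n; exact: nbhs_infty_ger.
move=> _; exists (fun n => c - n%:R); split=> [n|s _].
  by rewrite ltNyr gerBl.
near=> n; rewrite lerBlDr -lerBlDl.
by near: n; exact: nbhs_infty_ger.
Unshelve. all: by end_near. Qed.

Lemma exhaust_right b (c : R) : (c%:E < b)%E -> exists v : nat -> R,
  (forall n, ((v n)%:E < b)%E /\ c <= v n) /\
  (forall s : R, (s%:E < b)%E -> \forall n \near \oo, s <= v n).
Proof.
move=> cb; have : (- b < (- c)%:E)%E by rewrite EFinN lteN2.
move=> /exhaust_left[u [hu1 hu2]]; exists (fun n => - u n); split => [n|s sb].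
  by have [? ?] := hu1 n; rewrite EFinN lteNl lerNr.
have /hu2 : (- b < (- s)%:E)%E by rewrite EFinN lteN2.
by apply: filterS => n; rewrite lerNr.
Qed.

(** The two ends move independently, so a limit along one sequence of segments is not enough.
    Dominated convergence makes the integral of |f| outside one segment [[u_ n, v_ n]] smaller than
    [e], and this bounds the error for every larger segment. *)
Lemma cvg_Rintegral_eoo f a b c e : (a < c%:E)%E -> (c%:E < b)%E ->
  mu.-integrable (eoo a b) (EFin \o f) -> 0 < e ->
  exists u0 v0 : R, [/\ (a < u0%:E)%E, u0 <= v0, (v0%:E < b)%E &
    forall u v, (a < u%:E)%E -> u <= u0 -> v0 <= v -> (v%:E < b)%E ->
      `| \int[mu]_(s in `[u, v]) f s - \int[mu]_(s in eoo a b) f s| < e].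
Proof.
move=> ac cb fi e0.
have [u_ [hu1 hu2]] := exhaust_left ac.
have [v_ [hv1 hv2]] := exhaust_right cb.
have mE := measurable_eoo a b.
pose F n s := `|f s| * \1_(~` `[u_ n, v_ n]%classic) s.
have mf : measurable_fun (eoo a b) f.
  by have /integrableP[/measurable_EFinP] := fi.
have mnf : measurable_fun (eoo a b) (fun s => `|f s|).
  exact: measurableT_comp.
have mF n : measurable_fun (eoo a b) (F n).
  apply: measurable_funM => //; apply: measurable_indic; exact: measurableC.
have FO n s : 0 <= F n s <= `|f s|.
  rewrite /F indicE; case: (s \in _); rewrite ?mulr1 ?mulr0 ?lexx ?normr_ge0//.
have cF : \int[mu]_(s in eoo a b) F n s @[n --> \oo] -->
    \int[mu]_(s in eoo a b) cst 0 s.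
  apply: (proj2 (@dominated_Rcvg _ _ _ mu (eoo a b) F (cst 0)
    (fun s => `|f s|) mE mF (measurable_cst _) _ (integrable_norm fi) _)).
  - apply: aeW => s [as_ sb]; apply: cvg_near_cst; near=> n.
    rewrite /F indicE memNset ?mulr0//=; apply; rewrite in_itv/=; apply/andP; split.
      by near: n; exact: hu2.
    by near: n; exact: hv2.
  - by move=> n s _; rewrite ger0_norm; case/andP: (FO n s).
move/cvgrPdist_lt : cF => /(_ _ e0).
move=> [n _ /(_ _ (leqnn n))]; rewrite Rintegral_cst// mul0r sub0r normrN => Fe.
have [[au1 u1c] [vb1 cv1]] := (hu1 n, hv1 n).
exists (u_ n), (v_ n); split => //; first exact: le_trans cv1.
move=> u v au uu vv vb; apply: le_lt_trans (Fe).
have -> : \int[mu]_(s in `[u, v]) f s =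
  \int[mu]_(s in eoo a b) (f s * \1_(`[u, v]%classic) s).
rewrite [RHS](_ : _ = \int[mu]_(s in eoo a b) (f \_ `[u, v]) s); last first.
  apply: eq_Rintegral => s _; rewrite indicE patchE.
  by case: ifPn => _; rewrite ?mulr1 ?mulr0.
rewrite -Rintegral_mkcondr; congr (Rintegral _ _ _).
apply/seteqP; split => s /=; rewrite !in_itv/=; last by move=> [].
move=> /andP[us sv]; split; last exact/andP.
by split; [apply: (lt_le_trans au)|apply: le_lt_trans vb]; rewrite lee_fin.
have fi1 : mu.-integrable (eoo a b) (EFin \o (fun s => f s * \1_(`[u, v]%classic) s)).
apply: le_integrable fi => //.
  by apply/measurable_EFinP; apply: measurable_funM => //; exact: measurable_indic.
move=> s _; rewrite /= lee_fin indicE; case: (s \in _); rewrite ?mulr1 ?mulr0 ?normr0//.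
rewrite -RintegralB// (le_trans (le_normr_Rintegral _ _))//.
exact: integrableB_EFin.
rewrite (le_trans _ (ler_norm _))//; apply: le_Rintegral => //.
+ apply: integrable_norm; exact: integrableB_EFin.
+ apply: le_integrable (integrable_norm fi) => //.
    by apply/measurable_EFinP; apply: mF.
by move=> s _; rewrite /= lee_fin normr_id ger0_norm; case/andP: (FO n s).
+ move=> s [as_ sb]; rewrite /F !indicE in_setC -{2}[f s]mulr1 -mulrBr normrM.
apply: ler_wpM2l => //.
case: (boolP (s \in `[u, v]%classic)) => suv; first by rewrite subrr normr0 ler0n.
rewrite memNset/= ?sub0r ?normrN ?normr1//.
move/negP : suv; rewrite inE/= !in_itv/= => suv /andP[us sv]; apply: suv.
by rewrite (le_trans uu us) (le_trans sv vv).
Unshelve. all: by end_near. Qed.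

Lemma is_improper_Rint_on_unique f a b I : is_improper_Rint_on f a b I ->
  mu.-integrable (eoo a b) (EFin \o f) -> I = \int[mu]_(s in eoo a b) f s.
Proof.
move=> [fR hI] fi; apply/eqP; rewrite -subr_eq0 -normr_le0.
apply/ler_addgt0Pr => e e0; rewrite add0r.
have e20 : 0 < e / 2 by rewrite divr_gt0.
have [u0 [v0 [au0 uv0 vb0 h0]]] := hI _ e20.
have ub0 : (u0%:E < b)%E by apply: le_lt_trans vb0; rewrite lee_fin.
have [u1 [v1 [au1 uv1 vb1 h1]]] := cvg_Rintegral_eoo au0 ub0 fi e20.
pose u := Num.min u0 u1; pose v := Num.max v0 v1.
have au : (a < u%:E)%E by rewrite /u EFin_min lt_min au0.
have vb : (v%:E < b)%E by rewrite /v EFin_max gt_max vb0.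
have uv : u <= v.
  by rewrite /u /v ge_min; apply/orP; left; rewrite le_max uv0.
have {}h0 : `|RS_int f id u v - I| < e / 2.
  by apply: h0 => //; rewrite ?ge_min ?le_max lexx.
have {}h1 : `|\int[mu]_(s in `[u, v]) f s - \int[mu]_(s in eoo a b) f s| < e / 2.
  by apply: h1 => //; rewrite ?ge_min ?le_max lexx orbT.
have [J hJ] := fR _ _ au uv vb.
rewrite (RS_intE hJ) in h0.
have JE := is_RS_int_id_integral hJ _.
rewrite -JE in h1; last first.
  apply: integrableS fi => //; first exact: measurable_eoo.
  move=> s /=; rewrite in_itv/= => /andP[us sv].
  by split; [apply: (lt_le_trans au)|apply: le_lt_trans vb]; rewrite lee_fin.
rewrite (_ : I - _ = (J - \int[mu]_(s in eoo a b) f s) - (J - I)); last by ring.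
by rewrite (le_trans (ler_normB _ _))// [leRHS]splitr lerD// ltW.
Qed.

Lemma is_improper_Rint_on_integral f a b (c : R) : (a < c%:E)%E -> (c%:E < b)%E ->
  mu.-integrable (eoo a b) (EFin \o f) ->
  (forall u v, (a < u%:E)%E -> u <= v -> (v%:E < b)%E ->
     is_RS_int f id u v (\int[mu]_(s in `[u, v]) f s)) ->
  is_improper_Rint_on f a b (\int[mu]_(s in eoo a b) f s).
Proof.
move=> ac cb fi hR; split.
  by move=> u v au uv vb; eexists; exact: hR.
move=> e e0; have [u0 [v0 [au0 uv0 vb0 h0]]] := cvg_Rintegral_eoo ac cb fi e0.
exists u0, v0; split => // u v au uu vv vb.
rewrite (RS_intE (hR _ _ _ _ _))//; first exact: h0.
by rewrite (le_trans uu)// (le_trans uv0).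
Qed.

Lemma Rintegral_eoo_split f a p : (a < p%:E)%E ->
  mu.-integrable (eoo a +oo) (EFin \o f) ->
  \int[mu]_(s in eoo a +oo) f s =
  \int[mu]_(s in eoo a p%:E) f s + \int[mu]_(s in eoo p%:E +oo) f s.
Proof.
move=> ap fi.
have pE : eoo a +oo = (eoo a p%:E `|` [set p]) `|` eoo p%:E +oo.
  apply/seteqP; split => s; rewrite /eoo/=.
    move=> [as_ _]; have [sp|ps|->] := ltgtP s p.
    - by left; left; rewrite lte_fin.
    - by right; rewrite lte_fin ltry.
    - by left; right.
  move=> [[[as_ _]|->]|[+ _]]; rewrite ?ltry//.
  by rewrite lte_fin => ps; split => //; apply: lt_trans ap _; rewrite lte_fin.
have fi2 : mu.-integrable (eoo a p%:E `|` [set p]) (EFin \o f).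
  apply: integrableS fi; [exact: measurable_eoo| |].
    by apply: measurableU => //; exact: measurable_eoo.
  by rewrite pE; exact: subsetUl.
rewrite pE Rintegral_setU.
- rewrite Rintegral_setU//.
  + by rewrite Rintegral_set1 addr0.
  + exact: measurable_eoo.
  + by apply/disj_setPRL => s /= -> [_]; rewrite ltxx.
- by apply: measurableU => //; exact: measurable_eoo.
- exact: measurable_eoo.
- by rewrite -pE.
- apply/disj_setPRL => s [ps _] [[_ sp]|/= sp].
    by have := lt_trans ps sp; rewrite ltxx.
  by move: ps; rewrite sp ltxx.
Qed.

Lemma is_improper_Rint_from_unique f s a I : is_improper_Rint_from f a s I ->
  mu.-integrable (eoo a +oo) (EFin \o f) -> I = \int[mu]_(x in eoo a +oo) f x.
Proof.
elim: s a I => [|p s ih] a I /=; first exact: is_improper_Rint_on_unique.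
move=> [J [K [hJ hK ->]]] fi.
have ap : (a < p%:E)%E.
  have [_ /(_ _ ltr01)[u0 [v0 [au0 uv vp _]]]] := hJ.
  by apply: (lt_trans au0); apply: le_lt_trans vp; rewrite lee_fin.
rewrite (Rintegral_eoo_split ap fi); congr (_ + _).
  apply: (is_improper_Rint_on_unique hJ); apply: integrableS fi; rewrite ?ltry//.
  - exact: measurable_eoo. - exact: measurable_eoo.
  - by move=> x [ax _]; split => //; exact: ltry.
apply: ih => //; apply: integrableS fi.
- exact: measurable_eoo. - exact: measurable_eoo.
- by move=> x [px _]; split; [exact: lt_trans px|exact: ltry].
Qed.

Lemma eooT : eoo -oo +oo = setT.
Proof. by apply/seteqP; split => // s _; split; rewrite ?ltNyr ?ltry. Qed.

(** For an integrable function every admissible list of exceptional points leads to the Lebesgue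
    integral; this is why the improper integral does not depend on the list and why [xget] selects
    the right value. *)
Lemma is_improper_Rint_unique f I : is_improper_Rint f I ->
  mu.-integrable setT (EFin \o f) -> I = \int[mu]_x f x.
Proof.
by rewrite -eooT => -[s [_ h]]; exact: is_improper_Rint_from_unique h.
Qed.

Lemma is_improper_Rint_from_integral f (s : seq R) a :
  (if s is p :: _ then (a < p%:E)%E else (a < +oo)%E) -> sorted <%R s ->
  mu.-integrable (eoo a +oo) (EFin \o f) ->
  (forall u v, (a < u%:E)%E -> u <= v -> (forall p, p \in s -> ~ (u <= p <= v)) ->
     is_RS_int f id u v (\int[mu]_(x in `[u, v]) f x)) ->
  is_improper_Rint_from f a s (\int[mu]_(x in eoo a +oo) f x).
Proof.
have between (b : \bar R) (q : R) : (b < q%:E)%E -> exists c : R, (b < c%:E)%E /\ c < q.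
  case: b => [r| |]//.
    by rewrite lte_fin => rq; exists ((r + q) / 2); rewrite lte_fin !midf_lt.
  by move=> _; exists (q - 1); rewrite ltNyr ltrBlDr ltrDl.
elim: s a => [|p s ih] a /= ap ss fi hR.
  have [c ac] : exists c : R, (a < c%:E)%E.
    case: a ap {fi hR} => [r _| |]//; first by exists (r + 1); rewrite lte_fin ltrDl.
    by exists 0; exact: ltNyr.
  apply: (is_improper_Rint_on_integral ac) => //; first exact: ltry.
  by move=> u v au uv _; exact: hR.
have aS : subset (eoo a p%:E) (eoo a +oo).
  by move=> x [ax _]; split => //; exact: ltry.
have pS : subset (eoo p%:E +oo) (eoo a +oo).
  by move=> x [px _]; split; [exact: lt_trans px|exact: ltry].
exists (\int[mu]_(x in eoo a p%:E) f x), (\int[mu]_(x in eoo p%:E +oo) f x).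
have pall := order_path_min lt_trans ss.
split; last exact: Rintegral_eoo_split.
- have [c [ac cp]] := between _ _ ap.
  apply: (is_improper_Rint_on_integral ac) => //.
    by apply: integrableS fi => //; exact: measurable_eoo.
  move=> u v au uv vp; apply: hR => // q; rewrite lte_fin in vp.
  rewrite inE => /predU1P[->|qs] /andP[uq qv].
    by move: (le_lt_trans qv vp); rewrite ltxx.
  have pq := allP pall _ qs.
  by move: (lt_trans (le_lt_trans qv vp) pq); rewrite ltxx.
- apply: ih.
  + case: s ss pall {hR} => [_ _|q s /= /andP[pq _] _]; rewrite ?ltry//.
  + exact: path_sorted ss.
  + by apply: integrableS fi => //; exact: measurable_eoo.
  + move=> u v pu uv hs; apply: hR => //; first exact: lt_trans pu.
    move=> q; rewrite inE => /predU1P[->|/hs//] /andP[up _].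
    by move: pu; rewrite lte_fin ltNge up.
Qed.

Lemma improper_RintE f (s : seq R) : sorted <%R s ->
  mu.-integrable setT (EFin \o f) ->
  (forall u v, u <= v -> (forall p, p \in s -> ~ (u <= p <= v)) ->
     is_RS_int f id u v (\int[mu]_(x in `[u, v]) f x)) ->
  improper_Rint f = \int[mu]_x f x.
Proof.
move=> ss fi hR.
have hI : is_improper_Rint f (\int[mu]_x f x).
  exists s; split => //; rewrite -eooT; apply: is_improper_Rint_from_integral => //.
  - by case: s {ss hR} => [|p s]; rewrite ?ltNyr.
  - by rewrite eooT.
  - by move=> u v _; exact: hR.
rewrite /improper_Rint; case: xgetP => [J _ hJ|/(_ _ hI)//].
exact: is_improper_Rint_unique.
Qed.

End Improper.

(** * Right-continuous paths of controlled growth and their kernel integrals *)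

Section RightContinuous.
Context {R : realType}.
Implicit Types x : R -> R.

(** The preimage of an open ray differs from its interior only at discontinuities, hence by a
    countable set. *)
Lemma right_cont_measurable x : right_cont x -> measurable_fun setT x.
Proof.
move=> rx; pose D := [set t | ~ {for t, continuous x}].
have cD : countable D by exact: right_cont_countable_discontinuity.
apply: (measurability _ (RGenOInfty.measurableE R)) => _ [_ [r ->] <-].
rewrite setTI; set A := _ @^-1` _.
have -> : A = A° `|` (A `&` D).
  apply/seteqP; split => [t At|t [/interior_subset//|[]//]].
  have [Dt|/contrapT ct] := pselect (D t); [by right|left].
  have : nbhs (x t) `]r, +oo[%classic.
    apply: open_nbhs_nbhs; split; [exact: interval_open|exact: At].
  exact: ct.
apply: measurableU; first by apply: open_measurable; apply: open_interior.
apply: countable_measurable => //; apply: sub_countable cD.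
by apply: subset_card_le; exact: subIsetr.
Qed.

Lemma right_contB x y : right_cont x -> right_cont y ->
  right_cont (fun s => x s - y s).
Proof. by move=> rx ry t; apply: cvgB; [exact: rx|exact: ry]. Qed.

Lemma right_cont_cst (c : R) : right_cont (fun=> c).
Proof. by move=> t; exact: cvg_cst. Qed.

Lemma right_cont_translate x h : right_cont x -> right_cont (fun s => x (s + h)).
Proof.
move=> rx t; apply/cvgrPdist_lt => e e0.
have [eta /= eta0 heta] := (cvgrPdist_lt _ _).1 (rx (t + h)) _ e0.
exists eta => //= s; rewrite /ball/= => ts ts'; apply: heta.
  by rewrite /ball/= opprD addrACA subrr addr0.
by rewrite ltrD2r.
Qed.

Lemma continuous_right_cont x : continuous x -> right_cont x.
Proof. by move=> cx t; apply: cvg_at_right_filter; exact: cx. Qed.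

End RightContinuous.

Section GoodPath.
Context {R : realType}.
Local Notation mu := (@lebesgue_measure R).

(** All that the pathwise part of the proof uses of a trajectory of the driving process; the
    constant [C] may depend on the trajectory. *)
Definition good_path (b C : R) (x : R -> R) : Prop :=
  right_cont x /\ forall s, `|x s| <= C * weight b s.

Lemma good_path_ge0 b C x : good_path b C x -> 0 <= C.
Proof.
by move=> [_ /(_ 0)]; rewrite weight0 mulr1; apply: le_trans.
Qed.

Lemma good_path_translate b C x h : 0 <= b -> good_path b C x ->
  good_path b (C * weight b h) (fun s => x (s + h)).
Proof.
move=> b0 gx; have [rx hx] := gx; split; first exact: right_cont_translate.
move=> s; rewrite (le_trans (hx _))// -mulrA ler_wpM2l ?(good_path_ge0 gx)//.
by rewrite mulrC weightD.
Qed.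

Lemma good_pathB b C1 C2 x y : good_path b C1 x -> good_path b C2 y ->
  good_path b (C1 + C2) (fun s => x s - y s).
Proof.
move=> [rx hx] [ry hy]; split; first exact: right_contB.
by move=> s; rewrite (le_trans (ler_normB _ _))// mulrDl lerD.
Qed.

Lemma good_path_cst b (c : R) : 0 <= b -> good_path b `|c| (fun=> c).
Proof.
move=> b0; split; first exact: right_cont_cst.
by move=> s; rewrite ler_peMr ?weight_ge1.
Qed.

Lemma measurable_good_path b C x : good_path b C x -> measurable_fun setT x.
Proof. by move=> [/right_cont_measurable]. Qed.

End GoodPath.

Section FLPpath.
Context {R : realType}.
Variables (d b : R).
Hypotheses (d_gt0 : 0 < d) (d_lt1 : d < 1) (b_ge0 : 0 <= b) (b_lt : b < 1 - d).
Local Notation mu := (@lebesgue_measure R).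
Local Notation ker := (FLP_kernel d).
Implicit Types (s t h : R) (x : R -> R).

Definition kernel_bound t : R := `|t| `^ d * weight b t ^+ 2 * kernel_mass1 d b.

Lemma good_kernel_le t C x : good_path b C x ->
  (\int[mu]_s `|(ker t s * x s)%:E| <= (C * kernel_bound t)%:E)%E.
Proof.
move=> gx; have C0 := good_path_ge0 gx.
apply: (@le_trans _ _ (C%:E * kernel_mass d b t)%E); last first.
  by rewrite EFinM lee_wpmul2l ?lee_fin//; exact: kernel_mass_le.
rewrite /kernel_mass -ge0_integralZl//; first last.
- by move=> s _; rewrite lee_fin mulr_ge0 ?weight_ge0.
- by apply/measurable_EFinP; exact: measurable_kernel_weight.
apply: ge0_le_integral => //.
- apply: measurableT_comp => //; apply/measurable_EFinP; apply: measurable_funM.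
    exact: measurable_FLP_kernel.
  exact: measurable_good_path gx.
- apply: measurable_funeM; apply/measurable_EFinP.
  exact: measurable_kernel_weight.
move=> s _; rewrite -EFinM lee_fin normrM mulrCA ler_wpM2l//.
by have [_] := gx.
Qed.

Lemma integrable_kernel_good t C x : good_path b C x ->
  mu.-integrable setT (EFin \o (fun s => ker t s * x s)).
Proof.
move=> gx; apply/integrableP; split.
  apply/measurable_EFinP; apply: measurable_funM.
    exact: measurable_FLP_kernel.
  exact: measurable_good_path gx.
by rewrite (le_lt_trans (good_kernel_le t gx))// ltry.
Qed.

Definition kernel_int x t := \int[mu]_s (ker t s * x s).

Lemma kernel_int_le t C x : good_path b C x ->
  `|kernel_int x t| <= C * kernel_bound t.
Proof.
move=> gx; have fi := integrable_kernel_good t gx.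
rewrite -lee_fin; apply: le_trans (good_kernel_le t gx).
rewrite /kernel_int /Rintegral -abse_EFin fineK; last exact: integrable_fin_num.
by apply: le_abse_integral => //; exact: measurable_int fi.
Qed.

Lemma kernel_int_translate t h C x : good_path b C x ->
  kernel_int x (t + h) - kernel_int x h = kernel_int (fun s => x (s + h)) t.
Proof.
move=> gx; have gxh := good_path_translate h b_ge0 gx.
rewrite -RintegralB//; [|exact: integrable_kernel_good gx..].
under eq_Rintegral => s _ do rewrite -mulrBl FLP_kernel_shift.
rewrite -(@Rintegral_translate _ h (fun s => ker t (s - h) * x s)); first last.
- have := integrableB_EFin measurableT (integrable_kernel_good (t + h) gx) (integrable_kernel_good h gx).
  by apply: eq_integrable => // s _ /=; rewrite -mulrBl FLP_kernel_shift.
- apply: measurable_funM; last exact: measurable_good_path gx.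
  apply: (measurableT_comp (measurable_FLP_kernel _ _)).
  exact: measurable_funB.
by apply: eq_Rintegral => s _; rewrite addrK.
Qed.

(* The kernel integral of a constant is additive and homogeneous of degree d
   in t, hence zero. *)
Lemma kernel_int_cst (c : R) t : kernel_int (fun=> c) t = 0.
Proof.
have gc := good_path_cst c b_ge0.
have hD : kernel_int (fun=> c) (t + t) = kernel_int (fun=> c) t + kernel_int (fun=> c) t.
  by apply/eqP; rewrite -subr_eq (kernel_int_translate _ _ gc).
have hM : kernel_int (fun=> c) (2 * t) = 2 `^ d * kernel_int (fun=> c) t.
  have m2 : measurable_fun setT (fun s => ker (2 * t) s * c).
    by apply: measurable_funM => //; exact: measurable_FLP_kernel.
  have hA := @Rintegral_affine R 2 0 _ (ltr0Sn R 1) m2 (integrable_kernel_good (2 * t) gc).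
  transitivity (2 * \int[mu]_s (ker (2 * t) (2 * s + 0) * c)); first exact: hA.
  rewrite -(mulr_powRB1 (ler0n _ 2) d_gt0) -mulrA; congr (_ * _).
  rewrite -RintegralZl//; last exact: integrable_kernel_good gc.
  by apply: eq_Rintegral => s _; rewrite addr0 FLP_kernel_scale// mulrA.
have : 2 `^ d < 2 :> R.
  by rewrite -[ltRHS]powRr1// /powR pnatr_eq0/= ltr_expR ltr_pM2r// ln_gt0// ltr1n.
move: hM; rewrite mulr_natl mulr2n hD; set k := kernel_int _ _ => hM h2.
apply/eqP; have : (2 - 2 `^ d) * k = 0 by rewrite mulrBl -hM; ring.
by move/eqP; rewrite mulf_eq0 subr_eq0 gt_eqF.
Qed.

Lemma kernel_int_increments t h C x : good_path b C x ->
  kernel_int x (t + h) - kernel_int x h =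
  kernel_int (fun s => x (s + h) - x h) t.
Proof.
move=> gx; rewrite (kernel_int_translate _ _ gx).
have gxh := good_path_translate h b_ge0 gx.
have gc := good_path_cst (x h) b_ge0.
rewrite /kernel_int.
under [RHS]eq_Rintegral => s _ do rewrite mulrBr.
rewrite RintegralB//; last 2 first.
  exact: integrable_kernel_good gxh.
  exact: integrable_kernel_good gc.
by rewrite -[X in _ - X]/(kernel_int (fun=> x h) t) kernel_int_cst subr0.
Qed.

Lemma kernel_bound_ge0 t : 0 <= kernel_bound t.
Proof.
by rewrite /kernel_bound !mulr_ge0 ?powR_ge0 ?sqr_ge0// kernel_mass1_ge0.
Qed.

Lemma kernel_bound_cvg0 : kernel_bound h @[h --> (0 : R)] --> (0 : R).
Proof.
apply/cvgr0Pnorm_lt => e e0.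
(* The summand 1 keeps the divisor positive even if the other factor vanishes; the same device
   recurs below. *)
have K0 : 0 < 4 `^ b * kernel_mass1 d b + 1.
  by rewrite ltr_wpDl// mulr_ge0 ?powR_ge0// kernel_mass1_ge0.
pose e' := e / (4 `^ b * kernel_mass1 d b + 1).
have e'0 : 0 < e' by rewrite divr_gt0.
near=> h; rewrite ger0_norm ?kernel_bound_ge0// /kernel_bound.
have h1 : `|h| <= 1.
  near: h; apply: filterS (nbhsx_ballx (0 : R) 1 ltr01) => z.
  by rewrite /ball/= sub0r normrN => /ltW.
have hd : `|h| `^ d < e'.
  have -> : e' = (e' `^ d^-1) `^ d by rewrite -powRrM mulVf ?gt_eqF// powRr1// ltW.
  rewrite gt0_ltr_powR ?nnegrE ?powR_ge0//.
  near: h; apply: filterS (nbhsx_ballx (0 : R) (e' `^ d^-1) (powR_gt0 _ e'0)) => z.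
  by rewrite /ball/= sub0r normrN.
have w2 : weight b h ^+ 2 <= 4 `^ b.
  have -> : 4 `^ b = (2 `^ b) ^+ 2 :> R.
    by rewrite expr2 -powRM//; congr (_ `^ _); rewrite -natrM.
  rewrite lerXn2r ?nnegrE ?weight_ge0 ?powR_ge0//.
  by rewrite ge0_ler_powR ?nnegrE ?addr_ge0//; lra.
rewrite -mulrA (@le_lt_trans _ _ (`|h| `^ d * (4 `^ b * kernel_mass1 d b)))//.
  by rewrite ler_wpM2l ?powR_ge0// ler_wpM2r// kernel_mass1_ge0.
rewrite (@le_lt_trans _ _ (`|h| `^ d * (4 `^ b * kernel_mass1 d b + 1)))//.
  by rewrite ler_wpM2l ?powR_ge0// lerDl.
by rewrite -ltr_pdivlMr.
Unshelve. all: by end_near. Qed.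

(** By translation, the increment from [t] to [s] is the kernel integral at time [s - t] of a
    translated good path, so the bound near time 0 suffices. *)
Lemma kernel_int_continuous C x : good_path b C x -> continuous (kernel_int x).
Proof.
move=> gx t; apply/cvgrPdist_lt => e e0.
have C0 := good_path_ge0 gx.
have K0 : 0 < C * weight b t + 1 by rewrite ltr_wpDl// mulr_ge0 ?weight_ge0.
have := kernel_bound_cvg0; move/cvgrPdist_lt => /(_ (e / (C * weight b t + 1))).
rewrite divr_gt0// => /(_ isT)[eta /= eta0 heta].
exists eta => //= s; rewrite /ball/= => ts.
rewrite distrC -{1}(subrK t s) (kernel_int_translate _ _ gx).
have gxt := good_path_translate t b_ge0 gx.
rewrite (le_lt_trans (kernel_int_le _ gxt))//.
have := heta (s - t); rewrite /ball/= sub0r normrN distrC => /(_ ts).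
rewrite sub0r normrN ger0_norm ?kernel_bound_ge0// ltr_pdivlMr//; apply: le_lt_trans.
by rewrite mulrC ler_wpM2l ?kernel_bound_ge0// lerDl.
Qed.

Lemma good_kernel_int C x : good_path b C x ->
  good_path (d + 2 * b) (C * kernel_mass1 d b) (kernel_int x).
Proof.
move=> gx; split.
  exact/continuous_right_cont/(kernel_int_continuous gx).
move=> t; rewrite (le_trans (kernel_int_le _ gx))// -mulrA.
rewrite ler_wpM2l ?(good_path_ge0 gx)// /kernel_bound mulrC.
rewrite ler_wpM2l ?kernel_mass1_ge0//.
have p0 : 0 < 1 + `|t| by rewrite ltr_pwDl.
rewrite /weight powRD; last by rewrite (gt_eqF p0) implybT.
rewrite expr2 mulrDl !mul1r powRD; last by rewrite (gt_eqF p0) implybT.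
rewrite ler_wpM2r ?mulr_ge0 ?powR_ge0//.
by rewrite ge0_ler_powR ?nnegrE ?addr_ge0// ?lerDr// ltW.
Qed.

Lemma ppow_continuous r : r != 0 -> {for r, continuous (ppow d)}.
Proof.
move=> r0; have [rn|rp|/eqP] := ltgtP r 0; last by rewrite (negbTE r0).
- rewrite /prop_for /continuous_at (ppow_neg d_lt1 (ltW rn)).
  apply: cvg_near_cst; near=> s; rewrite ppow_neg//.
  by apply: ltW; near: s; exact: lt_nbhsl.
- rewrite /prop_for /continuous_at (ppow_pos d rp).
  apply: (@cvg_trans _ (s `^ (d - 1) @[s --> r])).
    apply: near_eq_cvg; near=> s; rewrite ppow_pos//.
    by near: s; exact: lt_nbhsr.
  by have [/derivable1_diffP/differentiable_continuous] := is_derive1_powR (d - 1) rp.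
Unshelve. all: by end_near. Qed.

Lemma FLP_kernel_continuous t s : s != 0 -> s != t -> {for s, continuous (ker t)}.
Proof.
move=> s0 st; apply: cvgB.
  apply: (@continuous_comp _ _ _ (fun s => t - s) (ppow d)).
    by apply: cvgB; [exact: cvg_cst|exact: cvg_id].
  by apply: ppow_continuous; rewrite subr_eq0 eq_sym.
apply: (@continuous_comp _ _ _ -%R (ppow d)); first exact: opp_continuous.
by apply: ppow_continuous; rewrite oppr_eq0.
Qed.

Lemma ppow_bounded u v t : u <= v -> ~ (u <= t <= v) ->
  exists M, forall s, u <= s <= v -> ppow d (t - s) <= M.
Proof.
move=> uv utv; have [tu|ut] := ltP t u.
  by exists 0 => s /andP[us _]; rewrite ppow_neg// subr_le0 (le_trans (ltW tu)).
have vt : v < t by rewrite ltNge; apply/negP => tv; apply: utv; rewrite ut.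
exists (ppow d (t - v)) => s /andP[_ sv].
by apply: ppow_anti; rewrite ?subr_gt0// lerD2l lerN2.
Qed.

(** On a segment that avoids 0 and [t] the kernel is bounded and continuous, while a good path is
    bounded with countably many discontinuities; the product is therefore Riemann integrable there,
    with the Lebesgue value. *)
Lemma improper_Rint_kernel t C x : good_path b C x ->
  improper_Rint (fun s => ker t s * x s) = kernel_int x t.
Proof.
move=> gx; have [rx hx] := gx; have C0 := good_path_ge0 gx.
(* The list must be strictly increasing, so the two singularities have to be merged when [t = 0]. *)
pose l := if t == 0 then [:: 0] else [:: Num.min 0 t; Num.max 0 t].
have l0 : 0 \in l /\ t \in l.
  rewrite /l; case: eqP => [->|_]; first by rewrite inE.
  by rewrite !inE; case: (leP 0 t) => _; rewrite !eqxx ?orbT.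
apply: (improper_RintE (s := l)).
- rewrite /l; case: eqP => //= /eqP t0; rewrite andbT.
  by move: t0; case: (ltgtP 0 t) => // <-; rewrite eqxx.
- exact: integrable_kernel_good gx.
move=> u v uv hl; have [h0 ht] := (hl _ l0.1, hl _ l0.2).
have [M1 hM1] := ppow_bounded uv ht; have [M2 hM2] := ppow_bounded uv h0.
pose W := weight b u * weight b (v - u).
have hW s : u <= s <= v -> weight b s <= W.
  move=> /andP[us sv]; rewrite -[in leLHS](subrKC u s).
  rewrite (le_trans (weightD _ _ _))// ler_wpM2l ?weight_ge0//.
  rewrite ge0_ler_powR ?nnegrE ?addr_ge0//.
  by rewrite lerD2l !ger0_norm ?subr_ge0 ?lerD2r// (le_trans us).
apply: (@is_RS_int_id_ae_continuous _ _ _ _ ((M1 + M2) * (C * W))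
  [set s | ~ {for s, continuous x}]) => //.
- apply: measurable_funTS; apply: measurable_funM.
    exact: measurable_FLP_kernel.
  exact: measurable_good_path gx.
- move=> s sI; rewrite normrM ler_pM//.
    rewrite FLP_kernelE (le_trans (ler_normB _ _))// !ger0_norm ?ppow_ge0//.
    by rewrite lerD ?hM1// -sub0r hM2.
  by rewrite (le_trans (hx _))// ler_wpM2l ?hW.
- exact: right_cont_countable_discontinuity.
move=> s /andP[us sv] /contrapT cs; apply: cvgM => //.
apply: FLP_kernel_continuous; apply/eqP => sE.
  by apply: h0; rewrite -sE !ltW.
by apply: ht; rewrite -sE !ltW.
Qed.

End FLPpath.

(** * The Langevin equation along a path *)

Section IntegrationByParts.
Context {R : realType}.
Local Notation mu := (@lebesgue_measure R).
Implicit Types (f g y : R -> R) (a b t : R).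

Lemma continuous_segment_uniform f a b e : continuous f -> 0 < e ->
  exists2 delta, 0 < delta & forall u v, a <= u <= b ->
    `|u - v| < delta -> `|f u - f v| < e.
Proof.
move=> cf e0.
have := @segment_compact R a b; rewrite compact_near_coveringP.
pose P (delta u : R) := forall v, `|u - v| < delta -> `|f u - f v| < e.
move=> /(_ R (0^'+) P _)[].
  move=> x _; have e20 : 0 < e / 2 by rewrite divr_gt0.
  have [eta /= eta0 heta] := (cvgrPdist_lt _ _).1 (cf x) _ e20.
  have eta20 : 0 < eta / 2 by rewrite divr_gt0.
  exists (ball x (eta / 2), [set r | r < eta / 2]); first split.
  - exact: nbhsx_ballx.
  - exact: nbhs_right_lt.
  move=> [u r] [/= xu re] v uv.
  rewrite -(subrKA (f x)) (le_lt_trans (ler_normD _ _))// [ltRHS]splitr ltrD//.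
    rewrite distrC; apply: heta => /=; rewrite (lt_trans xu)//.
    by rewrite ltr_pdivrMr// ltr_pMr// ltr1n.
  apply: heta => /=; rewrite -(subrKA u) (le_lt_trans (ler_normD _ _))//.
  by rewrite [ltRHS]splitr ltrD// (lt_trans uv).
move=> delta /= delta0 hd.
have d20 : 0 < delta / 2 by rewrite divr_gt0.
exists (delta / 2) => // u v uab.
apply: (hd (delta / 2)) => //=.
  by rewrite sub0r normrN gtr0_norm// ltr_pdivrMr// ltr_pMr// ltr1n.
Qed.

Lemma continuous_integrable_itv f a b : continuous f ->
  mu.-integrable `[a, b] (EFin \o f).
Proof.
move=> cf; apply: continuous_compact_integrable; first exact: segment_compact.
exact: continuous_subspaceT.
Qed.

Lemma Rintegral_FTC2 f g a b : a <= b -> continuous g ->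
  (forall u : R, is_derive u 1 f (g u)) ->
  \int[mu]_(u in `[a, b]) g u = f b - f a.
Proof.
rewrite le_eqVlt => /predU1P[<- _ _|ab cg df].
  by rewrite set_itv1 Rintegral_set1 subrr.
have cf u : {for u, continuous f}.
  by have [/derivable1_diffP/differentiable_continuous] := df u.
rewrite /Rintegral (@continuous_FTC2 _ g f a b)//.
- exact: continuous_subspaceT.
- split.
  + by move=> u _; have [] := df u.
  + exact/cvg_at_right_filter/cf.
  + exact/cvg_at_left_filter/cf.
- by move=> u _; rewrite derive1E; have [_ ->] := df u.
Qed.

Lemma Rintegral_split f a b t : a <= b -> b <= t ->
  mu.-integrable `[a, t] (EFin \o f) ->
  \int[mu]_(u in `[a, t]) f u =
  \int[mu]_(u in `[a, b]) f u + \int[mu]_(u in `[b, t]) f u.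
Proof.
move=> ab bt fi; have := @Rintegral_itvB _ f (BLeft a) (BRight t) b fi.
rewrite !bnd_simp => /(_ ab bt); rewrite Rintegral_itv_obnd_cbnd.
  by move=> <-; rewrite addrC subrK.
by apply: integrableS fi => //; apply: subset_itvr; rewrite bnd_simp.
Qed.

Section ByParts.
Variables (f g y : R -> R).
Hypotheses (cg : continuous g) (g0 : forall u, 0 <= g u)
  (df : forall u : R, is_derive u 1 f (g u)) (cy : continuous y).

Let cgy : continuous (fun u => g u * y u).
Proof. by move=> u; apply: cvgM; [exact: cg|exact: cy]. Qed.

Lemma Rintegral_osc u v c w : u <= v ->
  (forall s, u <= s <= v -> `|y s - c| <= w) ->
  `|\int[mu]_(s in `[u, v]) (g s * y s) - c * (f v - f u)| <= w * (f v - f u).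
Proof.
move=> uv hw; rewrite -(Rintegral_FTC2 uv cg df).
have gi := @continuous_integrable_itv _ u v cg.
have gyi := @continuous_integrable_itv _ u v cgy.
rewrite -!RintegralZl// -RintegralB//; last exact: integrableZl_EFin.
have di : mu.-integrable `[u, v] (EFin \o (fun s => g s * y s - c * g s)).
  by apply: integrableB_EFin => //; exact: integrableZl_EFin.
rewrite (le_trans (le_normr_Rintegral _ di))//.
apply: le_Rintegral => //; first exact: integrable_norm.
  exact: integrableZl_EFin.
move=> s; rewrite /= in_itv/= => suv.
by rewrite [c * _]mulrC -mulrBr normrM (ger0_norm (g0 s)) mulrC ler_wpM2r// hw.
Qed.

(** The integrator [y] may have unbounded variation, whereas [f] is monotone. The error of a cell is
    the integral of g y over it, with [y] replaced by [y (x i)] before the tag and by [y (x i.+1)]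
    after the tag. It is at most [w] times the increment of [f], and these increments telescope. *)
Lemma is_RS_int_by_parts a b : a <= b ->
  is_RS_int f y a b
    (f b * y b - f a * y a - \int[mu]_(s in `[a, b]) (g s * y s)).
Proof.
move=> ab; split => // e e0.
have fmono u v : u <= v -> f u <= f v.
  move=> uv; rewrite -subr_ge0 -(Rintegral_FTC2 uv cg df).
  by apply: Rintegral_ge0 => s _.
have K0 : 0 < f b - f a + 1 by rewrite ltr_wpDl// subr_ge0 fmono.
have eK0 : 0 < e / (f b - f a + 1) by rewrite divr_gt0.
have [delta delta0 hd] := continuous_segment_uniform a b cy eK0.
exists delta => // n x xi x0 xn hx.
pose w := e / (f b - f a + 1).
have hxx i : (i < n)%N -> x i <= x i.+1.
  by move=> /hx[h1 h2 _]; exact: le_trans h2.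
have xab i : (i <= n)%N -> a <= x i <= b.
  by move=> i_n; rewrite -x0 -xn !(partition_le hxx).
have -> : f b * y b - f a * y a = \sum_(i < n) (f (x i.+1) * y (x i.+1) - f (x i) * y (x i)).
  rewrite -x0 -xn -(big_mkord xpredT (fun i => f (x i.+1) * y (x i.+1) - f (x i) * y (x i))).
  by rewrite (telescope_sumr (fun i => f (x i) * y (x i))).
have -> : \int[mu]_(s in `[a, b]) (g s * y s) =
    \sum_(i < n) \int[mu]_(s in `[x i, x i.+1]) (g s * y s).
  rewrite -x0 -xn; apply: Rintegral_partition => //.
  exact: continuous_integrable_itv.
rewrite -!sumrB (le_lt_trans (ler_norm_sum _ _ _))//.
apply: (@le_lt_trans _ _ (\sum_(i < n) w * (f (x i.+1) - f (x i)))).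
  apply: ler_sum => -[i i_n] _ /=; have [h1 h2 h3] := hx _ i_n.
  have [/andP[ax xb] /andP[ax1 xb1]] := (xab _ (ltnW i_n), xab _ i_n).
  rewrite (Rintegral_split h1 h2); last exact: continuous_integrable_itv.
  have o1 : `|\int[mu]_(s in `[x i, xi i]) (g s * y s) - y (x i) * (f (xi i) - f (x i))|
      <= w * (f (xi i) - f (x i)).
    apply: Rintegral_osc => // s /andP[s1 s2]; apply/ltW/hd.
      by rewrite (le_trans ax s1) (le_trans s2)// (le_trans h2).
    exact: (dist_lt_itv (lexx _) (hxx _ i_n) s1 (le_trans s2 h2) h3).
  have o2 : `|\int[mu]_(s in `[xi i, x i.+1]) (g s * y s) - y (x i.+1) * (f (x i.+1) - f (xi i))|
      <= w * (f (x i.+1) - f (xi i)).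
    apply: Rintegral_osc => // s /andP[s1 s2]; apply/ltW/hd.
      by rewrite (le_trans ax (le_trans h1 s1)) (le_trans s2).
    exact: (dist_lt_itv (hxx _ i_n) (lexx _) (le_trans h1 s1) s2 h3).
  move: o1 o2; set A := \int[mu]_(s in _) _; set B := \int[mu]_(s in _) _ => o1 o2.
  rewrite (_ : _ - _ = (A - y (x i) * (f (xi i) - f (x i))) +
    (B - y (x i.+1) * (f (x i.+1) - f (xi i)))); last by ring.
  by rewrite (le_trans (ler_normD _ _))// (le_trans (lerD o1 o2))// -mulrDr ler_wpM2l ?(ltW eK0)//; lra.
rewrite -mulr_sumr -(big_mkord xpredT (fun i => f (x i.+1) - f (x i))).
rewrite (telescope_sumr (fun i => f (x i)))// x0 xn /w.
by rewrite mulrAC ltr_pdivrMr// ltr_pM2l// ltrDl.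
Qed.

End ByParts.
End IntegrationByParts.

Lemma EFin_Rintegral d (T : measurableType d) (R : realType)
    (mu : {measure set T -> \bar R}) (D : set T) (f : T -> R) :
  measurable D -> mu.-integrable D (EFin \o f) ->
  ((\int[mu]_(x in D) f x)%:E = \int[mu]_(x in D) (f x)%:E)%E.
Proof. by move=> mD fi; rewrite /Rintegral fineK//; exact: integrable_fin_num. Qed.

Section ExpAffine.
Context {R : realType}.
Implicit Types k c u : R.

Lemma is_derive_expR_affine k c u :
  is_derive u 1 (fun v : R => expR (k * v + c)) (k * expR (k * u + c)).
Proof.
have da : is_derive u 1 (fun v : R => k * v + c) k.
  have := is_deriveD (is_deriveZ k (is_derive_id u 1)) (is_derive_cst c u 1).
  by move/is_derive_eq; apply; rewrite addr0 /GRing.scale/= mulr1.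
have := @is_derive1_comp _ expR (fun v : R => k * v + c) u _ _ (is_derive_expR _) da.
by move/is_derive_eq; apply; rewrite mulrC.
Qed.

Lemma is_derive_expR_linear k u :
  is_derive u 1 (fun v : R => expR (k * v)) (k * expR (k * u)).
Proof.
have := is_derive_expR_affine k 0 u.
by under eq_fun do rewrite addr0; rewrite addr0.
Qed.

Lemma continuous_expR_linear k : continuous (fun v : R => expR (k * v)).
Proof.
move=> u; have [/derivable1_diffP/differentiable_continuous] := is_derive_expR_linear k u.
exact.
Qed.

End ExpAffine.

Section ExponentialWeight.
Context {R : realType}.
Local Notation mu := (@lebesgue_measure R).
Variables (lam q : R).
Hypothesis lam_gt0 : 0 < lam.

(** A single term of the exponential series at (lam / 2) (1 + |u|), of degree at least [q], is
    enough. Only half the rate is spent, so that [expR (lam * u)] times this bound still decays like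
    [expR (lam / 2 * u)] at -oo. *)
Lemma weight_le_expR : exists2 M, 0 <= M &
  forall u, weight q u <= M * expR (lam / 2 * `|u|).
Proof.
pose n := Num.truncn q.
have qn : q <= n.+1%:R by rewrite ltW// truncnS_gt.
pose k := lam / 2.
have k0 : 0 < k by rewrite divr_gt0.
exists (k^-1 ^+ n.+1 * n.+1`!%:R * expR k).
  by rewrite !mulr_ge0 ?expR_ge0// exprn_ge0// invr_ge0 ltW.
move=> u; have w1 : 1 <= 1 + `|u| by rewrite lerDl.
apply: (@le_trans _ _ ((1 + `|u|) ^+ n.+1)).
  by rewrite -powR_mulrn ?addr_ge0// ler_powR.
have z0 : 0 <= k * (1 + `|u|) by rewrite mulr_ge0 ?addr_ge0// ltW.
have := expR_ge1Dxn n z0.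
set z := _ / _ => h; have {h} : z <= expR (k * (1 + `|u|)).
  by apply: le_trans h; rewrite lerDr.
rewrite /z ler_pdivrMr ?ltr0n ?fact_gt0// exprMn mulrC -ler_pdivlMr ?exprn_gt0//.
move=> /le_trans; apply; rewrite mulrDr mulr1 expRD exprVn.
by rewrite [leLHS](_ : _ = (k ^+ n.+1)^-1 * n.+1`!%:R * expR k * expR (k * `|u|))//; ring.
Qed.

Lemma integrable_expR_ninfty k t : 0 < k ->
  mu.-integrable `]-oo, t] (EFin \o (fun u => expR (k * u))).
Proof.
move=> k0.
have ck : continuous (fun u : R => expR (k * u)).
  exact: continuous_expR_linear.
have dk (u : R) : is_derive u 1 (k^-1 \*: (fun u : R => expR (k * u))) (expR (k * u)).
  have := is_deriveZ k^-1 (is_derive_expR_linear k u).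
  by move/is_derive_eq; apply; rewrite /GRing.scale/= mulKf// gt_eqF.
have mk : measurable_fun setT (fun u : R => expR (k * u)) by exact: continuous_measurable_fun.
apply/integrableP; split; first by apply/measurable_EFinP; exact: measurable_funTS.
under eq_integral do rewrite /= ger0_norm ?expR_ge0//.
pose F n := [set` `[t - n%:R, t]].
have FU : \bigcup_n F n = `]-oo, t]%classic.
  apply/seteqP; split => [u [n _]|u]; rewrite /F/= !in_itv/=.
    by move=> /andP[].
  move=> ut; exists (Num.truncn (t - u)).+1 => //=.
  by rewrite in_itv/= ut andbT lerBlDr -lerBlDl ltW// truncnS_gt.
rewrite -FU.
apply: (@le_lt_trans _ _ (k^-1 * expR (k * t))%:E); last exact: ltry.
apply: ge0_integral_bigcup_le.
- apply/nondecreasing_seqP => n; apply/subsetPset; apply: subset_itvr.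
  by rewrite bnd_simp lerD2l lerN2 ler_nat.
- by move=> n; exact: measurable_itv.
- by apply/measurable_EFinP; exact: measurable_funTS.
- by move=> u; rewrite lee_fin expR_ge0.
move=> n; have fi := @continuous_integrable_itv _ _ (t - n%:R) t ck.
rewrite -(EFin_Rintegral _ fi)// lee_fin.
rewrite (Rintegral_FTC2 _ ck dk) ?gerBl//.
by rewrite mulr_ge0 ?expR_ge0// invr_ge0 ltW.
Qed.

Lemma integrable_expR_good t C (y : R -> R) : continuous y -> (forall u, `|y u| <= C * weight q u) ->
  mu.-integrable `]-oo, t] (EFin \o (fun u => expR (lam * u) * y u)).
Proof.
move=> cy hy; have [M M0 hM] := weight_le_expR.
have C0 : 0 <= C by have := hy 0; rewrite weight0 mulr1; apply: le_trans.
have ke : 0 < lam / 2 by rewrite divr_gt0.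
have gi := integrable_expR_ninfty t ke.
have Gi : mu.-integrable `]-oo, t]
    (EFin \o (fun u => C * M * expR (lam * `|t|) * expR (lam / 2 * u))).
  exact: integrableZl_EFin.
apply: le_integrable Gi => //.
  apply/measurable_EFinP; apply: measurable_funTS; apply: continuous_measurable_fun.
  move=> u; apply: cvgM; last exact: cy.
  exact: continuous_expR_linear.
move=> u; rewrite /= in_itv/= => ut.
rewrite lee_fin normrM (ger0_norm (expR_ge0 _)) [leRHS]ger0_norm; last first.
  by rewrite !mulr_ge0 ?expR_ge0.
have h1 : `|y u| <= C * M * expR (lam / 2 * `|u|).
  by rewrite (le_trans (hy u))// -mulrA ler_wpM2l.
(* For [u <= 0] the two exponentials in [u] agree; the factor with |t| pays for the range from 0 to
   [t]. *)
have h2 : expR (lam * u) * expR (lam / 2 * `|u|) <= expR (lam * `|t|) * expR (lam / 2 * u).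
  rewrite -!expRD ler_expR.
  have : `|u| <= 2 * `|t| - u.
    have := ler_norm t; have := normr_ge0 t; case: (ger0P u) => u0; lra.
  by nra.
rewrite -[leRHS]mulrA; apply: (@le_trans _ _ (expR (lam * u) * (C * M * expR (lam / 2 * `|u|)))).
  by rewrite ler_wpM2l ?expR_ge0.
by rewrite mulrCA ler_wpM2l// mulr_ge0.
Qed.

Lemma expR_good_cvg0 C (y : R -> R) : (forall u, `|y u| <= C * weight q u) ->
  expR (lam * a) * y a @[a --> -oo] --> (0 : R).
Proof.
move=> hy; have [M M0 hM] := weight_le_expR.
have C0 : 0 <= C by have := hy 0; rewrite weight0 mulr1; apply: le_trans.
apply/cvgr0Pnorm_lt => e e0.
have K0 : 0 < C * M + 1 by rewrite ltr_wpDl// mulr_ge0.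
near=> a; rewrite normrM (ger0_norm (expR_ge0 _)).
have a0 : a <= 0 by near: a; exact: nbhs_ninfty_le.
have ae : a < ln (e / (C * M + 1)) / (lam / 2).
  by near: a; apply: nbhs_ninfty_lt; rewrite num_real.
have {}ae : expR (lam / 2 * a) < e / (C * M + 1).
  rewrite -[ltRHS]lnK ?posrE ?divr_gt0// ltr_expR mulrC -ltr_pdivlMr// divr_gt0//.
apply: (@le_lt_trans _ _ (C * M * expR (lam / 2 * a))).
  have -> : expR (lam / 2 * a) = expR (lam * a) * expR (lam / 2 * `|a|).
    by rewrite -expRD (ler0_norm a0); congr expR; field.
  rewrite mulrCA ler_wpM2l ?expR_ge0//.
  by apply: (le_trans (hy a)); rewrite -[leRHS]mulrA; exact: ler_wpM2l.
apply: (@le_lt_trans _ _ ((C * M + 1) * expR (lam / 2 * a))).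
  by rewrite ler_wpM2r ?expR_ge0// lerDl.
by rewrite mulrC -ltr_pdivlMr.
Unshelve. all: by end_near. Qed.

End ExponentialWeight.

Section LangevinPath.
Context {R : realType}.
Local Notation mu := (@lebesgue_measure R).
Variables (lam q C : R) (y : R -> R).
Hypothesis lam_gt0 : 0 < lam.
Hypotheses (cy : continuous y) (hy : forall u, `|y u| <= C * weight q u).
Implicit Types (s t : R).

Let ey u := expR (lam * u) * y u.

Definition exp_mean t := \int[mu]_(u in `]-oo, t]) (expR (lam * u) * y u).

Definition OU_path t := y t - lam * (expR (- lam * t) * exp_mean t).

Let continuous_ey : continuous ey.
Proof. by move=> u; apply: cvgM; [exact: continuous_expR_linear|exact: cy]. Qed.

Lemma is_derive_exp_mean t : is_derive t 1 exp_mean (expR (lam * t) * y t).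
Proof.
have ct : {for t, continuous ey} by exact: continuous_ey.
have tt : t < t + 1 by rewrite ltrDl.
have [|dF F'] := @continuous_FTC1 _ ey -oo%O t (t + 1) tt
  (integrable_expR_good lam_gt0 _ cy hy) _ ct; first by rewrite ltNyr.
split; [exact: dF|rewrite -derive1E; exact: F'].
Qed.

Lemma continuous_exp_mean : continuous exp_mean.
Proof.
by move=> t; have [/derivable1_diffP/differentiable_continuous] := is_derive_exp_mean t.
Qed.

Lemma continuous_OU_path : continuous OU_path.
Proof.
move=> t; apply: cvgB; first exact: cy.
apply: cvgM; first exact: cvg_cst.
by apply: cvgM; [exact: continuous_expR_linear|exact: continuous_exp_mean].
Qed.

(** With [V] as below, [OU_path] is [y - lam V] by definition and also the derivative of [V] by the
    product rule. Integrating this derivative gives the equation although [y] need not be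
    differentiable. *)
Lemma OU_path_solution s t : s <= t ->
  OU_path t - OU_path s =
  - lam * (\int[mu]_(u in `[s, t]) OU_path u) + (y t - y s).
Proof.
move=> st.
pose V u := expR (- lam * u) * exp_mean u.
have dV (u : R) : is_derive u 1 V (OU_path u).
  have := is_deriveM (is_derive_expR_linear (- lam) u) (is_derive_exp_mean u).
  have e1 : expR (- lam * u) * expR (lam * u) = 1.
    by rewrite -expRD mulNr addNr expR0.
  move/is_derive_eq; apply; rewrite /GRing.scale/= /OU_path.
  by rewrite [X in X + _]mulrA e1; ring.
rewrite (Rintegral_FTC2 st continuous_OU_path dV) /OU_path /V; ring.
Qed.

Lemma RS_by_parts_exp a t : a <= t ->
  is_RS_int (fun u => expR (- lam * (t - u))) y a t
    (y t - expR (- lam * (t - a)) * y a -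
     lam * expR (- lam * t) * \int[mu]_(u in `[a, t]) (expR (lam * u) * y u)).
Proof.
move=> at_; pose f u := expR (- lam * (t - u)).
pose g u := lam * expR (- lam * (t - u)).
have fE : f = (fun u => expR (lam * u + - lam * t)).
  by apply/funext => u; rewrite /f; congr expR; ring.
have df (u : R) : is_derive u 1 f (g u).
  rewrite /g -/(f u) fE; exact: is_derive_expR_affine.
have cg : continuous g.
  move=> u; apply: cvgM; first exact: cvg_cst.
  by have [/derivable1_diffP/differentiable_continuous] := df u.
have g0 u : 0 <= g u by rewrite mulr_ge0 ?expR_ge0// ltW.
have := is_RS_int_by_parts cg g0 df cy at_.
have -> : f t * y t = y t by rewrite /f subrr mulr0 expR0 mul1r.
have -> // : \int[mu]_(s in `[a, t]) (g s * y s) =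
    lam * expR (- lam * t) * \int[mu]_(u in `[a, t]) (expR (lam * u) * y u).
rewrite -RintegralZl//; last exact: continuous_integrable_itv.
apply: eq_Rintegral => u _; rewrite mulrA; congr (_ * _).
rewrite /g -mulrA -expRD; congr (_ * expR _); ring.
Qed.

Lemma exp_mean_split a t : a <= t ->
  exp_mean t = exp_mean a + \int[mu]_(u in `[a, t]) (expR (lam * u) * y u).
Proof.
move=> at_; have fi := integrable_expR_good lam_gt0 t cy hy.
have := @Rintegral_itvB _ ey -oo%O (BRight t) a fi.
rewrite !bnd_simp => /(_ isT at_); rewrite Rintegral_itv_obnd_cbnd.
  by rewrite /exp_mean => <-; rewrite addrC subrK.
by apply: integrableS fi => //; apply: subset_itvr.
Qed.

Lemma exp_mean_ninfty : exp_mean a @[a --> -oo] --> (0 : R).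
Proof.
apply/cvgr0Pnorm_lt => e e0; have e20 : 0 < e / 2 by rewrite divr_gt0.
have fi : mu.-integrable (eoo -oo 0%:E) (EFin \o ey).
  apply: integrableS (integrable_expR_good lam_gt0 0 cy hy) => //.
    exact: measurable_eoo.
  by move=> u [_]; rewrite lte_fin /= in_itv/= => /ltW.
have I0 : \int[mu]_(u in eoo -oo 0%:E) ey u = exp_mean 0.
  rewrite /exp_mean -Rintegral_itv_bndo_bndc; last first.
    apply: integrableS (integrable_expR_good lam_gt0 0 cy hy) => //.
    by move=> u /=; rewrite !in_itv/= => /ltW.
  congr (Rintegral _ _ _); apply/seteqP; split => u; rewrite /eoo/= in_itv/= lte_fin.
    by case.
  by rewrite ltNyr.
have [u0 [v0 [_ uv0 v00 h]]] := @cvg_Rintegral_eoo _ ey -oo%E 0%:E (-1) (e / 2)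
  (ltNyr _) (ltrN10 _) fi e20.
rewrite lte_fin in v00.
(* The approximation by segments holds only for right ends [v < 0]; continuity of [exp_mean] at 0
   closes the gap. *)
near (0 : R)^'- => v.
have v0v : v0 <= v by apply: ltW; near: v; exact: nbhs_left_gt.
have v_lt0 : v < 0 by near: v; exact: nbhs_left_lt.
have ev : `|exp_mean 0 - exp_mean v| < e / 2.
  near: v; apply: (cvgrPdist_lt _ _).1 e20; apply: cvg_at_left_filter.
  exact: continuous_exp_mean.
near=> a.
have au0 : a <= u0 by near: a; apply: nbhs_ninfty_le; rewrite num_real.
have av : a <= v by rewrite (le_trans au0)// (le_trans uv0).
have := h a v (ltNyr _) au0 v0v; rewrite lte_fin => /(_ v_lt0).
rewrite I0 => h1.
have h2 := exp_mean_split av.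
rewrite (_ : exp_mean a = - (\int[mu]_(s in `[a, v]) ey s - exp_mean 0) -
  (exp_mean 0 - exp_mean v)); last by rewrite h2 /ey; ring.
by rewrite (le_lt_trans (ler_normB _ _))// normrN [ltRHS]splitr ltrD.
Unshelve. all: by end_near. Qed.

Lemma is_RS_int_ninfty_OU t :
  is_RS_int_ninfty (fun u => expR (- lam * (t - u))) y t (OU_path t).
Proof.
split=> [a at_|]; first by eexists; exact: RS_by_parts_exp.
have e1 (u : R) : expR (- lam * (t - u)) = expR (- lam * t) * expR (lam * u).
  by rewrite -expRD; congr expR; ring.
apply: (@cvg_trans _ ((y t - expR (- lam * t) * (expR (lam * a) * y a) -
     lam * expR (- lam * t) * (exp_mean t - exp_mean a)) @[a --> -oo])).
  apply: near_eq_cvg; near=> a.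
  have at_ : a <= t by near: a; apply: nbhs_ninfty_le; rewrite num_real.
  rewrite (RS_intE (RS_by_parts_exp at_)) e1 (exp_mean_split at_); ring.
rewrite /OU_path (_ : y t - _ = y t - expR (- lam * t) * 0 -
  lam * expR (- lam * t) * (exp_mean t - 0)); last by rewrite mulr0 !subr0 mulrA.
apply: cvgB.
  apply: cvgB; first exact: cvg_cst.
  by apply: cvgM; [exact: cvg_cst|exact: (expR_good_cvg0 lam_gt0 hy)].
apply: cvgM; first exact: cvg_cst.
by apply: cvgB; [exact: cvg_cst|exact: exp_mean_ninfty].
Unshelve. all: by end_near. Qed.

Lemma RS_int_ninfty_OU t :
  RS_int_ninfty (fun u => expR (- lam * (t - u))) y t = OU_path t.
Proof.
rewrite /RS_int_ninfty; case: xgetP => [J _ [_ hJ]|/(_ (OU_path t))[]]; last first.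
  exact: is_RS_int_ninfty_OU.
by apply: cvg_unique hJ (is_RS_int_ninfty_OU t).2.
Qed.

End LangevinPath.

Section OUTranslate.
Context {R : realType}.
Local Notation mu := (@lebesgue_measure R).

Lemma is_RS_int_translate (f g : R -> R) (a b h c I : R) :
  is_RS_int f g (a + h) (b + h) I ->
  is_RS_int (fun u => f (u + h)) (fun u => g (u + h) - c) a b I.
Proof.
move=> [ab hI]; split; first by rewrite lerD2r in ab.
move=> e e0; have [delta d0 hd] := hI e e0; exists delta => // n x xi x0 xn hx.
have := hd n (fun i => x i + h) (fun i => xi i + h).
rewrite x0 xn => /(_ erefl erefl) hS.
rewrite (_ : \sum_(i < n) _ =
  \sum_(i < n) f (xi i + h) * (g (x i.+1 + h) - g (x i + h))); last first.
  by apply: eq_bigr => i _; congr (_ * _); ring.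
by apply: hS => i /hx[h1 h2 h3]; split; rewrite ?lerD2r//; lra.
Qed.

Lemma RS_int_translate (f g : R -> R) (a b h c : R) :
  RS_integrable f g (a + h) (b + h) ->
  RS_int (fun u => f (u + h)) (fun u => g (u + h) - c) a b =
  RS_int f g (a + h) (b + h).
Proof.
by move=> [I hI]; rewrite (RS_intE hI); exact/RS_intE/is_RS_int_translate.
Qed.

Lemma is_RS_int_ninfty_translate (f g : R -> R) (t h c I : R) :
  is_RS_int_ninfty f g (t + h) I ->
  is_RS_int_ninfty (fun u => f (u + h)) (fun u => g (u + h) - c) t I.
Proof.
move=> [h1 h2]; split.
  move=> a at_; have [|J hJ] := h1 (a + h); first by rewrite lerD2r.
  by exists J; exact: is_RS_int_translate.
apply: (@cvg_trans _ ((fun a => RS_int f g (a + h) (t + h)) a @[a --> -oo])).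
  apply: near_eq_cvg; near=> a; rewrite RS_int_translate//.
  apply: h1; rewrite lerD2r; near: a; apply: nbhs_ninfty_le; by rewrite num_real.
apply: (@cvg_comp _ _ _ (fun a => a + h) (fun a => RS_int f g a (t + h)) _ (-oo)) => //.
apply/cvgrNyPle => A; near=> a; rewrite -lerBrDr.
near: a; apply: nbhs_ninfty_le; by rewrite num_real.
Unshelve. all: by end_near. Qed.

(** Both sides are limits of Riemann-Stieltjes integrals, in which the constant [y h] cancels from
    each increment of the integrator and a translation only relabels partitions; so neither has to
    be computed in the Lebesgue formula. *)
Lemma OU_path_translate lam q C (y : R -> R) t h : 0 < lam -> 0 <= q ->
  continuous y -> (forall u, `|y u| <= C * weight q u) ->
  OU_path lam (fun s => y (s + h) - y h) t = OU_path lam y (t + h).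
Proof.
move=> lam0 q0 cy hy; pose y' s := y (s + h) - y h.
have C0 : 0 <= C by have := hy 0; rewrite weight0 mulr1; apply: le_trans.
have cy' : continuous y'.
  move=> s; apply: cvgB; last exact: cvg_cst.
  apply: (@continuous_comp _ _ _ (fun s => s + h) y); last exact: cy.
  by apply: cvgD; [exact: cvg_id|exact: cvg_cst].
have hy' u : `|y' u| <= (C * weight q h + C * weight q h) * weight q u.
  rewrite mulrDl (le_trans (ler_normB _ _))// lerD//.
    rewrite (le_trans (hy _))// -mulrA ler_wpM2l// mulrC; exact: weightD.
  by rewrite (le_trans (hy _))// ler_peMr ?weight_ge1// mulr_ge0 ?weight_ge0.
have h1 := is_RS_int_ninfty_translate (y h) (is_RS_int_ninfty_OU lam0 cy hy (t + h)).
have [_ h2] := is_RS_int_ninfty_OU lam0 cy' hy' t.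
move: h1 => [_]; rewrite (_ : (fun u => expR (- lam * (t + h - (u + h)))) =
  (fun u => expR (- lam * (t - u)))); last first.
  by apply/funext => u; congr expR; ring.
by move=> h1; exact: cvg_unique h2 h1.
Qed.

Lemma linear_ode_unique lam (D : R -> R) : continuous D ->
  (forall s t, s <= t -> D t - D s = - lam * \int[mu]_(u in `[s, t]) D u) ->
  forall t, D t = expR (- lam * t) * D 0.
Proof.
move=> cD hD t.
have dD (u : R) : is_derive u 1 D (- lam * D u).
  (* The integral equation is available only from left to right, so a base point to the left of [u]
     is needed to describe [D] on both sides of [u]. *)
  pose F v := \int[mu]_(w in `[u - 1, v]) D w.
  have uu : u < u + 1 by rewrite ltrDl.
  have u1 : u - 1 < u by rewrite gtrBl.
  have fi := @continuous_integrable_itv _ D (u - 1) (u + 1) cD.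
  have cu : {for u, continuous D} by exact: cD.
  have [dF F'] := continuous_FTC1_closed uu fi u1 cu.
  have dF' : is_derive u 1 F (D u) by split; [exact: dF|rewrite -derive1E; exact: F'].
  have dG : is_derive u 1 (cst (D (u - 1)) + (- lam) \*: F) (- lam * D u).
    have := is_deriveD (is_derive_cst (D (u - 1)) u 1) (is_deriveZ (- lam) dF').
    by move/is_derive_eq; apply; rewrite add0r.
  have eqG : \forall v \near u, (cst (D (u - 1)) + (- lam) \*: F) v = D v.
    near=> v; have uv : u - 1 <= v by apply: ltW; near: v; exact: lt_nbhsr.
    rewrite (_ : _ v = D (u - 1) + - lam * F v)// /F -(hD _ _ uv).
    by rewrite addrC subrK.
  have [dG1 dG2] := dG; split.
    exact: near_eq_derivable dG1.
  by rewrite -dG2; apply: near_eq_derive => //; near do apply/esym.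
have dE (u : R) : is_derive u 1 ((fun v : R => expR (lam * v)) * D) 0.
  have := is_deriveM (is_derive_expR_linear lam u) (dD u).
  by move/is_derive_eq; apply; rewrite /GRing.scale/=; ring.
have hh : expR (lam * t) * D t = expR (lam * 0) * D 0 := is_derive_0_is_cst t 0 dE.
move: hh; rewrite mulr0 expR0 mul1r => <-.
by rewrite mulrA -expRD mulNr addNr expR0 mul1r.
Unshelve. all: by end_near. Qed.

End OUTranslate.

Lemma Rintegral_sum d (T : measurableType d) (R : realType)
    (m : {measure set T -> \bar R})
    (D : set T) (f : nat -> T -> R) N : measurable D ->
  (forall i, m.-integrable D (EFin \o f i)) ->
  m.-integrable D (EFin \o (fun s => \sum_(i < N) f i s)) /\
  \int[m]_(s in D) (\sum_(i < N) f i s) = \sum_(i < N) \int[m]_(s in D) f i s.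
Proof.
move=> mD fi; elim: N => [|N [ih1 ih2]].
  split; first by under eq_fun do rewrite big_ord0; exact: integrable0.
  under eq_Rintegral do rewrite big_ord0.
  by rewrite Rintegral_cst// mul0r big_ord0.
split.
  under eq_fun do rewrite big_ord_recr/=.
  exact: integrableD_EFin.
under eq_Rintegral do rewrite big_ord_recr/=.
by rewrite RintegralD// big_ord_recr/= ih2.
Qed.

(** * Integrals as limits of functions of finitely many coordinates *)

Section RiemannFunctional.
Context {R : realType}.
Local Notation mu := (@lebesgue_measure R).
Implicit Types (k z : R -> R) (n j : nat) (s : R).

Definition grid_pt n j : R := j%:R / n.+1%:R - n.+1%:R.

Definition grid_size n : nat := 2 * n.+1 ^ 2.

Definition grid_coef k n j : R :=
  \int[mu]_s (k s * \1_(`[grid_pt n j, grid_pt n j.+1[%classic) s).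

(** The grid has mesh 1 / (n + 1) and covers [[- n.+1%:R, n.+1%:R]]. The kernel is integrated
    exactly over each cell and only the path is sampled, so the singularities of the kernel do no
    harm; sampling at the right end of a cell suits right-continuous paths. *)
Definition grid_functional k n z : R :=
  \sum_(j < grid_size n) grid_coef k n j * z (grid_pt n j.+1).

Lemma grid_pt0 n : grid_pt n 0 = - n.+1%:R.
Proof. by rewrite /grid_pt mul0r sub0r. Qed.

Lemma grid_pt_size n : grid_pt n (grid_size n) = n.+1%:R.
Proof.
rewrite /grid_pt /grid_size natrM natrX expr2 mulrA mulfK ?pnatr_eq0//; ring.
Qed.

Lemma grid_pt_le n i j : (i <= j)%N -> grid_pt n i <= grid_pt n j.
Proof. by move=> ij; rewrite lerD2r ler_wpM2r// ler_nat. Qed.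

Lemma grid_ptS n j : grid_pt n j.+1 = grid_pt n j + n.+1%:R^-1.
Proof. by rewrite /grid_pt -natr1 mulrDl mul1r addrAC. Qed.

Lemma grid_pt_gap n j s : grid_pt n j <= s -> grid_pt n j.+1 - s <= n.+1%:R^-1.
Proof. by move=> js; rewrite grid_ptS lerBlDr addrC lerD2l. Qed.

Lemma grid_locate n s : - n.+1%:R <= s < n.+1%:R -> exists2 j, (j < grid_size n)%N &
  grid_pt n j <= s < grid_pt n j.+1.
Proof.
rewrite -grid_pt0 -grid_pt_size; elim: (grid_size n) => [|m ih] /andP[s0 s1].
  by move: (le_lt_trans s0 s1); rewrite ltxx.
have [sm|ms] := ltP s (grid_pt n m).
  by have [|j ? ?] := ih; [rewrite s0|exists j => //; exact: ltnW].
by exists m => //; rewrite ms.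
Qed.

Definition grid_step n z s : R :=
  \sum_(j < grid_size n) \1_(`[grid_pt n j, grid_pt n j.+1[%classic) s * z (grid_pt n j.+1).

Lemma grid_stepE n z s j : (j < grid_size n)%N ->
  grid_pt n j <= s < grid_pt n j.+1 -> grid_step n z s = z (grid_pt n j.+1).
Proof.
move=> j_n /andP[js sj]; rewrite /grid_step (bigD1 (Ordinal j_n))//= big1 => [|i ij].
  by rewrite addr0 indicE mem_set ?mul1r//= in_itv/= js.
rewrite indicE memNset ?mul0r//= in_itv/= => /andP[is_ si].
have [lt_ij|lt_ji|eq_ij] := ltngtP i j.
- by have := lt_le_trans si (le_trans (grid_pt_le n lt_ij) js); rewrite ltxx.
- by have := lt_le_trans sj (le_trans (grid_pt_le n lt_ji) is_); rewrite ltxx.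
- by move/negP: ij; apply; apply/eqP/val_inj.
Qed.

Lemma grid_step_out n z s : ~ (- n.+1%:R <= s < n.+1%:R) -> grid_step n z s = 0.
Proof.
move=> ns; rewrite /grid_step big1// => j _.
rewrite indicE memNset ?mul0r//= in_itv/= => /andP[js sj]; apply: ns.
rewrite -{1}grid_pt0 -grid_pt_size (le_trans _ js) ?grid_pt_le//=.
by rewrite (lt_le_trans sj)// grid_pt_le.
Qed.

(** The sampled path converges pointwise by right-continuity. The sample used at [s] lies at most 1
    to the right of [s], so submultiplicativity bounds it by C [weight q 1] times [weight q s], and
    dominated convergence applies. *)
Lemma grid_functional_cvg k q C z : 0 <= q -> right_cont z ->
  (forall s, `|z s| <= C * weight q s) -> measurable_fun setT k ->
  mu.-integrable setT (EFin \o (fun s => k s * weight q s)) ->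
  grid_functional k n z @[n --> \oo] --> \int[mu]_s (k s * z s).
Proof.
move=> q0 rz hz mk kwi.
have C0 : 0 <= C by have := hz 0; rewrite weight0 mulr1; apply: le_trans.
have ki : mu.-integrable setT (EFin \o k).
  apply: le_integrable kwi => //; first exact/measurable_EFinP.
  by move=> s _; rewrite lee_fin /= normrM ler_peMr// ger0_norm ?weight_ge0 ?weight_ge1.
have kji n j : mu.-integrable setT
    (EFin \o (fun s => k s * \1_(`[grid_pt n j, grid_pt n j.+1[%classic) s)).
  apply: le_integrable ki => //.
    by apply/measurable_EFinP; apply: measurable_funM => //; exact: measurable_indic.
  move=> s _; rewrite lee_fin /= normrM indicE.
  by case: (_ \in _); rewrite ?normr1 ?mulr1 ?normr0 ?mulr0.
have stepE n : grid_functional k n z = \int[mu]_s (k s * grid_step n z s).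
  have [_] := @Rintegral_sum _ _ _ mu setT (fun j s => z (grid_pt n j.+1) *
    (k s * \1_(`[grid_pt n j, grid_pt n j.+1[%classic) s)) (grid_size n) measurableT
    (fun j => integrableZl_EFin _ measurableT (kji n j)).
  rewrite /grid_functional => hE.
  transitivity (\int[mu]_s (\sum_(j < grid_size n) z (grid_pt n j.+1) *
    (k s * \1_(`[grid_pt n j, grid_pt n j.+1[%classic) s))).
    rewrite hE; apply: eq_bigr => j _; rewrite RintegralZl// mulrC//.
  apply: eq_Rintegral => s _; rewrite /grid_step mulr_sumr; apply: eq_bigr => j _; ring.
under eq_fun do rewrite stepE.
pose g s := C * weight q 1 * `|k s * weight q s|.
have gi : mu.-integrable setT (EFin \o g).
  by apply: integrableZl_EFin => //; exact: integrable_norm.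
apply: (proj2 (@dominated_Rcvg _ _ _ mu setT (fun n s => k s * grid_step n z s)
  (fun s => k s * z s) g measurableT _ _ _ gi _)).
- move=> n; apply: measurable_funM => //; apply: measurable_sum => j.
  by apply: measurable_funM => //; exact: measurable_indic.
- by apply: measurable_funM => //; exact: right_cont_measurable.
- apply: aeW => s _; apply: cvgM; first exact: cvg_cst.
  apply/cvgrPdist_lt => e e0.
  have [eta /= eta0 heta] := (cvgrPdist_lt _ _).1 (rz s) _ e0.
  near=> n.
  have sn : `|s| < n.+1%:R.
    by rewrite -natr1 ltr_wpDr// (lt_le_trans (truncnS_gt `|s|))// ler_nat;
       near: n; exact: nbhs_infty_ge.
  have [|j jn sj] := @grid_locate n s.
    by move: sn; rewrite ltr_norml => /andP[/ltW -> ->].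
  rewrite (grid_stepE z jn sj); have /andP[js sj'] := sj.
  apply: heta => //=; rewrite distrC gtr0_norm ?subr_gt0//.
  have : n.+1%:R^-1 < eta.
    by near: n; exact: (near_infty_natSinv_lt (PosNum eta0)).
  exact: le_lt_trans (grid_pt_gap js).
- move=> n s _; rewrite /g normrM mulrC normrM mulrA mulrAC ler_wpM2r//.
  rewrite (ger0_norm (weight_ge0 _ _)).
  have [sn|/grid_step_out ->] := pselect (- n.+1%:R <= s < n.+1%:R); last first.
    by rewrite normr0 !mulr_ge0 ?weight_ge0.
  have [j jn sj] := grid_locate sn; rewrite (grid_stepE z jn sj).
  rewrite (le_trans (hz _))// -mulrA ler_wpM2l// mulrC.
  have /andP[js sj'] := sj.
  rewrite -[in leLHS](subrKC s (grid_pt n j.+1)) (le_trans (weightD _ _ q0))//.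
  rewrite ler_wpM2l ?weight_ge0// /weight ge0_ler_powR ?nnegrE ?addr_ge0//.
  rewrite lerD2l normr1 gtr0_norm ?subr_gt0//.
  have : n.+1%:R^-1 <= 1 :> R by rewrite invf_le1// ler1n.
  exact: le_trans (grid_pt_gap js).
Unshelve. all: by end_near. Qed.

End RiemannFunctional.

(** * Laws on path spaces *)

Section PathSpace.
Context {R : realType} (I : pointedType).

Definition coordinates : set (set (I -> R)) :=
  [set A | exists i (B : set R), measurable B /\ A = [set x | B (x i)]].

(** The product sigma-algebra. It serves with [I := R] for trajectories and with [I := nat] for
    sequences of increments. *)
Definition path_space := g_sigma_algebraType coordinates.

HB.instance Definition _ := Measurable.on path_space.

Lemma measurable_coordinate i : measurable_fun setT (fun x : path_space => x i).
Proof.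
move=> _ B mB; rewrite setTI; apply: sub_sigma_algebra.
by exists i, B.
Qed.

Lemma measurable_into_path_space d (T : measurableType d) (f : T -> path_space) :
  (forall i, measurable_fun setT (fun w => f w i)) -> measurable_fun setT f.
Proof.
move=> mf; apply: (@measurability _ _ T path_space setT f coordinates erefl) => _ [_ [i [B [mB ->]]] <-].
by rewrite setTI -[X in measurable X]setTI; exact: mf.
Qed.

(** Indices may repeat, so the intersection of two rectangles is obtained by concatenating their
    lists of conditions. *)
Definition rectangle n (i : nat -> I) (B : nat -> set R) : set (I -> R) :=
  [set x | forall k, (k < n)%N -> B k (x (i k))].

Definition rectangles : set (set (I -> R)) :=
  [set A | exists n i B, (forall k, measurable (B k)) /\ A = rectangle n i B].

Lemma measurable_rectangle n i B : (forall k, measurable (B k)) ->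
  measurable (rectangle n i B : set path_space).
Proof.
move=> mB; elim: n => [|n ih].
  rewrite (_ : rectangle 0 i B = setT)//.
  by apply/seteqP; split => // x _ k.
rewrite (_ : rectangle n.+1 i B = rectangle n i B `&` [set x | B n (x (i n))]).
  apply: measurableI => //; rewrite -[X in measurable X]setTI.
  exact: measurable_coordinate.
apply/seteqP; split => [x h|x [h1 h2] k].
  by split => [k kn|]; apply: h => //; exact: ltnW.
by rewrite ltnS leq_eqVlt => /predU1P[->//|]; exact: h1.
Qed.

Lemma path_space_rectangles : @measurable _ path_space = <<s rectangles >>.
Proof.
apply/seteqP; split.
  apply: smallest_sub; first exact: smallest_sigma_algebra.
  move=> _ [i [B [mB ->]]]; apply: sub_sigma_algebra.
  exists 1%N, (fun=> i), (fun=> B); split => //.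
  by apply/seteqP; split => [x Bx [|]//|x /(_ 0%N)]; exact.
apply: smallest_sub; first exact: sigma_algebra_measurable.
by move=> _ [n [i [B [mB ->]]]]; exact: measurable_rectangle.
Qed.

Lemma rectanglesI : setI_closed rectangles.
Proof.
move=> _ _ [n1 [i1 [B1 [mB1 ->]]]] [n2 [i2 [B2 [mB2 ->]]]].
exists (n1 + n2)%N, (fun k => if (k < n1)%N then i1 k else i2 (k - n1)%N).
exists (fun k => if (k < n1)%N then B1 k else B2 (k - n1)%N); split.
  by move=> k; case: ifP.
apply/seteqP; split => [x [h1 h2] k kn /=|x h].
  case: ifPn => [|]; first exact: h1.
  by rewrite -leqNgt => n1k; apply: h2; rewrite ltn_subLR.
split => k kn.
  by have := h k (ltn_addr _ kn); rewrite /= kn.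
have := h (n1 + k)%N; rewrite ltn_add2l => /(_ kn) /=.
by rewrite ltnNge leq_addr/= addKn.
Qed.

Context {disp : measure_display} {Omega : measurableType disp}.
Variable P : probability Omega R.

(** One Dynkin argument for two purposes: equality of laws, with [c = 1] and [E = F = setT], and
    independence of [U] from an event [E], with [c = P E], [V = U] and [F = setT]. *)
Lemma path_law_induction (U V : Omega -> path_space) (E F : set Omega) (c : \bar R) :
  measurable_fun setT U -> measurable_fun setT V -> measurable E -> measurable F ->
  (0 <= c)%E -> c \is a fin_num ->
  (forall n i B, (forall k, measurable (B k)) ->
    P (U @^-1` rectangle n i B `&` E) = (c * P (V @^-1` rectangle n i B `&` F))%E) ->
  forall A, measurable A -> P (U @^-1` A `&` E) = (c * P (V @^-1` A `&` F))%E.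
Proof.
move=> mU mV mE mF c0 cfin hrect.
have mUE A : measurable A -> measurable (U @^-1` A `&` E).
  by move=> mA; apply: measurableI => //; rewrite -[X in measurable X]setTI; exact: mU.
have mVF A : measurable A -> measurable (V @^-1` A `&` F).
  by move=> mA; apply: measurableI => //; rewrite -[X in measurable X]setTI; exact: mV.
have hT : P (U @^-1` setT `&` E) = (c * P (V @^-1` setT `&` F))%E.
  have := hrect 0%N (fun=> point) (fun=> setT) (fun=> measurableT).
  by rewrite (_ : rectangle _ _ _ = setT)//; apply/seteqP; split => // x _ k.
have split_ (W : Omega -> path_space) (G : set Omega) A :
    measurable (W @^-1` A `&` G) -> measurable (W @^-1` (~` A) `&` G) ->
    P (W @^-1` setT `&` G) = (P (W @^-1` A `&` G) + P (W @^-1` (~` A) `&` G))%E.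
  move=> m1 m2; rewrite -measureU//.
    by rewrite -setIUl -preimage_setU setUv.
  by rewrite setIACA -preimage_setI setICr preimage_set0 set0I.
rewrite path_space_rectangles.
apply: (dynkin_induction (P := fun A : set path_space =>
  P (U @^-1` A `&` E) = (c * P (V @^-1` A `&` F))%E)
  path_space_rectangles rectanglesI) => //.
- by move=> _ [n [i [B [mB ->]]]]; exact: hrect.
- move=> A mA ih; have mCA := measurableC mA.
  move: hT; rewrite (split_ U E A) ?(split_ V F A)//; try by [exact: mUE|exact: mVF].
  rewrite muleDr//; last by rewrite ge0_adde_def// inE.
  (* Finiteness of [c] allows the mass of [A] to be subtracted from the total mass. *)
  have fx : (c * P (V @^-1` A `&` F))%E \is a fin_num.
    by rewrite fin_numM// fin_num_measure//; exact: mVF.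
  rewrite ih => h; rewrite -[LHS](addeK _ fx) -[RHS](addeK _ fx).
  by congr (_ - _)%E; rewrite addeC h addeC.
- move=> S mS /trivIsetP tS ih; have tS' i j : i != j -> S i `&` S j = set0 by exact: tS.
  rewrite !preimage_bigcup !setI_bigcupl.
  rewrite !measure_bigcup//=.
  + rewrite -(fineK cfin) -nneseriesZl// fineK//; first by apply: eq_eseriesr => k _; exact: ih.
  + by move=> k _; exact: mVF.
  + apply/trivIsetP => i j _ _ ij.
    by rewrite setIACA -preimage_setI tS'// preimage_set0 set0I.
  + by move=> k _; exact: mUE.
  + apply/trivIsetP => i j _ _ ij.
    by rewrite setIACA -preimage_setI tS'// preimage_set0 set0I.
Qed.

End PathSpace.

Section LimFunctional.
Context d (T : measurableType d) (R : realType).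

(** The upper limit exists everywhere, so the functional is measurable on the whole space, and it is
    the limit wherever there is one. *)
Definition lim_functional (F : nat -> T -> R) (x : T) : R :=
  fine (limn_esup (fun n => (F n x)%:E)).

Lemma measurable_lim_functional (F : nat -> T -> R) :
  (forall n, measurable_fun setT (F n)) -> measurable_fun setT (lim_functional F).
Proof.
move=> mF; apply: (measurableT_comp (@fine_measurable R setT measurableT)).
by apply: measurable_fun_limn_esup => n; exact/measurable_EFinP.
Qed.

Lemma lim_functionalE (F : nat -> T -> R) x (l : R) :
  F n x @[n --> \oo] --> l -> lim_functional F x = l.
Proof.
move=> Fl; rewrite /lim_functional is_cvg_limn_esupE.
  rewrite (_ : limn _ = l%:E)//; apply/cvg_lim => //.
  by apply: cvg_EFin Fl; exact: nearW.
by apply/cvg_ex; exists l%:E; apply: cvg_EFin Fl; exact: nearW.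
Qed.

End LimFunctional.

Section OUFunctional.
Context {R : realType}.
Variables (d b lam : R).
Hypotheses (d_gt0 : 0 < d) (d_lt1 : d < 1) (b_ge0 : 0 <= b) (b_lt : b < 1 - d).
Hypothesis lam_gt0 : 0 < lam.
Local Notation mu := (@lebesgue_measure R).
Local Notation path := (@path_space R R).
Implicit Types (x : R -> R) (t : R).

Definition FLP_path x t : R := (Gamma d)^-1 * kernel_int d x t.

Lemma FLP_good_path disp (Omega : measurableType disp) (L : R -> Omega -> R) w C t :
  good_path b C (L ^~ w) -> FLP d L t w = FLP_path (L ^~ w) t.
Proof.
by move=> gx; rewrite /FLP (improper_Rint_kernel d_gt0 d_lt1 b_ge0 b_lt _ gx).
Qed.

Lemma good_FLP_path x C : good_path b C x ->
  continuous (FLP_path x) /\ exists C', forall t,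
    `|FLP_path x t| <= C' * weight (d + 2 * b) t.
Proof.
move=> gx; split.
  move=> t; apply: cvgM; first exact: cvg_cst.
  exact: (kernel_int_continuous d_gt0 d_lt1 b_ge0 b_lt gx).
exists (`|(Gamma d)^-1| * (C * kernel_mass1 d b)) => t.
rewrite normrM -mulrA ler_wpM2l//.
by have [_] := good_kernel_int d_gt0 d_lt1 b_ge0 b_lt gx.
Qed.

Lemma FLP_path_increments x C t h : good_path b C x ->
  FLP_path x (t + h) - FLP_path x h = FLP_path (fun s => x (s + h) - x h) t.
Proof.
by move=> gx; rewrite -mulrBr (kernel_int_increments d_gt0 d_lt1 b_ge0 b_lt _ _ gx).
Qed.

Lemma integrable_kernel_weight t :
  mu.-integrable setT (EFin \o (fun s => FLP_kernel d t s * weight b s)).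
Proof.
apply/integrableP; split.
  apply/measurable_EFinP; apply: measurable_funM; first exact: measurable_FLP_kernel.
  exact: measurable_weight.
rewrite (_ : integral _ _ _ = kernel_mass d b t).
  apply: le_lt_trans (kernel_mass_le d_gt0 d_lt1 b_ge0 b_lt t) _.
  exact: ltry.
by apply: eq_integral => s _; rewrite /= normrM (ger0_norm (weight_ge0 _ _)).
Qed.

(** A total measurable function on path space; it is claimed to be the kernel integral only on good
    paths. *)
Definition FLP_functional t : path -> R :=
  fun x => (Gamma d)^-1 *
    lim_functional (T := path) (fun n x => grid_functional (FLP_kernel d t) n x) x.

Definition exp_kernel t u : R := expR (lam * u) * \1_(`]-oo, t]%classic) u.

Definition OU_functional t : path -> R := fun x =>
  FLP_functional t x - lam * (expR (- lam * t) *
   lim_functional (T := path) (fun n x => grid_functional (exp_kernel t) n (FLP_functional ^~ x)) x).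

Lemma measurable_grid_functional k n (F : R -> path -> R) :
  (forall t, measurable_fun setT (F t)) ->
  measurable_fun setT (fun x : path => grid_functional k n (F ^~ x)).
Proof.
by move=> mF; apply: measurable_sum => j; exact: measurable_funM.
Qed.

Lemma measurable_FLP_functional t : measurable_fun setT (FLP_functional t).
Proof.
apply: measurable_funM => //; apply: measurable_lim_functional => n.
apply: (@measurable_grid_functional _ _ (fun t (x : path) => x t)) => s.
exact: measurable_coordinate.
Qed.

Lemma measurable_OU_functional t : measurable_fun setT (OU_functional t).
Proof.
apply: measurable_funB; first exact: measurable_FLP_functional.
apply: measurable_funM => //; apply: measurable_funM => //.
apply: measurable_lim_functional => n.
by apply: measurable_grid_functional => s; exact: measurable_FLP_functional.
Qed.

Lemma FLP_functionalE C x t : good_path b C x -> FLP_functional t x = FLP_path x t.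
Proof.
move=> gx; have [rx hx] := gx; congr (_ * _); apply: lim_functionalE.
apply: (grid_functional_cvg b_ge0 rx hx); first exact: measurable_FLP_kernel.
exact: integrable_kernel_weight.
Qed.

Lemma measurable_exp_kernel t : measurable_fun setT (exp_kernel t).
Proof.
apply: measurable_funM; last exact: measurable_indic.
by apply: continuous_measurable_fun; exact: continuous_expR_linear.
Qed.

Lemma continuous_weight q : continuous (@weight R q).
Proof.
move=> u.
apply: (@continuous_comp _ _ _ (fun u : R => 1 + `|u|) (fun u : R => u `^ q)).
  by apply: cvgD; [exact: cvg_cst|exact: norm_continuous].
have p0 : 0 < 1 + `|u| by rewrite ltr_pwDl.
by have [/derivable1_diffP/differentiable_continuous] := is_derive1_powR q p0.
Qed.

Lemma integrable_exp_kernel_weight q t :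
  mu.-integrable setT (EFin \o (fun s => exp_kernel t s * weight q s)).
Proof.
have fi : mu.-integrable `]-oo, t] (EFin \o (fun u => expR (lam * u) * weight q u)).
  apply: (@integrable_expR_good _ lam q lam_gt0 _ 1); first exact: continuous_weight.
  by move=> u; rewrite mul1r ger0_norm ?weight_ge0.
have : mu.-integrable setT
    ((EFin \o (fun u => expR (lam * u) * weight q u)) \_ `]-oo, t]).
  by apply/integrable_restrict => //; rewrite setTI.
apply: eq_integrable => // s _.
rewrite patchE /= /exp_kernel indicE.
by case: ifPn => _; rewrite ?mulr1// mulr0 mul0r.
Qed.

Lemma OU_functionalE C x t : good_path b C x ->
  OU_functional t x = OU_path lam (FLP_path x) t.
Proof.
move=> gx; have [cy [C' hy]] := good_FLP_path gx.
have yE : FLP_functional ^~ x = FLP_path x.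
  by apply/funext => s; exact: FLP_functionalE gx.
rewrite /OU_functional /OU_path (FLP_functionalE _ gx); congr (_ - _ * (_ * _)).
apply: lim_functionalE; rewrite yE.
have q0 : 0 <= d + 2 * b by rewrite addr_ge0 ?mulr_ge0// ltW.
have := grid_functional_cvg q0 (continuous_right_cont cy) hy (measurable_exp_kernel t)
  (integrable_exp_kernel_weight _ t).
rewrite (_ : \int[mu]_s (exp_kernel t s * FLP_path x s) = exp_mean lam (FLP_path x) t)//.
rewrite /exp_mean [RHS]Rintegral_mkcond; apply: eq_Rintegral => s _.
rewrite patchE /exp_kernel indicE.
by case: ifPn => _; rewrite ?mulr1// mulr0 mul0r.
Qed.

End OUFunctional.

(** * Growth of the paths of a Levy process *)

Section IndependentSequences.
Context {R : realType} {disp : measure_display} {Omega : measurableType disp}.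
Variable P : probability Omega R.
Implicit Types D : nat -> Omega -> R.

Definition indep_seq D := forall N (B : nat -> set R), (forall i, measurable (B i)) ->
  P (\bigcap_(i in `I_N) (D i @^-1` B i)) = (\prod_(i < N) P (D i @^-1` B i))%E.

(** Collects all conditions that a rectangle puts on the coordinate [l]: independence provides one
    set per coordinate, while the indices of a rectangle may repeat. *)
Definition fiber n (i : nat -> nat) (B : nat -> set R) l : set R :=
  \bigcap_k (if (k < n)%N && (i k == l) then B k else setT).

Lemma measurable_fiber n i B l : (forall k, measurable (B k)) -> measurable (fiber n i B l).
Proof. by move=> mB; apply: bigcapT_measurable => k; case: ifP. Qed.

Lemma rectangle_preimage D n i B N : (forall k, (k < n)%N -> (i k < N)%N) ->
  (fun w k => D k w) @^-1` rectangle n i B =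
  \bigcap_(l in `I_N) (D l @^-1` fiber n i B l).
Proof.
move=> iN; apply/seteqP; split => [w h l lN k _ /=|w h k kn].
  by case: ifPn => // /andP[kn /eqP <-]; exact: h.
by have := h _ (iN k kn) k Logic.I; rewrite kn eqxx.
Qed.

Lemma indep_seq_law D D' : (forall i, measurable_fun setT (D i)) ->
  (forall i, measurable_fun setT (D' i)) -> indep_seq D -> indep_seq D' ->
  (forall i B, measurable B -> P (D i @^-1` B) = P (D' i @^-1` B)) ->
  forall A : set (@path_space R nat), measurable A ->
    P ((fun w k => D k w) @^-1` A) = P ((fun w k => D' k w) @^-1` A).
Proof.
move=> mD mD' iD iD' DD' A mA.
have := @path_law_induction _ nat _ _ P (fun w k => D k w) (fun w k => D' k w)
  setT setT 1%E.
have /[swap]/[apply] := measurable_into_path_space mD.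
have /[swap]/[apply] := measurable_into_path_space mD'.
move=> /(_ measurableT measurableT lee01 isT) h.
have := h _ A mA; rewrite !setIT mul1e; apply=> n i B mB.
rewrite !setIT mul1e.
have iN k : (k < n)%N -> (i k < (\max_(k < n) i k).+1)%N.
  by move=> kn; rewrite ltnS (leq_bigmax (F := fun k : 'I_n => i k) (Ordinal kn)).
rewrite !(rectangle_preimage _ _ iN) iD ?iD'; try by move=> l; exact: measurable_fiber.
by apply: eq_bigr => l _; apply: DD'; exact: measurable_fiber.
Qed.

(* The indices are truncated at j: the vector of the first j + 1 terms. *)
Lemma indep_seq_prefix D j (A : set (@path_space R nat)) B :
  (forall i, measurable_fun setT (D i)) -> indep_seq D ->
  measurable A -> measurable B ->
  P ((fun w k => D (minn k j) w) @^-1` A `&` D j.+1 @^-1` B) =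
  (P (D j.+1 @^-1` B) * P ((fun w k => D (minn k j) w) @^-1` A))%E.
Proof.
move=> mD iD mA mB.
have mDB : measurable (D j.+1 @^-1` B) by rewrite -[X in measurable X]setTI; exact: mD.
have mU : measurable_fun setT ((fun w k => D (minn k j) w) : Omega -> @path_space R nat).
  by apply: measurable_into_path_space => k; exact: mD.
rewrite -[in RHS](setIT (_ @^-1` A)).
apply: path_law_induction mA => //; first by rewrite fin_num_measure.
move=> n i C mC; rewrite setIT.
pose i' k := minn (i k) j.
have i'j k : (k < n)%N -> (i' k < j.+1)%N by rewrite ltnS geq_minr.
rewrite (_ : _ @^-1` rectangle n i C =
    (fun w k => D k w) @^-1` rectangle n i' C)//.
rewrite (rectangle_preimage _ _ i'j) iD; last by move=> l; exact: measurable_fiber.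
pose F l := if (l == j.+1)%N then B else fiber n i' C l.
rewrite (_ : _ `&` _ = \bigcap_(l in `I_j.+2) (D l @^-1` F l)).
  rewrite iD; last by move=> l; rewrite /F; case: ifP => // _; exact: measurable_fiber.
  rewrite big_ord_recr/= muleC (_ : F j.+1 = B) ?/F ?eqxx//; congr (_ * _)%E.
  by apply: eq_bigr => l _; rewrite /F ltn_eqF.
apply/seteqP; split => [w [h1 h2] l /= lj|w h].
  rewrite /F; case: eqP => [->//|/eqP lj']; apply: h1 => /=.
  by rewrite ltn_neqAle lj'.
split; last by have := h j.+1 (ltnSn _); rewrite /F/= eqxx.
by move=> l /= lj; have := h l (leqW lj); rewrite /F/= ltn_eqF.
Qed.

End IndependentSequences.

Section IndependentPairs.
Context {R : realType} {disp : measure_display} {Omega : measurableType disp}.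
Variable P : probability Omega R.
Implicit Types Y Z : Omega -> R.

Lemma integral_prob_cst (c : \bar R) : (\int[P]_w c = c)%E.
Proof.
transitivity (c * P setT)%E; first exact: (integral_cst P measurableT c).
by rewrite probability_setT mule1.
Qed.

Definition indep_pair Y Z := forall A B : set R, measurable A -> measurable B ->
  P (Y @^-1` A `&` Z @^-1` B) = (P (Y @^-1` A) * P (Z @^-1` B))%E.

(** Independence identifies the joint law with the product of the two laws, to which Tonelli's
    theorem applies. *)
Lemma indep_pair_integral Y Z (h : R * R -> \bar R) :
  measurable_fun setT Y -> measurable_fun setT Z -> indep_pair Y Z ->
  measurable_fun setT h -> (forall z, 0 <= h z)%E ->
  (\int[P]_w h (Y w, Z w) = \int[P]_w \int[P]_v h (Y w, Z v))%E.
Proof.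
move=> mY mZ iYZ mh h0.
have mYZ : measurable_fun setT (fun w => (Y w, Z w)) by exact: measurable_fun_pair.
pose Y' : {mfun Omega >-> R} := HB.pack Y (isMeasurableFun.Build _ _ _ _ Y mY).
pose Z' : {mfun Omega >-> R} := HB.pack Z (isMeasurableFun.Build _ _ _ _ Z mZ).
pose W : {mfun Omega >-> (R * R)%type} := HB.pack (fun w => (Y w, Z w))
  (isMeasurableFun.Build _ _ _ _ (fun w => (Y w, Z w)) mYZ).
have mhy y : measurable_fun setT (fun z => h (y, z)) by apply: measurableT_comp mh _.
transitivity (\int[distribution P W]_z h z)%E.
  by rewrite ge0_integral_distribution.
transitivity (\int[distribution P Y' \x distribution P Z']_z h z)%E.
  apply: eq_measure_integral => A mA _; apply/esym.
  by apply: product_measure_unique => // B C mB mC; exact: iYZ.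
rewrite fubini_tonelli1// ge0_integral_distribution//; last 2 first.
- exact: measurable_fun_fubini_tonelli_F.
- by move=> y; apply: integral_ge0 => z _; exact: h0.
apply: eq_integral => w _; rewrite /= /fubini_F ge0_integral_distribution//.
Qed.

Lemma measurable_sqr_sum : measurable_fun setT (fun z : R * R => ((z.1 + z.2) ^+ 2)%:E).
Proof.
apply/measurable_EFinP; apply: measurable_funX.
by apply: measurable_funD; [exact: measurable_fst|exact: measurable_snd].
Qed.

(** By Tonelli some value y of [Y] makes (y + Z)^2 integrable, for otherwise the double integral
    would be infinite; then Z^2 <= 2 (y + Z)^2 + 2 y^2. *)
Lemma indep_pair_sqr_integrable Y Z :
  measurable_fun setT Y -> measurable_fun setT Z -> indep_pair Y Z ->
  (\int[P]_w ((Y w + Z w) ^+ 2)%:E < +oo)%E -> (\int[P]_w (Z w ^+ 2)%:E < +oo)%E.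
Proof.
move=> mY mZ iYZ; have := indep_pair_integral mY mZ iYZ measurable_sqr_sum.
move=> /(_ (fun z => _))/=.
move=> ->; last by move=> z; rewrite lee_fin sqr_ge0.
have [[w hw] _|h] := pselect (exists w, (\int[P]_v ((Y w + Z v) ^+ 2)%:E < +oo)%E).
  have le1 : (\int[P]_v (Z v ^+ 2)%:E <=
      \int[P]_v (2%:E * ((Y w + Z v) ^+ 2)%:E + (2 * Y w ^+ 2)%:E))%E.
    apply: ge0_le_integral => //=.
    - by move=> v _; rewrite lee_fin sqr_ge0.
    - by apply/measurable_EFinP; exact: measurable_funX.
    - apply/measurable_EFinP; apply: measurable_funD => //.
      apply: measurable_funM => //; apply: measurable_funX.
      exact: measurable_funD.
    - move=> v _; rewrite lee_fin -subr_ge0.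
      rewrite (_ : _ - _ = (2 * Y w + Z v) ^+ 2); first exact: sqr_ge0.
      by ring.
  apply: le_lt_trans le1 _.
  have mS : measurable_fun setT (fun v => ((Y w + Z v) ^+ 2)%:E).
    by apply/measurable_EFinP; apply: measurable_funX; exact: measurable_funD.
  rewrite ge0_integralD//; last 2 first.
  - by apply: measurable_funeM.
  - by move=> v _; rewrite lee_fin mulr_ge0// sqr_ge0.
    rewrite ge0_integralZl//; last by move=> v _; rewrite lee_fin sqr_ge0.
    rewrite integral_prob_cst lte_add_pinfty ?ltry//.
    by rewrite lte_mul_pinfty.
  by move=> v _; rewrite mule_ge0// lee_fin sqr_ge0.
rewrite (eq_integral (cst +oo%E)).
  by rewrite integral_prob_cst ltxx.
move=> w _; apply/eqP; rewrite eq_le leey/= leNgt.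
by apply/negP => hw; apply: h; exists w.
Qed.

(** Integrating over [Z] first, the cross term vanishes for each fixed value of [Y]. The identity is
    one of extended reals and covers an infinite second moment of [Y]. *)
Lemma indep_pair_sqr Y Z :
  measurable_fun setT Y -> measurable_fun setT Z -> indep_pair Y Z ->
  (\int[P]_w (Z w ^+ 2)%:E < +oo)%E -> ('E_P[Z] = 0)%E ->
  (\int[P]_w ((Y w + Z w) ^+ 2)%:E =
   \int[P]_w (Y w ^+ 2)%:E + \int[P]_w (Z w ^+ 2)%:E)%E.
Proof.
move=> mY mZ iYZ Z2 Z0; have := indep_pair_integral mY mZ iYZ measurable_sqr_sum.
move=> /(_ (fun z => _))/=.
move=> ->; last by move=> z; rewrite lee_fin sqr_ge0.
have mZ2 : measurable_fun setT (fun v => (Z v ^+ 2)%:E).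
  by apply/measurable_EFinP; exact: measurable_funX.
have mY2 : measurable_fun setT (fun v => (Y v ^+ 2)%:E).
  by apply/measurable_EFinP; exact: measurable_funX.
have iZ2 : P.-integrable setT (fun v => (Z v ^+ 2)%:E).
  apply/integrableP; split => //.
  by under eq_integral do rewrite /= ger0_norm ?sqr_ge0//.
have iZ : P.-integrable setT (EFin \o Z).
  apply/integrableP; split; first exact/measurable_EFinP.
  apply: (@le_lt_trans _ _ (\int[P]_w (1 + (Z w ^+ 2)%:E))%E).
    apply: ge0_le_integral => //=.
    - by apply/measurable_EFinP; exact: measurableT_comp.
    - by apply: emeasurable_funD.
    - move=> w _; rewrite lee_fin.
      by rewrite -real_normK ?num_real//; have := sqr_ge0 (`|Z w| - 1); nra.
  rewrite ge0_integralD//; last by move=> w _; rewrite lee_fin sqr_ge0.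
  by rewrite integral_prob_cst lte_add_pinfty// ltry.
rewrite (eq_integral (fun w => (Y w ^+ 2)%:E + \int[P]_w (Z w ^+ 2)%:E))%E.
  rewrite ge0_integralD//.
  - by rewrite integral_prob_cst.
  - by move=> w _; rewrite lee_fin sqr_ge0.
  - by move=> w _; apply: integral_ge0 => v _; rewrite lee_fin sqr_ge0.
move=> w _.
rewrite (eq_integral (fun v => (Y w ^+ 2)%:E + ((2 * Y w)%:E * (Z v)%:E + (Z v ^+ 2)%:E)))%E; last first.
  by move=> v _; rewrite -EFinM -!EFinD; congr EFin; ring.
have ic c : P.-integrable setT (fun=> c%:E).
  exact: finite_measure_integrable_cst.
have icZ : P.-integrable setT (fun v => (2 * Y w)%:E * (Z v)%:E)%E.
  exact: (integrableZl measurableT (2 * Y w) iZ).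
rewrite integralD//; last by apply: integrableD.
rewrite integralD// integral_prob_cst; congr (_ + _)%E.
rewrite (integralZl measurableT iZ).
by move: Z0; rewrite unlock /= => ->; rewrite mule0 add0e.
Qed.

End IndependentPairs.

Section Ottaviani.
Context {R : realType} {disp : measure_display} {Omega : measurableType disp}.
Variable P : probability Omega R.
Variable X : R -> Omega -> R.
Hypothesis mX : forall t : R, 0 <= t -> measurable_fun setT (X t).
Hypothesis iX : indep_increments P X.
Implicit Types t : nat -> R.

Lemma increasing_ge0 t : 0 <= t 0%N -> (forall i, t i < t i.+1) -> forall i, 0 <= t i.
Proof. by move=> t0 ti; elim=> // i /le_trans; apply; exact: ltW. Qed.

Lemma measurable_increment (s t : R) : 0 <= s -> 0 <= t -> measurable_fun setT (fun w => X t w - X s w).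
Proof. by move=> s0 t0; apply: measurable_funB; exact: mX. Qed.

Lemma increments_indep_seq t : 0 <= t 0%N -> (forall i, t i < t i.+1) ->
  indep_seq P (fun i w => X (t i.+1) w - X (t i) w).
Proof. by move=> t0 ti N B mB; exact: iX. Qed.

Lemma measurable_preim (U : Omega -> R) (B : set R) :
  measurable_fun setT U -> measurable B -> measurable (U @^-1` B).
Proof. by move=> mU mB; rewrite -[X in measurable X]setTI; exact: mU. Qed.

Lemma measurable_norm_gt (a : R) : measurable [set x : R | a < `|x|].
Proof.
have -> : [set x : R | a < `|x|] = (fun x : R => `|x|) @^-1` `]a, +oo[.
  by apply/seteqP; split => x /=; rewrite in_itv/= andbT.
rewrite -[X in measurable X]setTI.
by have := @normr_measurable R setT; apply => //; exact: measurable_itv.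
Qed.

Lemma measurable_norm_increment_gt (a s t : R) : 0 <= s -> 0 <= t ->
  measurable [set w | a < `|X t w - X s w|].
Proof.
move=> s0 t0; exact: (measurable_preim (measurable_increment s0 t0) (measurable_norm_gt a)).
Qed.

(** Decompose by the first index [j] at which 2 a is exceeded, which is the event [seqDU F j]. It is
    independent of the remaining increment, which is at most [a] in absolute value with probability
    at least 1/2; when both happen, the total increment exceeds [a]. *)
Lemma ottaviani t N (a : R) : 0 <= a -> 0 <= t 0%N -> (forall i, t i < t i.+1) ->
  (forall j, (j <= N)%N -> (P [set w | (a < `|X (t N) w - X (t j) w|)%R] <= (2^-1)%:E)%E) ->
  (P (\bigcup_(j in `I_N.+1) [set w | (2 * a < `|X (t j) w - X (t 0%N) w|)%R]) <=
   2%:E * P [set w | (a < `|X (t N) w - X (t 0%N) w|)%R])%E.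
Proof.
move=> a0 t0 ti hN; have tge0 := increasing_ge0 t0 ti.
pose F j := [set w | 2 * a < `|X (t j) w - X (t 0%N) w|].
pose E := [set w | a < `|X (t N) w - X (t 0%N) w|].
have mF j : measurable (F j) by exact: measurable_norm_increment_gt.
have mE : measurable E by exact: measurable_norm_increment_gt.
have mG j : measurable (seqDU F j).
  by apply: measurableD => //; exact: bigsetU_measurable.
have key j : (j <= N)%N -> (P (seqDU F j) <= 2%:E * P (seqDU F j `&` E))%E.
  move=> jN.
  have mZ : measurable [set w | a < `|X (t N) w - X (t j) w|].
    exact: measurable_norm_increment_gt.
  apply: (@le_trans _ _ (2%:E * P (seqDU F j `&`
      ~` [set w | (a < `|X (t N) w - X (t j) w|)%R]))%E); last first.
    rewrite lee_pmul2l// le_measure ?inE//.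
    - by apply: measurableI => //; exact: measurableC.
    - exact: measurableI.
    move=> w [Gw /negP/=]; rewrite -leNgt => Zw; split => //=.
    have /= := subset_seqDU Gw; rewrite /F/E/= => Fw.
    have := ler_normD (X (t N) w - X (t 0%N) w) (- (X (t N) w - X (t j) w)).
    rewrite normrN (_ : _ - _ + _ = X (t j) w - X (t 0%N) w); last by ring.
    by move=> h; lra.
  move: jN mZ; rewrite leq_eqVlt => /predU1P[-> mZ|jN mZ].
    rewrite (_ : ~` _ = setT) ?setIT; last first.
      apply/seteqP; split => // w _ /=; rewrite subrr normr0.
      by apply/negP; rewrite -leNgt.
    by rewrite -[leLHS]mul1e lee_wpmul2r// lee_fin ler1n.
  case: j jN mZ => [|j] jN mZ.
    rewrite (_ : seqDU F 0 = set0) ?measure0 ?mule_ge0//.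
    rewrite -subset0 => w Gw; have := subset_seqDU Gw.
    by rewrite /F/= subrr normr0 ltNge mulr_ge0.
  (* The times up to [j.+1] are kept and the next one is [t N], so the whole remaining increment is
     the single term [D j.+1]; the later times only continue the sequence increasingly. *)
  pose t' l := if (l <= j.+1)%N then t l else t N + (l - j.+2)%:R.
  have t'0 : 0 <= t' 0%N by [].
  have t'i l : t' l < t' l.+1.
    rewrite /t'; have [lj|lj|->] := ltngtP l j.+1.
    - by rewrite ti.
    - by rewrite ltrD2l ltr_nat; lia.
    - rewrite subnn addr0; apply: (homo_ltn lt_trans) => //.
  pose D l w := X (t' l.+1) w - X (t' l) w.
  have mD l : measurable_fun setT (D l).
    by apply: measurable_increment; apply: increasing_ge0.
  have iD : indep_seq P D by exact: increments_indep_seq.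
  (* The events [F k] read on the sequence of increments; for [k <= j.+1] only the first [j.+1]
     increments enter, so truncating the index at [j] changes nothing. *)
  pose F' k : set (@path_space R nat) :=
    [set x | 2 * a < `|\sum_(0 <= l < k) x l|].
  have mF' k : measurable (F' k).
    have : measurable_fun setT (fun x : @path_space R nat => \sum_(0 <= l < k) x l).
      by apply: measurable_sum => l; exact: measurable_coordinate.
    move=> /(_ measurableT _ (measurable_norm_gt (2 * a))).
    by rewrite setTI.
  have FF' k : (k <= j.+1)%N -> (fun w l => D (minn l j) w) @^-1` F' k = F k.
    move=> kj; apply/funext => w; rewrite /F/F'/=.
    rewrite (@telescope_sumr_eq _ _ _ (fun l => X (t l) w))// => l /andP[_ lk].
    rewrite (minn_idPl _); last by lia.
    by rewrite /D /t' !ifT//; lia.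
  have GE : seqDU F j.+1 = (fun w l => D (minn l j) w) @^-1` seqDU F' j.+1.
    rewrite /seqDU !setDE preimage_setI preimage_setC FF'//; congr (_ `&` ~` _).
    change (\big[setU/set0]_(k < j.+1) F k =
      (fun w l => D (minn l j) w) @^-1` \big[setU/set0]_(k < j.+1) F' k).
    rewrite -!bigcup_mkord preimage_bigcup; apply: eq_bigcupr => k /= kj.
    by rewrite FF'// ltnW.
  have := @indep_seq_prefix _ _ _ P D j (seqDU F' j.+1) (~` [set x | a < `|x|]) mD iD.
  have mA : measurable (seqDU F' j.+1).
    by apply: measurableD => //; exact: bigsetU_measurable.
  move=> /(_ mA (measurableC (measurable_norm_gt a))).
  rewrite -GE (_ : D j.+1 = (fun w => X (t N) w - X (t j.+1) w)); last first.
    by rewrite /D /t' ltnn leqnn subnn addr0.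
  move=> ->.
  rewrite muleA -[leLHS]mul1e lee_wpmul2r//.
  rewrite preimage_setC probability_setC; last exact: mZ.
  have := hN _ (ltnW jN).
  rewrite -(fineK (fin_num_measure P _ mZ)) lee_fin.
  rewrite -EFinB -EFinM lee_fin; lra.
rewrite (_ : \bigcup_(j in `I_N.+1) _ = \big[setU/set0]_(j < N.+1) seqDU F j); last first.
  by rewrite -bigsetU_seqDU bigcup_mkord.
have tG : trivIset setT (fun j : 'I_N.+1 => seqDU F j).
  move=> i j _ _ ij; apply: val_inj; exact: (trivIset_seqDU F).
rewrite measure_bigsetU_ord//.
apply: (@le_trans _ _ (\sum_(j < N.+1) (2%:E * P (seqDU F j `&` E)))%E).
  by apply: lee_sum => j _; apply: key; rewrite -ltnS.
rewrite -ge0_sume_distrr//.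
rewrite lee_pmul2l// -measure_bigsetU_ord//; last 2 first.
- by move=> j; exact: measurableI.
- move=> i j _ _ [w [[wi _] [wj _]]]; apply: tG => //; by exists w.
rewrite le_measure ?inE//.
- by apply: bigsetU_measurable => j _; exact: measurableI.
- by move=> w; rewrite -bigcup_mkord_ord => -[? _ []].
Qed.

End Ottaviani.

Section LawIntegral.
Context {R : realType} {disp : measure_display} {Omega : measurableType disp}.
Variable P : probability Omega R.

Lemma eq_in_law_integral (U V : Omega -> R) (f : R -> \bar R) :
  measurable_fun setT U -> measurable_fun setT V -> eq_in_law P U V ->
  measurable_fun setT f -> (\int[P]_w f (U w) = \int[P]_w f (V w))%E.
Proof.
move=> mU mV UV mf.
pose U' : {mfun Omega >-> R} := HB.pack U (isMeasurableFun.Build _ _ _ _ U mU).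
pose V' : {mfun Omega >-> R} := HB.pack V (isMeasurableFun.Build _ _ _ _ V mV).
have ge0 (g : R -> \bar R) : measurable_fun setT g -> (forall x, 0 <= g x)%E ->
    (\int[P]_w g (U w) = \int[P]_w g (V w))%E.
  move=> mg g0; rewrite -[LHS](ge0_integral_distribution U')//.
  rewrite -[RHS](ge0_integral_distribution V')//.
  by apply: eq_measure_integral => A mA _; exact: UV.
rewrite [LHS]integralE [RHS]integralE; congr (_ - _)%E.
- have := ge0 _ (measurable_funepos mf) (funepos_ge0 f).
  have E (W : Omega -> R) : (fun w => f (W w))^\+%E = (fun w => f^\+%E (W w)).
    by apply/funext => w; rewrite !funeposE.
  by rewrite !E.
- have := ge0 _ (measurable_funeneg mf) (funeneg_ge0 f).
  have E (W : Omega -> R) : (fun w => f (W w))^\-%E = (fun w => f^\-%E (W w)).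
    by apply/funext => w; rewrite !funenegE.
  by rewrite !E.
Qed.

Lemma chebyshev_sqr (Z : Omega -> R) (a : R) : measurable_fun setT Z -> 0 < a ->
  (P [set w | (a < `|Z w|)%R] <= (a ^- 2)%:E * \int[P]_w (Z w ^+ 2)%:E)%E.
Proof.
move=> mZ a0.
have mE := measurable_preim mZ (measurable_norm_gt a).
rewrite -(@lee_pmul2l _ (a ^+ 2)%:E)// ?lte_fin ?exprn_gt0//.
rewrite muleA -EFinM divff ?expf_neq0 ?gt_eqF// mul1e.
rewrite -(setIT [set w | _]) -integral_indic// -ge0_integralZl//; last 2 first.
- by apply/measurable_EFinP; exact: measurable_indic.
- by rewrite lee_fin sqr_ge0.
apply: ge0_le_integral => //=.
- by move=> w _; rewrite -EFinM lee_fin mulr_ge0// sqr_ge0.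
- apply/measurable_EFinP; apply: measurable_funM => //; exact: measurable_indic.
- by apply/measurable_EFinP; exact: measurable_funX.
move=> w _; rewrite -EFinM lee_fin indicE.
have [/set_mem/= aZ|_] := boolP (w \in _); last by rewrite mulr0 sqr_ge0.
by rewrite mulr1 -(real_normK (num_real (Z w))) ler_pXn2r ?nnegrE// ltW.
Qed.

End LawIntegral.

Section Moments.
Context {R : realType} {disp : measure_display} {Omega : measurableType disp}.
Variable P : probability Omega R.
Variable X : R -> Omega -> R.
Hypothesis mX : forall t : R, 0 <= t -> measurable_fun setT (X t).
Hypothesis iX : indep_increments P X.
Hypothesis sX : stationary_increments P X.
Hypothesis X_0 : {ae P, forall w, X 0 w = 0}.
Hypothesis EX : forall t : R, 0 <= t -> ('E_P[X t] = 0)%E.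
Hypothesis EX2 : ('E_P[fun w => (X 1 w ^+ 2)%R] < +oo)%E.
Implicit Types h s t : R.

Definition increment_var h : \bar R := (\int[P]_w ((X h w - X 0 w) ^+ 2)%:E)%E.
Local Notation V := increment_var.

Lemma increment_var_ge0 h : (0 <= V h)%E.
Proof. by apply: integral_ge0 => w _; rewrite lee_fin sqr_ge0. Qed.

Lemma increment_varE s h : 0 <= s -> 0 <= h ->
  (\int[P]_w ((X (s + h) w - X s w) ^+ 2)%:E = V h)%E.
Proof.
move=> s0 h0; apply: (eq_in_law_integral (f := fun x : R => (x ^+ 2)%:E)).
- by apply: measurable_increment => //; exact: addr_ge0.
- exact: measurable_increment.
- exact: sX.
- by apply/measurable_EFinP; exact: measurable_funX.
Qed.

Lemma increment_mean s h : 0 <= s -> 0 <= h ->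
  ('E_P[fun w => (X (s + h) w - X s w)%R] = 0)%E.
Proof.
move=> s0 h0; rewrite unlock.
rewrite (eq_in_law_integral (f := EFin) _ _ (sX s0 h0)); last 3 first.
- by apply: measurable_increment => //; exact: addr_ge0.
- exact: measurable_increment.
- by apply/measurable_EFinP; exact: measurable_id.
have := EX h0; rewrite unlock => <-; apply: ae_eq_integral => //.
- by apply/measurable_EFinP; exact: measurable_increment.
- by apply/measurable_EFinP; exact: mX.
- by apply: filterS X_0 => w + _; rewrite /= => ->; rewrite subr0.
Qed.

Lemma increments_indep_pair r s t : 0 <= r -> r < s -> s < t ->
  indep_pair P (fun w => X s w - X r w) (fun w => X t w - X s w).
Proof.
move=> r0 rs st A B mA mB.
(* Independence of increments is stated for an infinite increasing sequence of times; those after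
   [t] are arbitrary. *)
pose T i : R := if i is i'.+1 then (if i' is i''.+1 then t + i''%:R else s) else r.
pose C i := if i == 0%N then A else B.
have := @iX 2 T C r0.
have Ti i : T i < T i.+1.
  by case: i => [|[|i]]//=; rewrite ?addr0// ltrD2l ltr_nat.
have mC i : measurable (C i) by rewrite /C; case: ifP.
move=> /(_ Ti mC); rewrite !big_ord_recl big_ord0 mule1/= !addr0 => <-.
congr (P _); apply/seteqP; split=> [w [hA hB] i /=|w h].
  by case: i => [|[|]]//= _; rewrite addr0.
have := h 0%N isT; have := h 1%N isT.
by rewrite /C/= addr0.
Qed.

Lemma increment_var0 : V 0 = 0%E.
Proof.
rewrite /V; under eq_integral do rewrite subrr expr0n/=.
by rewrite integral0.
Qed.

Lemma increment_var1_fin : (V 1 < +oo)%E.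
Proof.
move: EX2; rewrite unlock; apply: le_lt_trans; rewrite le_eqVlt; apply/orP; left.
apply/eqP; apply: ae_eq_integral => //.
- by apply/measurable_EFinP; apply: measurable_funX; exact: measurable_increment.
- by apply/measurable_EFinP; apply: measurable_funX; exact: mX.
- by apply: filterS X_0 => w + _; rewrite /= => ->; rewrite subr0.
Qed.

Lemma increment_varD s h : 0 < s -> 0 < h -> (V h < +oo)%E ->
  (V (s + h) = V s + V h)%E.
Proof.
move=> s0 h0 Vh.
have sh : s < s + h by rewrite ltrDl.
rewrite -(increment_varE (ltW s0) (ltW h0)) -indep_pair_sqr.
- by apply: eq_integral => w _; congr (EFin (_ ^+ 2)); ring.
- by apply: measurable_increment => //; exact: ltW.
- by apply: measurable_increment; rewrite ?addr_ge0// ltW.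
- exact: increments_indep_pair.
- by rewrite increment_varE ?ltW.
- by apply: increment_mean; exact: ltW.
Qed.

(** A second moment is assumed at time 1 only. The increment over [[0, 1]] is the sum of two
    independent ones, of lengths [1 - h] and [h]; this gives first finiteness of [V h], then the
    bound by additivity. *)
Lemma increment_var_le1 h : 0 <= h -> h <= 1 -> (V h <= V 1)%E.
Proof.
rewrite le_eqVlt => /predU1P[<- _|h0].
  by rewrite increment_var0 increment_var_ge0.
rewrite le_eqVlt => /predU1P[->//|h1].
have s0 : 0 < 1 - h by rewrite subr_gt0.
have E1 : 1 = (1 - h) + h by rewrite subrK.
have Vh : (V h < +oo)%E.
  rewrite -(increment_varE (ltW s0) (ltW h0)).
  apply: (indep_pair_sqr_integrable (Y := fun w => X (1 - h) w - X 0 w)).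
  - by apply: measurable_increment => //; exact: ltW.
  - by apply: measurable_increment; rewrite -?E1// ltW.
  - by apply: increments_indep_pair => //; rewrite ltrDl.
  - rewrite -E1; apply: le_lt_trans increment_var1_fin.
    by apply: ge0_le_integral => // [w _|||w _];
      rewrite ?lee_fin ?sqr_ge0//; [apply/measurable_EFinP; apply: measurable_funX;
      apply: measurable_funD; apply: measurable_increment => //; exact: ltW|
      apply/measurable_EFinP; apply: measurable_funX; exact: measurable_increment|
      rewrite (_ : _ + _ = X 1 w - X 0 w)//; ring].
by rewrite [in leRHS]E1 increment_varD// leeDr// increment_var_ge0.
Qed.

Lemma increment_var_linear : exists2 c : R, 0 <= c &
  forall h, 0 <= h -> (V h <= (c * (1 + h))%:E)%E.
Proof.
have V1fin : V 1 \is a fin_num by rewrite ge0_fin_numE ?increment_var_ge0// increment_var1_fin.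
exists (fine (V 1)); first by rewrite fine_ge0// increment_var_ge0.
have main n h : 0 <= h -> h <= n.+1%:R -> (V h <= (fine (V 1) * n.+1%:R)%:E)%E.
  elim: n h => [|n ih] h h0 hn.
    by rewrite mulr1 fineK// increment_var_le1.
  have [h1|h1] := leP h 1.
    apply: le_trans (increment_var_le1 h0 h1) _.
    rewrite -{1}(fineK V1fin) lee_fin ler_peMr ?fine_ge0 ?increment_var_ge0//.
    by rewrite ler1n.
  rewrite (_ : h = (h - 1) + 1); last by rewrite subrK.
  rewrite increment_varD ?subr_gt0// ?increment_var1_fin//.
  rewrite [n.+2%:R]mulrSr mulrDr mulr1 EFinD fineK// leeD2r// ih//.
    by rewrite subr_ge0 ltW.
  by rewrite lerBlDr -mulrSr.
move=> h h0; have /andP[h1 h2] := truncn_itv h0.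
apply: le_trans (main (Num.trunc h) h h0 (ltW h2)) _.
by rewrite lee_fin ler_wpM2l ?fine_ge0 ?increment_var_ge0// mulrSr addrC lerD2l.
Qed.

Lemma increment_tail : exists2 c : R, 0 <= c & forall s t a, 0 <= s -> s <= t -> 0 < a ->
  (P [set w | (a < `|X t w - X s w|)%R] <= (a ^- 2 * (c * (1 + (t - s))))%:E)%E.
Proof.
have [c c0 hc] := increment_var_linear; exists c => // s t a s0 st a0.
have ts : 0 <= t - s by rewrite subr_ge0.
have mZ : measurable_fun setT (fun w => X t w - X s w).
  by apply: measurable_increment => //; exact: le_trans st.
apply: le_trans (chebyshev_sqr P mZ a0) _.
rewrite EFinM lee_pmul2l// ?lte_fin ?invr_gt0 ?exprn_gt0//.
by have := hc _ ts; rewrite -(increment_varE s0 ts) subrKC.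
Qed.

End Moments.

Section Growth.
Context {R : realType} {disp : measure_display} {Omega : measurableType disp}.
Variable P : probability Omega R.
Variable X : R -> Omega -> R.
Hypothesis mX : forall t : R, 0 <= t -> measurable_fun setT (X t).
Hypothesis iX : indep_increments P X.
Implicit Types h s t T a : R.

Definition dyadic_exceed (T a : R) n : set Omega :=
  \bigcup_(j in `I_(2 ^ n).+1)
    [set w | (2 * a < `|X (T * (j%:R / 2 ^+ n)) w - X 0 w|)%R].

Definition exceed T a : set Omega := \bigcup_n dyadic_exceed T a n.

Lemma dyadic_ge0 (T : R) n j : 0 <= T -> 0 <= T * (j%:R / 2 ^+ n).
Proof. by move=> T0; rewrite mulr_ge0// divr_ge0// exprn_ge0. Qed.

Lemma measurable_dyadic_exceed T a n : 0 <= T -> measurable (dyadic_exceed T a n).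
Proof.
move=> T0; apply: bigcup_measurable => j _.
by apply: measurable_norm_increment_gt => //; exact: dyadic_ge0.
Qed.

Lemma measurable_exceed T a : 0 <= T -> measurable (exceed T a).
Proof. by move=> T0; apply: bigcupT_measurable => n; exact: measurable_dyadic_exceed. Qed.

(** The bound of Ottaviani's inequality does not depend on the number of grid points. The dyadic
    grids are nested, since j / 2^n = 2 j / 2^(n + 1), so continuity of P from below passes to their
    union. *)
Lemma maximal_inequality T a : 0 < T -> 0 <= a ->
  (forall s, 0 <= s -> s <= T -> (P [set w | (a < `|X T w - X s w|)%R] <= (2^-1)%:E)%E) ->
  (P (exceed T a) <= 2%:E * P [set w | (a < `|X T w - X 0 w|)%R])%E.
Proof.
move=> T0 a0 hT.
have := @nondecreasing_cvg_mu _ _ _ P (dyadic_exceed T a).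
have mD n : measurable (dyadic_exceed T a n) by apply: measurable_dyadic_exceed; exact: ltW.
move=> /(_ mD (measurable_exceed a (ltW T0))) cvgU.
have {}cvgU := cvgU _.
have nd : nondecreasing_seq (dyadic_exceed T a).
  apply/nondecreasing_seqP => n; apply/subsetPset => w [j /= jn hj].
  exists (2 * j)%N; first by rewrite /= expnS; lia.
  rewrite /= (_ : (2 * j)%:R / 2 ^+ n.+1 = j%:R / 2 ^+ n :> R)//.
  rewrite exprS natrM -mulf_div divff ?mul1r//.
move: (cvgU nd) => {}cvgU; rewrite -[leLHS](cvg_lim _ cvgU)//.
apply: lime_le; first by apply/cvg_ex; eexists; exact: cvgU.
near=> n.
pose t (j : nat) := T * (j%:R / 2 ^+ n) : R.
have p0 : 0 < 2 ^+ n :> R by rewrite exprn_gt0.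
have ti i : t i < t i.+1.
  by rewrite /t ltr_pM2l// ltr_pM2r ?invr_gt0// ltr_nat.
have t0 : t 0%N = 0 by rewrite /t mul0r mulr0.
have tN : t (2 ^ n)%N = T by rewrite /t natrX divff ?mulr1// gt_eqF.
have := @ottaviani _ _ _ P X mX iX t (2 ^ n)%N a a0; rewrite tN t0.
move=> /(_ (lexx _) ti) h; apply: h => j jn.
apply: hT; first by apply: dyadic_ge0; exact: ltW.
rewrite -[leRHS]tN ler_pM2l// ler_pM2r ?invr_gt0// ler_nat//.
Unshelve. all: by end_near. Qed.

(** By right-continuity, exceeding 2 a at [s < T] persists on an interval to the right of [s]. A
    dyadic grid with step [q] shorter than that interval and than [T - s] has a point in it, the
    first one strictly after [s]. *)
Lemma exceedP T a w : 0 < T ->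
  (forall t, 0 <= t -> X s w @[s --> t^'+] --> X t w) -> ~ exceed T a w ->
  forall s, 0 <= s -> s <= T -> `|X s w - X 0 w| <= 2 * a.
Proof.
move=> T0 rX nE s s0; rewrite le_eqVlt => /predU1P[->|sT].
  rewrite leNgt; apply/negP => h; apply: nE; exists 0%N => //.
  by exists 1%N; rewrite //= expr0 divr1 mulr1.
rewrite leNgt; apply/negP => h; apply: nE.
have : \forall r \near s^'+, 2 * a < `|X r w - X 0 w|.
  have : `|X r w - X 0 w| @[r --> s^'+] --> `|X s w - X 0 w|.
    by apply: cvg_norm; apply: cvgB; [exact: rX|exact: cvg_cst].
  by move/cvgr_gt; exact.
move=> hr; have : exists2 e, 0 < e & forall r, s < r -> r < s + e -> 2 * a < `|X r w - X 0 w|.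
  case: hr => e /= e0 he; exists e => // r sr re; apply: he => //=.
  by rewrite ltr0_norm ?subr_lt0//; lra.
case=> e e0 he.
pose m := Num.min e (T - s).
have m0 : 0 < m by rewrite lt_min e0 subr_gt0.
pose n := (Num.trunc (T / m)).+1.
have Tm0 : 0 <= T / m by rewrite divr_ge0 ?ltW.
have Tn : T / m < 2 ^+ n.
  have /andP[_ h2] := truncn_itv Tm0.
  by apply: lt_trans h2 _; rewrite -natrX ltr_nat ltn_expl.
have p0 : 0 < 2 ^+ n :> R by rewrite exprn_gt0.
pose q := T / 2 ^+ n.
have q0 : 0 < q by rewrite divr_gt0.
have qm : q < m by rewrite ltr_pdivrMr// mulrC -ltr_pdivrMr.
have qe : q < e by apply: lt_le_trans qm _; rewrite ge_min lexx.
have qT : q < T - s by apply: lt_le_trans qm _; rewrite ge_min lexx orbT.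
have sq0 : 0 <= s / q by exact: divr_ge0 s0 (ltW q0).
have /andP[h1 h2] := truncn_itv sq0.
set j := (Num.trunc (s / q)) in h1 h2.
rewrite ler_pdivlMr// in h1; rewrite ltr_pdivrMr// in h2.
have jE : T * (j.+1%:R / 2 ^+ n) = j.+1%:R * q by exact: mulrCA.
have jS : j.+1%:R * q = j%:R * q + q by rewrite -natr1 mulrDl mul1r.
exists n => //; exists j.+1; last by rewrite /= jE; apply: he => //; lra.
rewrite /= ltnS -(ler_nat R) natrX -(ler_pM2r q0) jS.
rewrite [leRHS](_ : _ = T); last by rewrite /q mulrCA divff ?mulr1// gt_eqF.
by lra.
Qed.

Hypothesis sX : stationary_increments P X.
Hypothesis X_0 : {ae P, forall w, X 0 w = 0}.
Hypothesis EX : forall t : R, 0 <= t -> ('E_P[X t] = 0)%E.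
Hypothesis EX2 : ('E_P[fun w => (X 1 w ^+ 2)%R] < +oo)%E.

Let level b k : R := (2 ^+ k) `^ b.

(** At time 2^k the variance is of order 2^k and the squared level is 2^(2 b k), whence the ratio
    [rho], equal to 2^(1 - 2 b). The index [K] is where the tail falls below 1/2, as the maximal
    inequality requires. *)
Lemma exceed_dyadic_bound b : 2^-1 < b -> exists (c rho : R) (K : nat),
  [/\ 0 <= c, 0 <= rho, rho < 1 & forall k, (K <= k)%N ->
  (P (exceed (2 ^+ k) (level b k)) <= (c * rho ^+ k)%:E)%E].
Proof.
move=> hb; have [c c0 hc] := increment_tail mX iX sX X_0 EX EX2.
pose rho : R := 2 `^ (1 - 2 * b).
have rho0 : 0 < rho by exact: powR_gt0.
have rho1 : rho < 1.
  rewrite /rho (_ : 1 - 2 * b = - (2 * b - 1)); last by ring.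
  rewrite powRN invf_lt1 ?powR_gt0//.
  have p0 : 0 < 2 * b - 1 by lra.
  have := gt0_ltr_powR p0 (_ : 1 \in Num.nneg) (_ : 2 \in Num.nneg).
  by rewrite powR1; apply; rewrite ?nnegrE// ltr1n.
have tail k s : 0 <= s -> s <= 2 ^+ k ->
    (P [set w | (level b k < `|X (2 ^+ k) w - X s w|)%R] <= (2 * c * rho ^+ k)%:E)%E.
  move=> s0 sk; have p0 : 0 < 2 ^+ k :> R by rewrite exprn_gt0.
  have p1 : 1 <= 2 ^+ k :> R by rewrite exprn_ege1// ler1n.
  have l0 : 0 < level b k by exact: powR_gt0.
  apply: le_trans (hc s (2 ^+ k) _ s0 sk l0) _.
  rewrite lee_fin.
  have -> : rho ^+ k = level b k ^- 2 * 2 ^+ k.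
    rewrite /rho /level -powR_mulrn ?powR_ge0// -powRrM.
    rewrite -(powR_mulrn k (ler0n R 2)) -(powR_mulrn 2 (powR_ge0 _ b)).
    rewrite -!powRrM -powRN -powRD.
      by congr (_ `^ _); ring.
    by rewrite pnatr_eq0 implybT.
  rewrite [leRHS](_ : _ = level b k ^- 2 * (c * (2 * 2 ^+ k))); last by ring.
  have l1 : 0 <= level b k ^- 2 by rewrite invr_ge0 exprn_ge0// ltW.
  by rewrite ler_wpM2l// ler_wpM2l//; lra.
have [K _ hK] : \forall k \near \oo, 2 * c * rho ^+ k <= 2^-1.
  have : 2 * c * rho ^+ k @[k --> \oo] --> 2 * c * 0.
    by apply: cvgMr; apply: cvg_expr; rewrite ger0_norm// ltW.
  by rewrite mulr0 => /cvgr_le; apply; rewrite invr_gt0.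
exists (2 * (2 * c)), rho, K; split => //; rewrite ?mulr_ge0// ?(ltW rho0)//.
move=> k Kk; have p0 : 0 < 2 ^+ k :> R by rewrite exprn_gt0.
apply: le_trans (maximal_inequality p0 (powR_ge0 _ _) _) _.
  move=> s s0 sk; apply: le_trans (tail k s s0 sk) _.
  by rewrite lee_fin; exact: hK.
by rewrite -mulrA EFinM lee_pmul2l// tail// ltW.
Qed.

Lemma exceed_eventually_not b : 2^-1 < b ->
  {ae P, forall w, exists n, forall k, (n <= k)%N -> ~ exceed (2 ^+ k) (level b k) w}.
Proof.
move=> hb; have [c [rho [K [c0 r0 r1 hK]]]] := exceed_dyadic_bound hb.
pose F k := exceed (2 ^+ (k + K)) (level b (k + K)).
have mF k : measurable (F k) by apply: measurable_exceed; exact: exprn_ge0.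
exists (lim_sup_set F); split.
- by apply: bigcapT_measurable => n; apply: bigcup_measurable => k _.
- apply: lim_sup_set_cvg0 => //.
  apply: (@le_lt_trans _ _ (c / (1 - rho))%:E); last exact: ltry.
  apply: lime_le; first by apply: is_cvg_nneseries => k _ _; exact: measure_ge0.
  apply: nearW => n.
  apply: (@le_trans _ _ (\sum_(0 <= k < n) (c * rho ^+ k)%:E)%E).
    apply: lee_sum => k _; apply: le_trans (hK _ (leq_addl _ _)) _.
    by rewrite lee_fin ler_wpM2l// exprD ler_piMr ?exprn_ge0// exprn_ile1// ltW.
  rewrite sumEFin lee_fin -mulr_sumr ler_wpM2l//.
  have d0 : 0 < 1 - rho by rewrite subr_gt0.
  rewrite -(ler_pM2r d0) mulVf ?gt_eqF//.
  have -> : (\sum_(0 <= k < n) rho ^+ k) * (1 - rho) = 1 - rho ^+ n.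
    elim: n => [|n ih]; first by rewrite big_nil mul0r expr0 subrr.
    by rewrite big_nat_recr//= mulrDl ih exprS; ring.
  by rewrite gerBl exprn_ge0.
move=> w /= h n _; apply: contrapT => hn; apply: h.
exists (n + K)%N => k nk E; apply: hn; exists (k - K)%N; first by rewrite /=; lia.
by rewrite /F subnK//; lia.
Qed.

Lemma growth b : 2^-1 < b ->
  {ae P, forall w, (forall t, 0 <= t -> X s w @[s --> t^'+] --> X t w) ->
    exists C, forall s, 0 <= s -> `|X s w| <= C * weight b s}.
Proof.
move=> hb; have b0 : 0 <= b by lra.
apply: filterS (exceed_eventually_not hb) => w [n hn] rX.
have p0 k : 0 < 2 ^+ k :> R by rewrite exprn_gt0.
have hX k s : (n <= k)%N -> 0 <= s -> s <= 2 ^+ k -> `|X s w| <= `|X 0 w| + 2 * level b k.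
  move=> nk s0 sk; have := exceedP (p0 k) rX (hn k nk) s0 sk.
  by have := ler_normD (X 0 w) (X s w - X 0 w); rewrite subrKC => h1 h2; lra.
(* The first two terms serve times up to 2^n. Beyond, a time between 2^k and 2^(k + 1) is controlled
   by the level of [k.+1], which is 2^b times that of [k] and thus at most 2^b times the weight. *)
pose C := `|X 0 w| + 2 * level b n + 2 * 2 `^ b.
have C0 : `|X 0 w| + 2 * level b n <= C by rewrite lerDl mulr_ge0// powR_ge0.
have lv0 k : 0 <= level b k by exact: powR_ge0.
exists C.
have main m s : 0 <= s -> s <= 2 ^+ (n + m) -> `|X s w| <= C * weight b s.
  elim: m s => [|m ih] s s0.
    rewrite addn0 => sn; apply: le_trans (hX n s (leqnn _) s0 sn) _.
    apply: le_trans C0 _; rewrite ler_peMr ?weight_ge1//.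
    by rewrite !addr_ge0// mulr_ge0// powR_ge0.
  have [sm _|sm sM] := leP s (2 ^+ (n + m)); first exact: ih.
  rewrite addnS in sM.
  apply: le_trans (hX (n + m).+1 s _ s0 sM) _; first by rewrite -addnS leq_addr.
  have w1 : 1 <= weight b s by exact: weight_ge1.
  have w2 : level b (n + m) <= weight b s.
    rewrite /level /weight ge0_ler_powR// ?nnegrE ?ltW// ?addr_ge0//.
    by rewrite ger0_norm//; lra.
  have -> : level b (n + m).+1 = 2 `^ b * level b (n + m).
    by rewrite /level exprS powRM// ltW.
  have h1 : `|X 0 w| <= `|X 0 w| * weight b s by rewrite ler_peMr.
  have h2 : 2 `^ b * level b (n + m) <= 2 `^ b * weight b s.
    by rewrite ler_wpM2l// powR_ge0.
  have h3 : 0 <= level b n * weight b s by rewrite mulr_ge0// (le_trans ler01).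
  by rewrite /C; lra.
move=> s s0; have /andP[_ h2] := truncn_itv s0.
apply: (main (Num.trunc s).+1) => //; apply: le_trans (ltW h2) _.
by rewrite -natrX ler_nat; apply: leq_trans (ltnW (ltn_expl _ (ltnSn 1))) _; rewrite leq_exp2l// leq_addl.
Qed.

End Growth.

(** * The two-sided Levy process *)

Section LeftLimits.
Context {R : realType}.
Implicit Types (x : R -> R) (t : R).

Definition left_lim x t : R := lim (x s @[s --> t^'-]).

(** The function of left limits has the same left limit as [x]. After reflection this makes the
    two-sided process right-continuous at negative times. *)
Lemma left_lim_dist x t (l e : R) : 0 < e -> x s @[s --> t^'-] --> l ->
  (forall u, 0 < u -> cvg (x s @[s --> u^'-])) -> 0 < t ->
  \forall u \near t^'-, `|left_lim x u - l| <= e.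
Proof.
move=> e0 xl hx t0.
have : \forall s \near t^'-, `|l - x s| <= e by move/cvgrPdist_le : xl; exact.
case=> r /= r0 hr; near=> u.
have ut : u < t by near: u; exact: nbhs_left_lt.
have u0 : 0 < u by near: u; exact: nbhs_left_gt.
have cu := hx u u0.
have cn : `|x s - l| @[s --> u^'-] --> `|left_lim x u - l|.
  by apply: cvg_norm; apply: cvgB => //; exact: cvg_cst.
rewrite -(cvg_lim _ cn)//; apply: limr_le; first by apply/cvg_ex; eexists; exact: cn.
near=> s; rewrite distrC; apply: hr.
  have su : s < u by near: s; exact: nbhs_left_lt.
  have sr : t - r < s by near: s; apply: nbhs_left_gt; near: u; apply: nbhs_left_gt; lra.
  by rewrite /= gtr0_norm; lra.
by apply: (lt_trans _ ut); near: s; exact: nbhs_left_lt.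
Unshelve. all: by end_near. Qed.

Lemma left_lim_growth x (C b : R) t : 0 <= b -> 0 <= C -> 0 < t ->
  cvg (x s @[s --> t^'-]) -> (forall s, 0 <= s -> `|x s| <= C * weight b s) ->
  `|left_lim x t| <= C * weight b t.
Proof.
move=> b0 C0 t0 cx hx.
have cn : `|x s| @[s --> t^'-] --> `|left_lim x t| by exact: cvg_norm.
rewrite -(cvg_lim _ cn)//; apply: limr_le; first by apply/cvg_ex; eexists; exact: cn.
near=> s.
have s0 : 0 < s by near: s; exact: nbhs_left_gt.
have st : s < t by near: s; exact: nbhs_left_lt.
apply: le_trans (hx s (ltW s0)) _; rewrite ler_wpM2l//.
rewrite /weight ge0_ler_powR ?nnegrE ?addr_ge0// !ger0_norm ?ltW//; lra.
Unshelve. all: by end_near. Qed.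

Lemma two_sided_good_path disp (Omega : measurableType disp) (L1 L2 : R -> Omega -> R)
    (b C1 C2 : R) w : 0 <= b -> cadlag (L1 ^~ w) -> cadlag (L2 ^~ w) ->
  (forall s, 0 <= s -> `|L1 s w| <= C1 * weight b s) ->
  (forall s, 0 <= s -> `|L2 s w| <= C2 * weight b s) ->
  good_path b (Num.max C1 C2) (two_sided L1 L2 ^~ w).
Proof.
move=> b0 c1 c2 h1 h2.
have nonneg C (x : R -> R) : (forall s, 0 <= s -> `|x s| <= C * weight b s) -> 0 <= C.
  by move=> /(_ 0 (lexx _)); rewrite weight0 mulr1; exact: le_trans.
have C1_ge0 := nonneg _ _ h1; have C2_ge0 := nonneg _ _ h2.
have cl u : 0 < u -> cvg (L2 s w @[s --> u^'-]).
  by move=> u0; have [_] := c2 u (ltW u0); exact.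
split; last first.
  move=> s; rewrite /two_sided; have [s0|s0] := leP 0 s.
    by apply: le_trans (h1 s s0) _; rewrite ler_wpM2r ?weight_ge0// le_max lexx.
  have s0' : 0 < - s by rewrite oppr_gt0.
  rewrite normrN -weightN; apply: le_trans (left_lim_growth b0 C2_ge0 s0' (cl _ s0') h2) _.
  by rewrite ler_wpM2r ?weight_ge0// le_max lexx orbT.
move=> t; rewrite /two_sided; have [t0|t0] := leP 0 t.
  have [rt _] := c1 t t0.
  apply: cvg_trans rt; apply: near_eq_cvg; near=> s.
  by rewrite (le_trans t0)//; near: s; exact: nbhs_right_ge.
have t0' : 0 < - t by rewrite oppr_gt0.
have H : left_lim (L2 ^~ w) u @[u --> (- t)^'-] --> left_lim (L2 ^~ w) (- t).
  apply/cvgrPdist_le => e e0; have := left_lim_dist e0 (cl _ t0') cl t0'.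
  by apply: filterS => u; rewrite distrC.
have : - left_lim (L2 ^~ w) (- s) @[s --> t^'+] --> - left_lim (L2 ^~ w) (- t).
  apply: cvgN; by move: H => /cvg_at_leftNP; rewrite opprK.
apply: cvg_trans; apply: near_eq_cvg; near=> s.
by rewrite leNgt ifF//; apply/negbF; near: s; exact: nbhs_right_lt.
Unshelve. all: by end_near. Qed.

End LeftLimits.

Lemma cvg_within_seq (T : topologicalType) (u : nat -> T) (D : set T) (t : T) :
  u n @[n --> \oo] --> t -> (forall n, D (u n)) ->
  u n @[n --> \oo] --> within D (nbhs t).
Proof.
move=> ut uD A wA; have : \forall n \near \oo, D (u n) -> A (u n) by exact: ut wA.
by case=> N _ h; exists N => // n Nn; exact: h Nn (uD n).
Qed.

Section LeftContinuityInProbability.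
Context {R : realType} {disp : measure_display} {Omega : measurableType disp}.
Variable P : probability Omega R.

(** A fixed time is almost surely not a jump time. If the left limit differs from [X t], then for
    some [k] the events [E k n] hold for all large [n]; their probabilities tend to 0 by continuity
    in probability, so this has probability 0. *)
Lemma left_lim_ae (X : R -> Omega -> R) (t : R) : Levy_process P X -> 0 < t ->
  {ae P, forall w, left_lim (X ^~ w) t = X t w}.
Proof.
move=> [[pX _ _ _] [cX dX]] t0.
have mX (s : R) : 0 <= s -> measurable_fun setT (X s) by exact: pX.
pose u n : R := t * (1 - n.+1%:R^-1).
have u0 n : 0 <= u n.
  by rewrite mulr_ge0 ?(ltW t0)// subr_ge0 invf_le1 ?ler1n ?ltr0n.
have ut n : u n < t by rewrite /u gtr_pMr// ltrBlDr ltrDl invr_gt0.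
have ucvg : u n @[n --> \oo] --> t.
  rewrite -[X in _ --> X](_ : t * (1 - 0) = t); last by rewrite subr0 mulr1.
  by apply: cvgMr; apply: cvgB; [exact: cvg_cst|exact: cvg_harmonic].
pose E k n := [set w | k.+1%:R^-1 < `|X (u n) w - X t w|].
have mE k n : measurable (E k n) by apply: measurable_norm_increment_gt => //; exact: ltW.
have PE k : P (E k n) @[n --> \oo] --> 0%E.
  have e0 : 0 < k.+1%:R^-1 :> R by rewrite invr_gt0.
  have := cX t _ (ltW t0) e0; apply: cvg_comp.
  exact: cvg_within_seq.
pose N := \bigcup_k \bigcup_m \bigcap_(n in [set n | (m <= n)%N]) E k n.
have N0 : P.-negligible N.
  apply: negligible_bigcup => k; apply: negligible_bigcup => m.
  have mI : measurable (\bigcap_(n in [set n | (m <= n)%N]) E k n).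
    by apply: bigcap_measurableType.
  exists (\bigcap_(n in [set n | (m <= n)%N]) E k n); split => //.
  apply/eqP; rewrite -measure_le0.
  rewrite -[leRHS](cvg_lim _ (PE k))//; apply: lime_ge.
    by apply/cvg_ex; eexists; exact: PE.
  near=> n; apply: le_measure; rewrite ?inE// => w; apply => /=.
  by near: n; exact: nbhs_infty_ge.
apply: filterS2 dX (_ : {ae P, forall w, ~ N w}); last first.
  by apply: negligibleS N0 => w /= /contrapT.
move=> w cw nN; have [_ /(_ t0) cl] := cw t (ltW t0).
have ul : u n @[n --> \oo] --> t^'- by exact: cvg_within_seq.
have Xl : X (u n) w @[n --> \oo] --> left_lim (X ^~ w) t.
  exact: (cvg_comp _ _ ul cl).
have nl : `|X (u n) w - X t w| @[n --> \oo] --> `|left_lim (X ^~ w) t - X t w|.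
  by apply: cvg_norm; apply: cvgB => //; exact: cvg_cst.
apply/eqP; rewrite -subr_eq0 -normr_le0 leNgt; apply/negP => d0.
have [k _ hk] := near_infty_natSinv_lt (PosNum d0).
have {}hk := hk k (leqnn _); rewrite /= in hk.
move/cvgr_gt : nl => /(_ _ hk) [m _ hm].
by apply: nN; exists k => //; exists m => // n /= mn; exact: hm.
Unshelve. all: by end_near. Qed.

End LeftContinuityInProbability.

Section SigmaOf.
Context {R : realType} {disp : measure_display} {Omega : measurableType disp}.
Variables (T : set R) (X : R -> Omega -> R).

Let G : set (set Omega) :=
  [set A | exists t, T t /\ exists2 B : set R, measurable B & A = X t @^-1` B].
Let OmegaX := g_sigma_algebraType G.

Lemma sigma_of_increment s t (B : set R) : T s -> T t -> measurable B ->
  sigma_of T X ((fun w => X t w - X s w) @^-1` B).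
Proof.
move=> Ts Tt mB.
have mX u : T u -> measurable_fun setT (X u : OmegaX -> R).
  move=> Tu _ C mC; rewrite setTI; apply: sub_sigma_algebra.
  by exists u; split => //; exists C.
have : measurable_fun setT ((fun w => X t w - X s w) : OmegaX -> R).
  by apply: measurable_funB; exact: mX.
by move=> /(_ measurableT _ mB); rewrite setTI.
Qed.

Lemma sigma_of_bigcap (I : set nat) (A : nat -> set Omega) :
  (forall i, I i -> sigma_of T X (A i)) -> sigma_of T X (\bigcap_(i in I) A i).
Proof. by move=> mA; exact: (@bigcap_measurableType _ OmegaX). Qed.

End SigmaOf.

Lemma ae_eq_measure d (T : measurableType d) (R : realType)
    (mu : {measure set T -> \bar R}) (A B : set T) : measurable A -> measurable B ->
  {ae mu, forall w, A w <-> B w} -> mu A = mu B.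
Proof.
move=> mA mB AB; rewrite -(setIT A) -(setIT B) -!integral_indic//.
apply: ae_eq_integral => //; try by apply/measurable_EFinP; exact: measurable_indic.
apply: filterS AB => w [ab ba] _ /=; congr EFin; rewrite !indicE.
by congr (nat_of_bool _)%:R; apply/idP/idP => /set_mem ?; apply/mem_set; auto.
Qed.

Lemma eq_in_law_fdd1 (R : realType) d (T : measurableType d) (P : probability T R)
    (X Y : R -> T -> R) (t u : 'I_1 -> R) :
  eq_in_law P (fdd X t) (fdd Y u) -> eq_in_law P (X (t ord0)) (Y (u ord0)).
Proof.
move=> XY B mB.
have mA : measurable ((@tnth _ R ^~ (ord0 : 'I_1)) @^-1` B).
  by rewrite -[X in measurable X]setTI; exact: measurable_tnth.
have pE (Z : R -> T -> R) v : fdd Z v @^-1` (@tnth 1 R ^~ ord0 @^-1` B) = Z (v ord0) @^-1` B.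
  by apply/seteqP; split => w /=; rewrite tnth_mktuple.
by have := XY _ mA; rewrite !pE.
Qed.

Section TwoSidedIncrements.
Context {R : realType} {disp : measure_display} {Omega : measurableType disp}.
Variable P : probability Omega R.
Hypothesis P_complete : measure_is_complete P.
Variables L1 L2 : R -> Omega -> R.
Hypotheses (L1P : Levy_process P L1) (L2P : Levy_process P L2).
Hypothesis L12 : eq_fdd P [set t : R | 0 <= t] L1 L2.
Hypothesis L12_indep : indep_processes P [set t : R | 0 <= t] L1 L2.
Local Notation L := (two_sided L1 L2).
Implicit Types (s t h : R) (tau : nat -> R).

Lemma ae_measurable_fun_real (f g : Omega -> R) :
  {ae P, forall w, f w = g w} -> measurable_fun setT f -> measurable_fun setT g.
Proof.
move=> fg mf; apply/measurable_EFinP.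
apply: (ae_measurable_fun P_complete (f := EFin \o f)); last exact/measurable_EFinP.
by apply: filterS fg => w fgw _ /=; rewrite fgw.
Qed.

Lemma two_sided_neg_ae t : t < 0 -> {ae P, forall w, L t w = - L2 (- t) w}.
Proof.
move=> t0; have := @left_lim_ae _ _ _ P L2 (- t) L2P.
rewrite oppr_gt0 => /(_ t0); apply: filterS => w h.
by rewrite /two_sided leNgt t0/= -h.
Qed.

Let mL1 t : 0 <= t -> measurable_fun setT (L1 t).
Proof. by case: L1P => -[h _ _ _] _; exact: h. Qed.

Let mL2 t : 0 <= t -> measurable_fun setT (L2 t).
Proof. by case: L2P => -[h _ _ _] _; exact: h. Qed.

(** For [t < 0] the value is defined by a left limit; it is almost surely [- L2 (- t)], and
    completeness transfers measurability. *)
Lemma measurable_two_sided t : measurable_fun setT (L t).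
Proof.
have [t0|t0] := leP 0 t.
  by rewrite /two_sided t0; exact: mL1.
apply: (@ae_measurable_fun_real (fun w => - L2 (- t) w)).
  by apply: filterS (two_sided_neg_ae t0) => w ->.
by apply: measurableT_comp => //; apply: mL2; rewrite oppr_ge0 ltW.
Qed.

(** Here [k] is the index with [tau k = 0]. Since 0 belongs to the grid, no increment straddles it,
    and each comes from one of the two processes, without left limits. *)
Definition split_increment tau k j : Omega -> R :=
  if (j < k)%N then fun w => L2 (- tau j) w - L2 (- tau j.+1) w
  else fun w => L1 (tau j.+1) w - L1 (tau j) w.

Section Grid.
Variables (tau : nat -> R) (k : nat).
Hypotheses (tau_lt : forall i, tau i < tau i.+1) (tau_k : tau k = 0).
Local Notation D := (split_increment tau k).

Let tau_homo : {homo tau : i j / (i < j)%N >-> i < j}.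
Proof. exact: homo_ltn lt_trans tau_lt. Qed.

Lemma grid_le0 j : (j <= k)%N -> 0 <= - tau j.
Proof.
rewrite leq_eqVlt => /predU1P[->|jk]; first by rewrite tau_k oppr0.
by rewrite oppr_ge0 -tau_k ltW// tau_homo.
Qed.

Lemma grid_ge0 j : (k <= j)%N -> 0 <= tau j.
Proof.
rewrite leq_eqVlt => /predU1P[<-|jk]; first by rewrite tau_k.
by rewrite -tau_k ltW// tau_homo.
Qed.

Lemma measurable_split_increment j : measurable_fun setT (D j).
Proof.
rewrite /split_increment; case: ltnP => jk; apply: measurable_funB.
- by apply: mL2; apply: grid_le0; exact: ltnW.
- by apply: mL2; exact: grid_le0.
- by apply: mL1; apply: grid_ge0; exact: leqW.
- by apply: mL1; exact: grid_ge0.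
Qed.

Lemma split_increment_ae : {ae P, forall w j, D j w = L (tau j.+1) w - L (tau j) w}.
Proof.
have h1 : {ae P, forall w, L1 0 w = 0} by case: L1P => -[].
have h2 : {ae P, forall w, L2 0 w = 0} by case: L2P => -[].
apply: (@ae_foralln _ _ _ P) => j.
rewrite /split_increment; case: ltnP => jk; last first.
  by apply: aeW => w; rewrite /two_sided !grid_ge0// leqW.
have tj : tau j < 0 by rewrite -tau_k tau_homo.
move: jk; rewrite leq_eqVlt => /predU1P[jk|jk].
  rewrite jk tau_k; apply: filterS3 h1 h2 (two_sided_neg_ae tj) => w h1 h2 ->.
  by rewrite {1}/two_sided lexx h1 oppr0 h2 opprK; ring.
have tj1 : tau j.+1 < 0 by rewrite -tau_k tau_homo.
apply: filterS2 (two_sided_neg_ae tj) (two_sided_neg_ae tj1) => w -> ->.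
by ring.
Qed.

Lemma split_increment_law j (B : set R) : measurable B ->
  P (D j @^-1` B) = P ((fun w => L1 (tau j.+1 - tau j) w - L1 0 w) @^-1` B).
Proof.
move=> mB; have d0 : 0 <= tau j.+1 - tau j by rewrite subr_ge0 ltW.
case: L1P => -[_ z1 _ s1] _; case: L2P => -[_ z2 _ s2] _.
rewrite /split_increment; case: ltnP => jk; last first.
  have := s1 (tau j) (tau j.+1 - tau j) (grid_ge0 jk) d0 B mB.
  by rewrite subrKC.
have := s2 (- tau j.+1) (tau j.+1 - tau j) (grid_le0 jk) d0 B mB.
rewrite (_ : - tau j.+1 + _ = - tau j); last by ring.
move=> ->.
have E := eq_in_law_fdd1 (@L12 1 (fun=> tau j.+1 - tau j) (fun=> d0)) mB.
(* Equality of the laws of [L1] and [L2] is used at a single time, so the initial values, which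
   vanish only almost surely, have to be removed first. *)
have sub0 (X : R -> Omega -> R) : (forall t, 0 <= t -> measurable_fun setT (X t)) ->
    {ae P, forall w, X 0 w = 0} ->
    P ((fun w => X (tau j.+1 - tau j) w - X 0 w) @^-1` B) =
    P (X (tau j.+1 - tau j) @^-1` B).
  move=> mX X0.
  have mXd : measurable_fun setT (fun w => X (tau j.+1 - tau j) w - X 0 w).
    by apply: measurable_funB; exact: mX.
  apply: ae_eq_measure; [exact: measurable_preim|by apply: measurable_preim => //; exact: mX|].
  by apply: filterS X0 => w /= ->; rewrite subr0.
by rewrite !sub0.
Qed.

Lemma split_increment_indep : indep_seq P D.
Proof.
case: L1P => -[_ _ i1 _] _; case: L2P => -[_ _ i2 _] _.
have main m (B : nat -> set R) : (forall i, measurable (B i)) ->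
    P (\bigcap_(j in `I_(k + m)) (D j @^-1` B j)) =
    (\prod_(j < k + m) P (D j @^-1` B j))%E.
  move=> mB.
  pose A1 := \bigcap_(j in `I_m) (D (k + j)%N @^-1` B (k + j)%N).
  pose A2 := \bigcap_(j in `I_k) (D j @^-1` B j).
  have D1 j : D (k + j)%N = fun w => L1 (tau (k + j.+1)%N) w - L1 (tau (k + j)%N) w.
    by rewrite /split_increment ltnNge leq_addr addnS.
  have D2 j : (j < k)%N -> D j = fun w => L2 (- tau j) w - L2 (- tau j.+1) w.
    by rewrite /split_increment => ->.
  have -> : \bigcap_(j in `I_(k + m)) (D j @^-1` B j) = A1 `&` A2.
    apply/seteqP; split => [w h|w [h1 h2] j /= jkm].
      split => j /= jm; apply: h => /=; first by rewrite ltn_add2l.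
      exact: ltn_addr.
    have [jk|kj] := ltnP j k; first exact: h2.
    by have := h1 (j - k)%N; rewrite /= subnKC//; apply; rewrite ltn_subLR.
  have sA1 : sigma_of [set t : R | 0 <= t] L1 A1.
    apply: sigma_of_bigcap => j _; rewrite D1.
    by apply: sigma_of_increment => //=; apply: grid_ge0; exact: leq_addr.
  have sA2 : sigma_of [set t : R | 0 <= t] L2 A2.
    apply: sigma_of_bigcap => j /= jk; rewrite D2//.
    by apply: sigma_of_increment => //=; apply: grid_le0 => //; exact: ltnW.
  rewrite L12_indep// big_split_ord/= muleC; congr (_ * _)%E.
    (* Independence of the increments of [L2] is stated for increasing times, so the negative part
       of the grid is read backwards from [tau k = 0]; the values past the index [k] are
       arbitrary. *)
    pose rho i : R := if (i <= k)%N then - tau (k - i)%N else - tau 0%N + (i - k)%:R.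
    have rho0 : 0 <= rho 0%N by rewrite /rho/= subn0 tau_k oppr0.
    have rhoi i : rho i < rho i.+1.
      rewrite /rho; have [ik|ki|->] := ltngtP i k.
      - by rewrite ltrN2 tau_homo//; lia.
      - by rewrite ltrD2l ltr_nat; lia.
      - by rewrite subnn ltrDl ltr0n; lia.
    have := @i2 k rho (fun i => B (k - i.+1)%N) rho0 rhoi (fun i => mB _).
    have DE i : (i < k)%N -> (fun w => L2 (rho i.+1) w - L2 (rho i) w) = D (k - i.+1)%N.
      move=> ik; rewrite D2; last by lia.
      by rewrite /rho ik (ltnW ik) subnSK.
    have -> : \bigcap_(i in `I_k) [set w | B (k - i.+1)%N (L2 (rho i.+1) w - L2 (rho i) w)] = A2.
      apply/seteqP; split => [w h j /= jk|w h i /= ik].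
        have jE : (k - (k - j.+1).+1)%N = j by lia.
        have ltk : (k - j.+1 < k)%N by lia.
        by have := DE _ ltk; rewrite jE => <-; have := h _ ltk; rewrite /= jE.
      have := h (k - i.+1)%N; rewrite /= -DE//; apply; lia.
    move=> ->; rewrite [RHS](reindex_inj rev_ord_inj)/=; apply: eq_bigr => i _.
    by rewrite -DE.
  have := @i1 m (fun i => tau (k + i)%N) (fun i => B (k + i)%N).
  rewrite addn0 tau_k lexx => /(_ isT) h.
  have -> : A1 = \bigcap_(i in `I_m)
      [set w | B (k + i)%N (L1 (tau (k + i.+1)%N) w - L1 (tau (k + i)%N) w)].
    by apply: eq_bigcapr => j _; rewrite D1.
  rewrite h//; last by move=> i; rewrite addnS.
  by apply: eq_bigr => i _; rewrite D1.
move=> N B mB.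
(* The claim [main] covers index ranges that contain the whole negative part; sets equal to [setT]
   pad the range beyond [N]. *)
pose B' i := if (i < N)%N then B i else setT.
have mB' i : measurable (B' i) by rewrite /B'; case: ifP.
have := main N B' mB'; rewrite addnC big_split_ord/=.
rewrite [X in (_ * X)%E]big1 ?mule1; last first.
  by move=> i _; rewrite /B' ltnNge leq_addr/= preimage_setT probability_setT.
rewrite [in RHS](eq_bigr (fun i : 'I_N => P (D i @^-1` B i))); last first.
  by move=> i _; rewrite /B' ltn_ord.
move=> <-; congr (P _); apply/seteqP; split => w h j /= jN.
  by rewrite /B'; case: ifP => // jN'; exact: h.
by have := h j (ltn_addr _ jN); rewrite /B'/= jN.
Qed.

End Grid.

(** The increments on a grid through 0 are independent with laws that depend only on the lengths.
    The origin may sit at different indices in the two grids, which is what a translation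
    produces. *)
Lemma two_sided_grid_law tau tau' k k' : (forall i, tau i < tau i.+1) -> tau k = 0 ->
  (forall i, tau' i < tau' i.+1) -> tau' k' = 0 ->
  (forall i, tau' i.+1 - tau' i = tau i.+1 - tau i) ->
  forall A : set (@path_space R nat), measurable A ->
    P ((fun w j => L (tau j.+1) w - L (tau j) w) @^-1` A) =
    P ((fun w j => L (tau' j.+1) w - L (tau' j) w) @^-1` A).
Proof.
move=> ti tk ti' tk' tt' A mA.
have mI (t : nat -> R) :
    measurable_fun setT ((fun w j => L (t j.+1) w - L (t j) w) : Omega -> @path_space R nat).
  by apply: measurable_into_path_space => j; apply: measurable_funB; exact: measurable_two_sided.
have E (t : nat -> R) l : (forall i, t i < t i.+1) -> t l = 0 ->
    P ((fun w j => split_increment t l j w) @^-1` A) =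
    P ((fun w j => L (t j.+1) w - L (t j) w) @^-1` A).
  move=> it tl; apply: ae_eq_measure.
  - rewrite -[X in measurable X]setTI; apply: (measurable_into_path_space _ measurableT mA).
    by move=> j; exact: measurable_split_increment.
  - by rewrite -[X in measurable X]setTI; exact: (mI t).
  - by apply: filterS (split_increment_ae it tl) => w h /=; rewrite (funext h).
rewrite -(E tau k)// -(E tau' k')//.
apply: indep_seq_law mA; try by move=> j; exact: measurable_split_increment.
- exact: split_increment_indep.
- exact: split_increment_indep.
- by move=> j B mB; rewrite !split_increment_law// tt'.
Qed.

Lemma grid_through (s : seq R) : exists2 tau : nat -> R,
  forall i, tau i < tau i.+1 & forall x, x \in s -> exists i, tau i = x.
Proof.
pose u := sort <=%R (undup s).
have us : sorted <%R u by rewrite sort_lt_sorted undup_uniq.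
exists (fun j => if (j < size u)%N then nth 0 u j else last 0 u + (j.+1 - size u)%:R).
  move=> i; have [iu|ui] := ltnP i.+1 (size u).
    by rewrite (ltnW iu) (sorted_ltn_nth lt_trans 0 us) ?inE// ltnW.
  case: ifPn => iu; last by rewrite ltrD2l ltr_nat; lia.
  have -> : size u = i.+1 by apply/eqP; rewrite eqn_leq ui.
  rewrite (last_nth 0) (_ : size u = i.+1); last by apply/eqP; rewrite eqn_leq ui.
  by rewrite /= ltrDl ltr0n; lia.
move=> x xs; have xu : x \in u by rewrite mem_sort mem_undup.
by exists (index x u); rewrite index_mem xu nth_index.
Qed.

Lemma two_sided_stationary_increments h1 h2 (A : set (@path_space R R)) : measurable A ->
  P ((fun w s => L (s + h1) w - L h1 w) @^-1` A) =
  P ((fun w s => L (s + h2) w - L h2 w) @^-1` A).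
Proof.
move=> mA.
have mI h : measurable_fun setT ((fun w s => L (s + h) w - L h w) : Omega -> @path_space R R).
  by apply: measurable_into_path_space => s; apply: measurable_funB; exact: measurable_two_sided.
have := @path_law_induction _ R _ _ P _ _ setT setT 1%E (mI h1) (mI h2)
  measurableT measurableT lee01 isT.
move=> H; have := H _ A mA; rewrite !setIT mul1e; apply=> n i B mB.
rewrite !setIT mul1e.
(* The points [- h1] and [- h2] put the origin into both translated grids, and the point 0 makes
   [L h1] and [L h2] values on these grids. *)
have [tau ti tauP] := grid_through ([:: 0; - h1; - h2] ++ [seq i k | k <- iota 0 n]).
have [|k0 t0] := tauP 0; first by rewrite !inE eqxx.
have [|k1 t1] := tauP (- h1); first by rewrite !inE eqxx orbT.
have [|k2 t2] := tauP (- h2); first by rewrite !inE eqxx !orbT.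
have /choice[a ha] k : exists j, (k < n)%N -> tau j = i k.
  have [kn|nk] := ltnP k n; last by exists 0%N.
  have [|j <-] := tauP (i k); last by exists j.
  by rewrite mem_cat map_f ?orbT// mem_iota.
(* Applied to the increments on the translated grid, this difference of partial sums is
   [L (tau m + h) - L h], whatever [h] is. *)
pose Phi m (x : @path_space R nat) := \sum_(0 <= l < m) x l - \sum_(0 <= l < k0) x l.
have mPhi m : measurable_fun setT (Phi m).
  by apply: measurable_funB; apply: measurable_sum => l; exact: measurable_coordinate.
pose A' : set (@path_space R nat) :=
  \bigcap_k (if (k < n)%N then Phi (a k) @^-1` B k else setT).
have mA' : measurable A'.
  apply: bigcapT_measurable => k; case: ifP => // _.
  by rewrite -[X in measurable X]setTI; exact: mPhi.
have E h : (fun w s => L (s + h) w - L h w) @^-1` rectangle n i B =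
    (fun w j => L (tau j.+1 + h) w - L (tau j + h) w) @^-1` A'.
  have PhiE k w : (k < n)%N ->
      Phi (a k) (fun j => L (tau j.+1 + h) w - L (tau j + h) w) =
      L (i k + h) w - L h w.
    move=> kn; rewrite /Phi !(telescope_sumr (fun l => L (tau l + h) w))//.
    by rewrite ha// t0 add0r; ring.
  apply/seteqP; split => [w hw k _ /=|w hw k kn].
    case: ifPn => // kn.
    change (B k (Phi (a k) (fun j => L (tau j.+1 + h) w - L (tau j + h) w))).
    by rewrite PhiE//; exact: hw.
  by have := hw k Logic.I; rewrite kn /preimage/= PhiE.
rewrite !E; apply: (two_sided_grid_law (k := k1) (k' := k2)) => //.
- by move=> j; rewrite ltrD2r.
- by rewrite t1 addNr.
- by move=> j; rewrite ltrD2r.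
- by rewrite t2 addNr.
- by move=> j; ring.
Qed.

End TwoSidedIncrements.

Section TwoSidedGrowth.
Context {R : realType} {disp : measure_display} {Omega : measurableType disp}.
Variable P : probability Omega R.

Lemma driving_Levy_good_path (L1 L2 : R -> Omega -> R) (b : R) : 2^-1 < b ->
  Levy_process P L1 -> Levy_process P L2 -> eq_fdd P [set t : R | 0 <= t] L1 L2 ->
  (forall t, 'E_P[two_sided L1 L2 t] = 0)%E ->
  ('E_P[fun w => (two_sided L1 L2 1 w ^+ 2)%R] < +oo)%E ->
  {ae P, forall w, exists C, good_path b C (two_sided L1 L2 ^~ w)}.
Proof.
move=> hb L1P L2P L12 EL EL2.
have [[m1 z1 i1 s1] [_ c1]] := L1P; have [[m2 z2 i2 s2] [_ c2]] := L2P.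
have L1E t : 0 <= t -> two_sided L1 L2 t = L1 t.
  by move=> t0; apply/funext => w; rewrite /two_sided t0.
have E1 t : 0 <= t -> ('E_P[L1 t] = 0)%E by move=> t0; rewrite -L1E.
have V1 : ('E_P[fun w => (L1 1 w ^+ 2)%R] < +oo)%E by rewrite -L1E.
have law t : 0 <= t -> eq_in_law P (L1 t) (L2 t).
  by move=> t0; exact: eq_in_law_fdd1 (@L12 1 (fun=> t) (fun=> t0)).
have E2 t : 0 <= t -> ('E_P[L2 t] = 0)%E.
  move=> t0; rewrite -(E1 t t0) unlock; apply/esym.
  apply: (eq_in_law_integral (f := EFin)); [exact: m1|exact: m2|exact: law|].
  by apply/measurable_EFinP; exact: measurable_id.
have V2 : ('E_P[fun w => (L2 1 w ^+ 2)%R] < +oo)%E.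
  move: V1; rewrite !unlock; congr (_ < _)%E.
  apply: (eq_in_law_integral (f := fun x : R => (x ^+ 2)%:E));
    [exact: (m1 1 ler01)|exact: (m2 1 ler01)|exact: (law 1 ler01)|].
  by apply/measurable_EFinP; exact: measurable_funX.
have g1 := growth m1 i1 s1 z1 E1 V1 hb.
have g2 := growth m2 i2 s2 z2 E2 V2 hb.
have b0 : 0 <= b by lra.
apply: filterS2 (filterI c1 c2) (filterI g1 g2) => w [d1 d2] [h1 h2].
have [C1 hC1] := h1 (fun t t0 => proj1 (d1 t t0)).
have [C2 hC2] := h2 (fun t t0 => proj1 (d2 t t0)).
by exists (Num.max C1 C2); exact: two_sided_good_path.
Qed.

Lemma tail_cvg0 (Y : Omega -> R) : measurable_fun setT Y ->
  P [set w | (k%:R < `|Y w|)%R] @[k --> \oo] --> 0%E.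
Proof.
move=> mY; pose F (k : nat) := [set w | k%:R < `|Y w|].
have mF k : measurable (F k) by exact: (measurable_preim mY (measurable_norm_gt _)).
have F0 : \bigcap_k F k = set0.
  apply/seteqP; split => // w h.
  have /andP[_ h2] := truncn_itv (normr_ge0 (Y w)).
  by have := h (Num.trunc `|Y w|).+1 Logic.I; rewrite /F/= ltNge ltW.
rewrite -[X in _ --> X](measure0 P) -F0; apply: nonincreasing_cvg_mu => //.
- by apply: le_lt_trans (probability_le1 P (mF 0%N)) _; rewrite ltry.
- exact: bigcapT_measurable.
- apply/nonincreasing_seqP => k; apply/subsetPset => w; rewrite /F/=.
  by apply: le_lt_trans; rewrite ler_nat.
Qed.

End TwoSidedGrowth.

(** * Stationarity and uniqueness *)

Section FractionalLevyOU.
Context {R : realType} {disp : measure_display} {Omega : measurableType disp}.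
Variable P : probability Omega R.
Hypothesis P_complete : measure_is_complete P.
Variables (d b lam : R).
Hypotheses (d_gt0 : 0 < d) (d_lt1 : d < 1) (b_ge0 : 0 <= b) (b_lt : b < 1 - d).
Hypothesis lam_gt0 : 0 < lam.
Variable L : R -> Omega -> R.
Hypothesis mL : forall t, measurable_fun setT (L t).
Hypothesis L_good : {ae P, forall w, exists C, good_path b C (L ^~ w)}.

Let shift (h : R) : Omega -> @path_space R R := fun w s => L (s + h) w - L h w.
Hypothesis L_law : forall h1 h2 (A : set (@path_space R R)), measurable A ->
  P (shift h1 @^-1` A) = P (shift h2 @^-1` A).

Local Notation Ld := (FLP d L).
Local Notation LOU := (FLOU lam Ld).

Let measurable_shift h : measurable_fun setT (shift h).
Proof.
by apply: measurable_into_path_space => s; apply: measurable_funB; exact: mL.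
Qed.

Lemma FLP_good w C : good_path b C (L ^~ w) -> Ld ^~ w = FLP_path d (L ^~ w).
Proof. by move=> gx; apply/funext => t; exact: FLP_good_path gx. Qed.

Lemma FLOU_good w C : good_path b C (L ^~ w) ->
  LOU ^~ w = OU_path lam (FLP_path d (L ^~ w)).
Proof.
move=> gx; have [cy [C' hy]] := good_FLP_path d_gt0 d_lt1 b_ge0 b_lt gx.
apply/funext => t; rewrite /FLOU (FLP_good gx).
exact: RS_int_ninfty_OU lam_gt0 cy hy t.
Qed.

Lemma FLOU_functional w : (exists C, good_path b C (L ^~ w)) ->
  forall t h, LOU (t + h) w = OU_functional d lam t (shift h w).
Proof.
move=> [C gx] t h; have [cy [C' hy]] := good_FLP_path d_gt0 d_lt1 b_ge0 b_lt gx.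
have gs := good_pathB (good_path_translate h b_ge0 gx) (good_path_cst (L h w) b_ge0).
rewrite (OU_functionalE d_gt0 d_lt1 b_ge0 b_lt lam_gt0 t gs).
rewrite -[LOU _ _]/((LOU ^~ w) (t + h)) (FLOU_good gx).
have q0 : 0 <= d + 2 * b by rewrite addr_ge0 ?mulr_ge0// ltW.
rewrite -(OU_path_translate t h lam_gt0 q0 cy hy); congr (OU_path _ _ _).
by apply/funext => s; rewrite (FLP_path_increments d_gt0 d_lt1 b_ge0 b_lt _ _ gx).
Qed.

Lemma measurable_FLOU t : measurable_fun setT (LOU t).
Proof.
apply: (ae_measurable_fun_real P_complete (f := OU_functional d lam t \o shift 0)).
  by apply: filterS L_good => w gw; rewrite /= -FLOU_functional// addr0.
by apply: measurableT_comp; [exact: measurable_OU_functional|exact: measurable_shift].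
Qed.

Lemma FLOU_is_RS_int : {ae P, forall w, forall t : R,
  is_RS_int_ninfty (fun u => expR (- lam * (t - u))) (Ld ^~ w) t (LOU t w)}.
Proof.
apply: filterS L_good => w [C gx] t.
have [cy [C' hy]] := good_FLP_path d_gt0 d_lt1 b_ge0 b_lt gx.
rewrite -[LOU t w]/((LOU ^~ w) t) (FLOU_good gx) (FLP_good gx).
exact: is_RS_int_ninfty_OU lam_gt0 cy hy t.
Qed.

Lemma FLOU_solution : pathwise_solution P lam Ld LOU.
Proof.
split; first by move=> t _; exact: measurable_FLOU.
  apply: filterS L_good => w [C gx].
  have [cy [C' hy]] := good_FLP_path d_gt0 d_lt1 b_ge0 b_lt gx.
  rewrite (FLOU_good gx); exact: continuous_OU_path lam_gt0 cy hy.
apply: filterS L_good => w [C gx] s t st.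
have [cy [C' hy]] := good_FLP_path d_gt0 d_lt1 b_ge0 b_lt gx.
have := OU_path_solution lam_gt0 cy hy st.
by rewrite -(FLOU_good gx) -(FLP_good gx).
Qed.

Lemma measurable_fdd m (X : R -> Omega -> R) (t : 'I_m -> R) :
  (forall i, measurable_fun setT (X (t i))) -> measurable_fun setT (fdd X t).
Proof.
move=> mX; apply/measurable_fun_tnthP => i.
rewrite (_ : _ \o _ = X (t i))//.
by apply/funext => w; rewrite /= tnth_mktuple.
Qed.

Lemma FLOU_stationary : stationary P LOU.
Proof.
move=> m t h _ A mA.
pose Psi (x : @path_space R R) := [tuple OU_functional d lam (t i) x | i < m].
have mPsi : measurable_fun setT Psi.
  apply/measurable_fun_tnthP => i.
  rewrite (_ : _ \o _ = OU_functional d lam (t i)).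
    exact: measurable_OU_functional.
  by apply/funext => x; rewrite /= tnth_mktuple.
have mPA : measurable (Psi @^-1` A) by rewrite -[X in measurable X]setTI; exact: mPsi.
have E k : P (fdd LOU (fun i => t i + k) @^-1` A) = P (shift k @^-1` (Psi @^-1` A)).
  apply: ae_eq_measure.
  - rewrite -[X in measurable X]setTI; apply: measurable_fdd => // i.
    exact: measurable_FLOU.
  - by rewrite -[X in measurable X]setTI; exact: measurable_shift.
  apply: filterS L_good => w gw; rewrite /=.
  rewrite (_ : fdd _ _ _ = Psi (shift k w))//.
  by apply: eq_from_tnth => i; rewrite !tnth_mktuple FLOU_functional.
have t0 : (fun i => t i + 0) = t by apply/funext => i; rewrite addr0.
by rewrite -[in LHS]t0 !E; exact: L_law.
Qed.

Lemma stationary1 X s t : stationary P X -> eq_in_law P (X s) (X t).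
Proof.
move=> sX; have := sX 1%N (fun=> s) (t - s); rewrite subrKC => h.
by apply: eq_in_law_fdd1 (h _) => i j; rewrite !ord1.
Qed.

Lemma stationary_tail X (s a : R) : stationary P X ->
  P [set w | (a < `|X s w|)%R] = P [set w | (a < `|X 0 w|)%R].
Proof. by move=> sX; exact: stationary1 sX _ (measurable_norm_gt a). Qed.

Lemma stationary_solution_unique (Z X Y : R -> Omega -> R) :
  pathwise_solution P lam Z X -> stationary P X ->
  pathwise_solution P lam Z Y -> stationary P Y ->
  {ae P, forall w, forall t, X t w = Y t w}.
Proof.
move=> [mX cX eX] sX [mY cY eY] sY.
pose D t w := X t w - Y t w.
have DE : {ae P, forall w, forall t, D t w = expR (- lam * t) * D 0 w}.
  apply: filterS2 (filterI cX cY) (filterI eX eY) => w [cx cy] [ex ey].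
  apply: linear_ode_unique => [t|s t st]; first by apply: cvgB; [exact: cx|exact: cy].
  rewrite RintegralB//; try exact: continuous_integrable_itv.
  by rewrite /D mulrBr; have := ex s t st; have := ey s t st; lra.
have mX' t : measurable_fun setT (X t) by exact: mX.
have mY' t : measurable_fun setT (Y t) by exact: mY.
have mD t : measurable_fun setT (D t) by exact: measurable_funB.
have mgt (V : Omega -> R) a : measurable_fun setT V -> measurable [set w | a < `|V w|].
  by move=> mV; exact: (measurable_preim mV (measurable_norm_gt a)).
have D0 k : P [set w | (k.+1%:R^-1 < `|D 0 w|)%R] = 0%E.
  pose e : R := k.+1%:R^-1; have e0 : 0 < e by rewrite invr_gt0.
  have bound j : (P [set w | (e < `|D 0 w|)%R] <=
      P [set w | (j%:R < `|X 0 w|)%R] + P [set w | (j%:R < `|Y 0 w|)%R])%E.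
    (* Far enough in the past a difference larger than [e] at time 0 is amplified beyond 2 j; the
       choice of [n] comes from [expR x >= 1 + x]. *)
    have [n hn] : exists n : R, 2 * j%:R <= expR (lam * n) * e.
      exists (2 * j%:R / (lam * e)).
      apply: (@le_trans _ _ (lam * (2 * j%:R / (lam * e)) * e)).
        by rewrite le_eqVlt; apply/orP; left; apply/eqP; field; rewrite !gt_eqF.
      rewrite ler_pM2r//; apply: le_trans (expR_ge1Dx _); by rewrite lerDr.
    rewrite -(stationary_tail (- n) _ sX) -(stationary_tail (- n) _ sY).
    apply: (@le_trans _ _ (P ([set w | j%:R < `|X (- n) w|] `|` [set w | j%:R < `|Y (- n) w|]))).
      have -> : P [set w | e < `|D 0 w|] = P [set w | expR (lam * n) * e < `|D (- n) w|].
        apply: ae_eq_measure; [exact: mgt|exact: mgt|].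
        apply: filterS DE => w hw /=; rewrite (hw (- n)) mulrN mulNr opprK normrM.
        by rewrite (ger0_norm (expR_ge0 _)) ltr_pM2l// expR_gt0.
      apply: le_measure; rewrite ?inE; [exact: mgt|by apply: measurableU; exact: mgt|].
      move=> w /= h; have [hx|hx] := ltP j%:R `|X (- n) w|; [by left|right].
      by have := ler_normB (X (- n) w) (Y (- n) w); rewrite -/(D _ _); lra.
    by apply: measureU2; exact: mgt.
  apply/eqP; rewrite -measure_le0.
  have lim0 : (P [set w | (j%:R < `|X 0 w|)%R] + P [set w | (j%:R < `|Y 0 w|)%R])%E
      @[j --> \oo] --> (0 + 0)%E by apply: cvgeD => //; exact: tail_cvg0.
  rewrite adde0 in lim0; rewrite -[leRHS](cvg_lim _ lim0)//; apply: lime_ge.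
    by apply/cvg_ex; eexists; exact: lim0.
  by apply: nearW => j; exact: bound.
have D0N : P.-negligible (\bigcup_k [set w | k.+1%:R^-1 < `|D 0 w|]).
  apply: negligible_bigcup => k.
  by exists [set w | k.+1%:R^-1 < `|D 0 w|]; split; [exact: mgt|exact: D0|].
have D0ae : {ae P, forall w, D 0 w = 0}.
  apply: negligibleS D0N => w /= /eqP; rewrite -normr_gt0 => n0.
  have [k _ hk] := near_infty_natSinv_lt (PosNum n0).
  by exists k => //; exact: hk k (leqnn _).
apply: filterS2 DE D0ae => w h h0 t.
by apply/eqP; rewrite -subr_eq0 -/(D t w) h h0 mulr0.
Qed.

End FractionalLevyOU.

Theorem theorem3p7 (R : realType) (disp : measure_display)
    (Omega : measurableType disp) (P : probability Omega R)
    (P_complete : measure_is_complete P)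
    (d lam : R) (d_gt0 : 0 < d) (d_lt_half : d < 2^-1) (lam_gt0 : 0 < lam)
    (L : R -> Omega -> R) (L_driving : driving_Levy P L) :
  let Ld := FLP d L in
  let LOU := FLOU lam Ld in
  [/\ {ae P, forall w, forall t : R,
        is_RS_int_ninfty (fun u => expR (- lam * (t - u))) (Ld ^~ w) t
          (LOU t w)},
      pathwise_solution P lam Ld LOU,
      stationary P LOU &
      forall X : R -> Omega -> R,
        pathwise_solution P lam Ld X -> stationary P X ->
        {ae P, forall w, forall t, X t w = LOU t w}].
Proof.
move=> Ld LOU.
have [[L1 [L2 [L1P L2P L12 Lind LE]]] _ EL EL2] := L_driving.
(* The midpoint of 1/2 and [1 - d]. *)
pose b : R := 3 / 4 - d / 2.
have d1 : d < 1 by lra.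
have b0 : 0 <= b by rewrite /b; lra.
have b1 : b < 1 - d by rewrite /b; lra.
have hb : 2^-1 < b by rewrite /b; lra.
have mL t : measurable_fun setT (L t).
  by rewrite LE; exact: (measurable_two_sided P_complete L1P L2P).
have gL : {ae P, forall w, exists C, good_path b C (L ^~ w)}.
  rewrite LE; apply: driving_Levy_good_path => //; rewrite -LE//.
have law h1 h2 (A : set (@path_space R R)) : measurable A ->
    P ((fun w s => L (s + h1) w - L h1 w) @^-1` A) =
    P ((fun w s => L (s + h2) w - L h2 w) @^-1` A).
  by rewrite LE; exact: (two_sided_stationary_increments P_complete L1P L2P L12 Lind).
have sol := FLOU_solution P_complete d_gt0 d1 b0 b1 lam_gt0 mL gL.
have sta := FLOU_stationary P_complete d_gt0 d1 b0 b1 lam_gt0 mL gL law.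
have rs := FLOU_is_RS_int d_gt0 d1 b0 b1 lam_gt0 gL.
split => //.
by move=> X solX staX; exact: (stationary_solution_unique lam_gt0 solX staX sol sta).
Qed.
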